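(* The bi-algebra $\mathcal{A}^w(\uparrow)$ is the bi-algebra of polynomials in the diagrams $D_L$, $D_R$ and $w_k$ (for $k\ge1$), where $\deg D_L=\deg D_R=1$ and $\deg w_k=k$, subject to the one relation $w_1=D_L-D_R$. Thus $\mathcal{A}^w(\uparrow)$ has two generators in degree $1$ and one generator in every degree greater than $1$.
   Context: All vector spaces are over $\mathbb{Q}$. **Arrow diagrams.** An arrow diagram is an oriented line (the skeleton) with finitely many arrows with distinct endpoints on it, up to orientation-preserving diffeomorphism; its degree is the number of arrows. $\mathcal{A}^w(\uparrow)$ is the graded space of formal linear combinations of arrow diagrams modulo: - TC: exchanging two tails that are adjacent on the skeleton does not change the diagram. - $\overrightarrow{4T}$: for an arrow $\alpha$ and a second arrow $\beta$ with fixed tail, the sum of the two diagrams in which the head of $\beta$ is immediately before the tail of $\alpha$, respectively immediately before the head of $\alpha$, equals the sum of the two diagrams in which it is immediately after the tail of $\alpha$, respectively immediately after the head of $\alpha$. The product is concatenation of skeleton lines. The co-product $\Delta D$ is the sum over all ways of dividing the arrows of $D$ between a left co-factor and a right co-factor. With these, $\mathcal{A}^w(\uparrow)$ is a graded co-commutative bi-algebra. In a polynomial bi-algebra the generators are primitive. (If degree-completed spaces are used, polynomials are replaced by power series; here the uncompleted graded space is meant.) **Generators.** $D_R$ (resp. $D_L$) is the diagram with a single arrow whose tail precedes (resp. follows) its head along the skeleton. To define $w_k$ one uses diagrams with internal trivalent vertices: directed graphs attached to the skeleton, each internal vertex having two incoming edges, one designated left ($l$) and one right ($r$), and one outgoing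 edge ($o$). These represent elements of $\mathcal{A}^w(\uparrow)$ by eliminating vertices via the following rules, which give a well-defined result: - $\overrightarrow{STU}_1$: if the outgoing edge of a vertex ends on the skeleton at a point $p$, the diagram equals (the diagram with the vertex removed and edges $l,r$ ending near $p$ in the order $l$, then $r$ along the skeleton) minus (the same in the order $r$, then $l$). - $\overrightarrow{STU}_2$: if the right incoming edge $r$ of a vertex starts on the skeleton at $p$, the diagram equals (vertex and $r$ removed, with near $p$ the tail of $o$ followed by the head of $l$) minus (head of $l$ followed by tail of $o$). If instead the left incoming edge starts on the skeleton at $p$, the same holds with $l$ and $r$ exchanged and the overall sign reversed. The $k$-wheel $w_k$, $k\ge1$, is the diagram with an oriented cycle of $k$ edges through $k$ internal vertices and $k$ spokes, each spoke starting on the skeleton and ending at a cycle vertex, where at each vertex the spoke is the left incoming edge and the cycle edge is the right incoming edge, the $k$ tails being the only skeleton endpoints. The order of the tails is irrelevant by TC. *)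

(* Defs.v *)
From HB Require Import structures.
From mathcomp Require Import all_boot all_order all_algebra.
From mathcomp Require Import finmap.
From mathcomp Require Import monalg.
From mathcomp Require Import boolp.

Set Implicit Arguments.
Unset Strict Implicit.
Unset Printing Implicit Defensive.

Import GRing.Theory.
Local Open Scope fset_scope.
Local Open Scope ring_scope.
Local Open Scope quotient_scope.

Inductive span (V : lmodType rat) (R : V -> Prop) : V -> Prop :=
| span0 : span R 0
| spanD (a : rat) (r v : V) : R r -> span R v -> span R (a *: r + v).

Section Span.
Variables (V : lmodType rat) (R : V -> Prop).

Lemma span_gen r : R r -> span R r.
Proof. by move=> Rr; rewrite -[r]addr0 -[r]scale1r; apply: spanD => //; constructor. Qed.

Lemma span_add u v : span R u -> span R v -> span R (u + v).
Proof.
move=> Su Sv; elim: Su => [|a r u' Rr _ IH]; first by rewrite add0r.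
by rewrite -addrA; constructor.
Qed.

Lemma span_scale a v : span R v -> span R (a *: v).
Proof.
elim=> [|b r v' Rr _ IH]; first by rewrite scaler0; constructor.
by rewrite scalerDr scalerA; constructor.
Qed.

Lemma span_sum (I : Type) (s : seq I) (F : I -> V) :
  (forall i, span R (F i)) -> span R (\sum_(i <- s) F i).
Proof.
move=> SF; elim: s => [|i s IH]; first by rewrite big_nil; constructor.
by rewrite big_cons; apply: span_add.
Qed.

Definition spanp : {pred V} := fun v => `[< span R v >].

Lemma spanpP v : reflect (span R v) (v \in spanp).
Proof. exact: asboolP. Qed.

Lemma spanp_zmod : zmod_closed spanp.
Proof.
split; first by apply/spanpP; constructor.
move=> u v /spanpP Su /spanpP Sv; apply/spanpP/span_add => //.
by rewrite -scaleN1r; apply: span_scale.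
Qed.

HB.instance Definition _ := GRing.isZmodClosed.Build V spanp spanp_zmod.

Definition qmod := Quotient.quot spanp.
HB.instance Definition _ := GRing.Zmodule.on qmod.

Definition qpi (v : V) : qmod := \pi_qmod v.

Lemma qpi_eq u v : (qpi u = qpi v) <-> span R (u - v).
Proof.
rewrite /qpi; split=> [/eqP|/spanpP].
  by rewrite -Quotient.idealrBE => /spanpP.
by rewrite Quotient.idealrBE => /eqP.
Qed.

Lemma qpi_surj x : exists v, x = qpi v.
Proof. by exists (repr x); rewrite /qpi reprK. Qed.


Definition qscale (a : rat) (x : qmod) : qmod := qpi (a *: repr x).

Lemma qpi_repr_span v : span R (repr (qpi v) - v).
Proof. by apply/qpi_eq; rewrite /qpi reprK. Qed.

Lemma qpiZ_def a v : qscale a (qpi v) = qpi (a *: v).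
Proof. by apply/qpi_eq; rewrite -scalerBr; apply/span_scale/qpi_repr_span. Qed.

Lemma qpiD_def u v : qpi u + qpi v = qpi (u + v).
Proof. by rewrite /qpi raddfD. Qed.

Lemma qscaleA a b x : qscale a (qscale b x) = qscale (a * b) x.
Proof. by have [v ->] := qpi_surj x; rewrite !qpiZ_def scalerA. Qed.
Lemma qscale1 : left_id 1 qscale.
Proof. by move=> x; have [v ->] := qpi_surj x; rewrite qpiZ_def scale1r. Qed.
Lemma qscaleDr : right_distributive qscale +%R.
Proof.
move=> a x y; have [u ->] := qpi_surj x; have [v ->] := qpi_surj y.
by rewrite qpiD_def !qpiZ_def qpiD_def scalerDr.
Qed.
Lemma qscaleDl x : {morph qscale^~ x : a b / a + b}.
Proof.
by move=> a b; have [u ->] := qpi_surj x; rewrite !qpiZ_def qpiD_def scalerDl.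
Qed.

HB.instance Definition _ :=
  GRing.Zmodule_isLmodule.Build rat qmod qscaleA qscale1 qscaleDr qscaleDl.

Lemma qpi_linear : linear qpi.
Proof. by move=> a u v; rewrite -qpiD_def -qpiZ_def. Qed.
HB.instance Definition _ := GRing.isLinear.Build rat V qmod *:%R qpi qpi_linear.

Section Lift.
Variables (W : lmodType rat) (h : {linear V -> W}).
Hypothesis h0 : forall r, R r -> h r = 0.

Definition qlift (x : qmod) : W := h (repr x).

Lemma qliftE v : qlift (qpi v) = h v.
Proof.
apply/eqP; rewrite /qlift -subr_eq0 -linearB; apply/eqP.
elim: (qpi_repr_span v) => [|a r u Rr _ IH]; first by rewrite linear0.
by rewrite linearP h0 // IH scaler0 addr0.
Qed.

Lemma qlift_linear : linear qlift.
Proof.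
move=> a x y; have [u ->] := qpi_surj x; have [v ->] := qpi_surj y.
by rewrite -linearP !qliftE linearP.
Qed.
End Lift.
End Span.

Section LinExt.
Variables (K : choiceType) (W : lmodType rat).

Definition linext (h : K -> W) (v : {malg rat[K]}) : W :=
  \sum_(k <- msupp v) v@_k *: h k.

Lemma linextEw h (d : {fset K}) v : msupp v `<=` d ->
  linext h v = \sum_(k <- d) v@_k *: h k.
Proof.
move=> le; rewrite /linext (big_fset_incl _ le) // => k _ /mcoeff_outdom ->.
by rewrite scale0r.
Qed.

Lemma linext_linear h : linear (linext h).
Proof.
move=> a u v; set d := msupp u `|` msupp v `|` msupp (a *: u + v).
rewrite !(@linextEw h d) ?scaler_sumr -?big_split /=.
- apply: eq_bigr => k _; by rewrite mcoeffD mcoeffZ scalerDl scalerA.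
- by rewrite /d -fsetUA fsetUCA fsubsetUl.
- by rewrite /d -fsetUA fsubsetUl.
- by rewrite fsubsetUr.
Qed.
HB.instance Definition _ h :=
  GRing.isLinear.Build rat {malg rat[K]} W *:%R (linext h) (linext_linear h).

Lemma linextU h k : linext h << k >> = h k.
Proof.
by rewrite (@linextEw h [fset k]) ?msuppU_le // big_seq_fset1 mcoeffUU scale1r.
Qed.

Lemma malg_lin_ext (f g : {linear {malg rat[K]} -> W}) :
  (forall k, f << k >> = g << k >>) -> f =1 g.
Proof.
move=> fg v; rewrite [v]monalgE !linear_sum; apply: eq_bigr => k _.
have -> : << v@_k *g k >> = v@_k *: << k >> :> {malg rat[K]}.
  by apply/malgP => j; rewrite mcoeffZ !mcoeffU mulr_natr.
by rewrite !linearZ fg.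
Qed.
End LinExt.

Section Tensor.
Variables (U V : lmodType rat).

Definition pure (u : U) (v : V) : {malg rat[(U * V)%type]} := << (u, v) >>.

Inductive bilin_rel : {malg rat[(U * V)%type]} -> Prop :=
| bilin_l a u u' v :
    bilin_rel (pure (a *: u + u') v - a *: pure u v - pure u' v)
| bilin_r a u v v' :
    bilin_rel (pure u (a *: v + v') - a *: pure u v - pure u v').

Notation tensor := (qmod bilin_rel).

Definition tens (u : U) (v : V) : tensor := qpi bilin_rel (pure u v).

Lemma tens_linear_l v : linear (tens^~ v).
Proof.
move=> a u u'; apply/eqP; rewrite -subr_eq0 /tens.
rewrite opprD addrA -linearZ -!linearB; apply/eqP.
rewrite -[RHS](linear0 (qpi bilin_rel)); apply/qpi_eq; rewrite subr0.
exact/span_gen/bilin_l.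
Qed.

Lemma tens_linear_r u : linear (tens u).
Proof.
move=> a v v'; apply/eqP; rewrite -subr_eq0 /tens.
rewrite opprD addrA -linearZ -!linearB; apply/eqP.
rewrite -[RHS](linear0 (qpi bilin_rel)); apply/qpi_eq; rewrite subr0.
exact/span_gen/bilin_r.
Qed.

Section TLift.
Variables (W : lmodType rat) (b : U -> V -> W).
Definition tlift : tensor -> W := qlift (linext (fun p => b p.1 p.2)).

Hypotheses (bl : forall v, linear (b^~ v)) (br : forall u, linear (b u)).

Lemma linext_pure u v : linext (fun p => b p.1 p.2) (pure u v) = b u v.
Proof. exact: linextU. Qed.

Lemma tlift_rel r : bilin_rel r -> linext (fun p => b p.1 p.2) r = 0.
Proof.
case=> a x y z; rewrite !linearB linearZ /= !linext_pure.
  by rewrite bl addrAC addrK subrr.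
by rewrite br addrAC addrK subrr.
Qed.

Lemma tliftE u v : tlift (tens u v) = b u v.
Proof. by rewrite /tlift /tens qliftE; [exact: linext_pure | exact: tlift_rel]. Qed.

Lemma tlift_linear : linear tlift.
Proof. by apply: qlift_linear; exact: tlift_rel. Qed.
End TLift.

Lemma tensor_ind (P : tensor -> Prop) : P 0 ->
  (forall a u v t, P t -> P (a *: tens u v + t)) -> forall t, P t.
Proof.
move=> P0 PD t; have [v ->] := qpi_surj t; rewrite [v]monalgE.
elim: (msupp v : seq _) => [|[u w] s IH]; first by rewrite big_nil linear0.
rewrite big_cons linearD /=.
have -> : << v@_(u, w) *g (u, w) >> = v@_(u, w) *: pure u w.
  by apply/malgP => j; rewrite mcoeffZ !mcoeffU mulr_natr.
by rewrite linearZ; apply: PD.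
Qed.
End Tensor.
Notation tensor U V := (qmod (@bilin_rel U V)).

Section TensorMap.
Variables (U U' V V' : lmodType rat) (f : U -> V) (g : U' -> V').

Definition tmap : tensor U U' -> tensor V V' :=
  tlift (fun u u' => tens (f u) (g u')).

Hypotheses (lf : linear f) (lg : linear g).

Lemma tmapE u u' : tmap (tens u u') = tens (f u) (g u').
Proof.
apply: (tliftE (b := fun u u' => tens (f u) (g u'))) => ? a x y.
  by rewrite lf tens_linear_l.
by rewrite lg tens_linear_r.
Qed.

Lemma tmap_linear : linear tmap.
Proof.
apply: (tlift_linear (b := fun u u' => tens (f u) (g u'))) => ? a x y.
  by rewrite lf tens_linear_l.
by rewrite lg tens_linear_r.
Qed.
End TensorMap.

Lemma tensor_ext (U V W : lmodType rat) (f g : tensor U V -> W) :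
  linear f -> linear g -> (forall u v, f (tens u v) = g (tens u v)) -> f =1 g.
Proof.
move=> lf lg fg; apply: tensor_ind => [|a u v t IH]; last by rewrite lf lg fg IH.
by rewrite -[0](addNr 0) -scaleN1r lf lg !scaleN1r !addNr.
Qed.

Section TensorMul.
Variables (A B : algType rat).

Definition tmul (x y : tensor A B) : tensor A B :=
  tlift (fun a b => tmap ( *%R a) ( *%R b) y) x.

Lemma mull_linear (C : algType rat) (a : C) : linear ( *%R a).
Proof. by move=> k x y; rewrite mulrDr scalerAr. Qed.
#[local] Hint Resolve mull_linear : core.

Let L (a : A) (b : B) := tmap_linear (mull_linear a) (mull_linear b).

Lemma lin_comb (V : lmodType rat) (k c : rat) (x y z t : V) :
  k *: (c *: x + y) + (c *: z + t) = c *: (k *: x + z) + (k *: y + t).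
Proof. by rewrite !scalerDr !scalerA [c * k]mulrC addrACA. Qed.

Lemma tmul_lin_l y (b : B) : linear (fun a : A => tmap ( *%R a) ( *%R b) y).
Proof.
move=> k a a'; move: y; apply: tensor_ext => [|c x y|u v].
- exact: L.
- by rewrite (L a b c x y) (L a' b c x y); exact: lin_comb.
- rewrite !(tmapE (mull_linear _) (mull_linear _)) mulrDl -scalerAl.
  exact: tens_linear_l.
Qed.

Lemma tmul_lin_r y (a : A) : linear (fun b : B => tmap ( *%R a) ( *%R b) y).
Proof.
move=> k b b'; move: y; apply: tensor_ext => [|c x y|u v].
- exact: L.
- by rewrite (L a b c x y) (L a b' c x y); exact: lin_comb.
- rewrite !(tmapE (mull_linear _) (mull_linear _)) mulrDl -scalerAl.
  exact: tens_linear_r.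
Qed.

Lemma tmulE a b y : tmul (tens a b) y = tmap ( *%R a) ( *%R b) y.
Proof.
rewrite /tmul (tliftE (b := fun a b => tmap ( *%R a) ( *%R b) y)) //.
- by move=> c; apply: tmul_lin_l.
- by move=> c; apply: tmul_lin_r.
Qed.

Lemma tmul_tens a b a' b' :
  tmul (tens a b) (tens a' b') = tens (a * a') (b * b').
Proof. by rewrite tmulE (tmapE (mull_linear _) (mull_linear _)). Qed.

Lemma tmul_linear_l y : linear (tmul^~ y).
Proof.
apply: (tlift_linear (b := fun a b => tmap ( *%R a) ( *%R b) y)) => c.
- exact: tmul_lin_l.
- exact: tmul_lin_r.
Qed.

Lemma tmul_linear_r x : linear (tmul x).
Proof.
move=> k y y'; move: x; apply: tensor_ext => [|c x z|a b].
- exact: tmul_linear_l.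
- by rewrite (tmul_linear_l y c x z) (tmul_linear_l y' c x z); exact: lin_comb.
- by rewrite !tmulE; exact: L.
Qed.
End TensorMul.

(* The word of the arrow endpoints met along the skeleton: (true, a) is the
   tail and (false, a) the head of the arrow named a.  Names are immaterial:
   they are identified by the relation [relabel] below. *)
Definition gauss (w : seq (bool * nat)) : bool :=
  uniq w && all (fun x => (~~ x.1, x.2) \in w) w.

Record arrow_diag := ArrowDiag { word :> seq (bool * nat); _ : gauss word }.
HB.instance Definition _ := [isSub for word].
HB.instance Definition _ := [Choice of arrow_diag by <:].

Lemma gaussP (D : arrow_diag) : gauss D.
Proof. by case: D. Qed.

Definition map_names (f : nat -> nat) (w : seq (bool * nat)) :=
  [seq (x.1, f x.2) | x <- w].

Definition names (w : seq (bool * nat)) : seq nat := [seq x.2 | x <- w].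

Definition wnext (w : seq (bool * nat)) : nat := (\max_(x <- w) x.2.+1)%N.

Definition wcat (w w' : seq (bool * nat)) :=
  w ++ map_names (addn (wnext w)) w'.

Lemma next_cat w w' : wnext (w ++ w') = maxn (wnext w) (wnext w').
Proof. by rewrite /wnext big_cat. Qed.

Lemma next_cons x w : wnext (x :: w) = maxn x.2.+1 (wnext w).
Proof. exact: big_cons. Qed.

Lemma next_shift n w : w != [::] -> wnext (map_names (addn n) w) = (n + wnext w)%N.
Proof.
elim: w => // x [|y w] IH _; first by rewrite !next_cons /wnext !big_nil !maxn0 addnS.
by rewrite [LHS]next_cons [wnext (x :: _)]next_cons IH // addn_maxr addnS.
Qed.

Lemma next_wcat w w' : wnext (wcat w w') = (wnext w + wnext w')%N.
Proof.
case: w' => [|x w']; first by rewrite /wcat cats0 /wnext big_nil addn0.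
by rewrite /wcat next_cat next_shift // (maxn_idPr _) // leq_addr.
Qed.

Lemma map_names_comp f g w : map_names f (map_names g w) = map_names (f \o g) w.
Proof. by rewrite /map_names -map_comp. Qed.

Lemma wcatA : associative wcat.
Proof.
move=> u v w; rewrite /wcat -/(wcat u v) next_wcat /map_names map_cat catA.
congr (_ ++ _); rewrite -map_comp; apply: eq_map => x /=.
by rewrite addnA.
Qed.

Lemma wcat0w : left_id [::] wcat.
Proof. by move=> w; rewrite /wcat /wnext big_nil -[RHS]map_id; apply: eq_map; case. Qed.

Lemma wcatw0 : right_id [::] wcat.
Proof. by move=> w; rewrite /wcat cats0. Qed.

Lemma names_lt w a : a \in names w -> (a < wnext w)%N.
Proof.
move=> /mapP[x xw ->]; rewrite /wnext.
elim: w xw => // y w IH; rewrite inE big_cons leq_max => /orP[/eqP->|/IH ->].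
  by rewrite leqnn.
by rewrite orbT.
Qed.

Lemma gauss_map f w : {in names w &, injective f} -> gauss w ->
  gauss (map_names f w).
Proof.
move=> fI /andP[Uw /allP Aw]; apply/andP; split.
  rewrite map_inj_in_uniq // => -[b x] [c y] xw yw [-> E].
  by rewrite (fI x y _ _ E) //; apply/mapP; [exists (b, x) | exists (c, y)].
apply/allP => _ /mapP[x /Aw xw ->]; apply/mapP.
by exists (~~ x.1, x.2).
Qed.

Lemma gauss_wcat w w' : gauss w -> gauss w' -> gauss (wcat w w').
Proof.
move=> Gw Gw'.
have /andP[Us As] : gauss (map_names (addn (wnext w)) w').
  by apply: gauss_map Gw' => a b _ _ /addnI.
have /andP[Uw Aw] := Gw.
rewrite /gauss cat_uniq Uw Us andbT /=; apply/andP; split.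
  apply/hasPn => _ /mapP[y _ ->] /=; apply/negP => yw.
  have := @names_lt w (wnext w + y.2); rewrite ltnNge leq_addr => /(_ _)/negP [] //.
  by apply/mapP; exists (y.1, wnext w + y.2)%N.
rewrite all_cat; apply/andP; split; [move: Aw | move: As]; apply: sub_all => x;
  by rewrite mem_cat => ->; rewrite ?orbT.
Qed.

Definition ad_mul (D D' : arrow_diag) : arrow_diag :=
  ArrowDiag (gauss_wcat (gaussP D) (gaussP D')).
Definition ad_one : arrow_diag := @ArrowDiag [::] isT.

Lemma ad_mulA : associative ad_mul.
Proof. by move=> *; apply: val_inj; rewrite /= wcatA. Qed.
Lemma ad_mul1m : left_id ad_one ad_mul.
Proof. by move=> *; apply: val_inj; rewrite /= wcat0w. Qed.
Lemma ad_mulm1 : right_id ad_one ad_mul.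
Proof. by move=> *; apply: val_inj; rewrite /= wcatw0. Qed.
Lemma ad_unitm D D' : ad_mul D D' = ad_one -> D = ad_one /\ D' = ad_one.
Proof.
move=> /(congr1 (size \o val)) /=; rewrite size_cat size_map => /eqP.
by rewrite addn_eq0 => /andP[/nilP E1 /nilP E2]; split; apply: val_inj.
Qed.
HB.instance Definition _ :=
  Choice_isMonomialDef.Build arrow_diag ad_mulA ad_mul1m ad_mulm1 ad_unitm.

Definition ad (D : arrow_diag) : {malg rat[arrow_diag]} := << D >>.

(* In [fourT] the arrow named a is alpha and the one named b is beta; the
   word u ++ tl a :: v = u' ++ hd a :: v' is the diagram without the head of
   beta. *)
Notation tl a := (true, a).
Notation hd a := (false, a).

Inductive aw_rel : {malg rat[arrow_diag]} -> Prop :=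
| relabel (D D' : arrow_diag) f : {in names D &, injective f} ->
    word D' = map_names f D -> aw_rel (ad D - ad D')
| TC (D D' : arrow_diag) u v a b :
    word D = u ++ tl a :: tl b :: v -> word D' = u ++ tl b :: tl a :: v ->
    aw_rel (ad D - ad D')
| fourT (D1 D2 D3 D4 : arrow_diag) u v u' v' a b :
    u ++ tl a :: v = u' ++ hd a :: v' ->
    word D1 = u ++ hd b :: tl a :: v -> word D2 = u' ++ hd b :: hd a :: v' ->
    word D3 = u ++ tl a :: hd b :: v -> word D4 = u' ++ hd a :: hd b :: v' ->
    aw_rel (ad D1 + ad D2 - (ad D3 + ad D4)).

Lemma adM D D' : ad D * ad D' = ad (ad_mul D D').
Proof. by rewrite /ad malgM_def fgmulUU mulr1. Qed.

Lemma map_names_cat f u v : map_names f (u ++ v) = map_names f u ++ map_names f v.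
Proof. exact: map_cat. Qed.

Lemma next_swap u v x y : wnext (u ++ x :: y :: v) = wnext (u ++ y :: x :: v).
Proof. by rewrite !(next_cat, next_cons); congr maxn; exact: maxnCA. Qed.

Lemma next_ins u v x : wnext (u ++ x :: v) = maxn x.2.+1 (wnext (u ++ v)).
Proof. by rewrite !(next_cat, next_cons) maxnCA. Qed.

Lemma aw_rel_mull D r : aw_rel r -> aw_rel (ad D * r).
Proof.
case.
- move=> D1 D2 f fI E; rewrite mulrBr !adM.
  pose g x := if (x < wnext D)%N then x else (wnext D + f (x - wnext D))%N.
  apply: (@relabel _ _ g) => [x y|] /=; last first.
    rewrite /wcat map_names_cat E !map_names_comp; congr (_ ++ _).
      rewrite -[LHS]map_id; apply/eq_in_map => -[c x] xD /=.
      by rewrite /g names_lt //; apply/mapP; exists (c, x).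
    by apply: eq_map => x; rewrite /g /= ltnNge leq_addr /= addKn.
  rewrite /g /wcat /names map_cat !mem_cat => xN yN.
  have Hin z : (z < wnext D)%N = false ->
      (z \in [seq x0.2 | x0 <- word D])
      || (z \in [seq x0.2 | x0 <- map_names (addn (wnext D)) D1]) ->
      (z - wnext D)%N \in names D1 /\ (wnext D <= z)%N.
    move=> zD /orP[/names_lt|/mapP[_ /mapP[x1 x1D ->] ->] /=]; rewrite ?zD //.
    by rewrite addKn leq_addr; split=> //; apply/mapP; exists x1.
  case: ifP => xD; case: ifP => yD //.
  - by move=> E1; move: xD; rewrite E1 ltnNge leq_addr.
  - by move=> E1; move: yD; rewrite -E1 ltnNge leq_addr.
  - have [xN' lx] := Hin _ xD xN; have [yN' ly] := Hin _ yD yN.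
    by move=> /addnI /fI => /(_ xN' yN') E1; rewrite -(subnKC lx) E1 subnKC.
- move=> D1 D2 u v a b E1 E2; rewrite mulrBr !adM.
  apply: (@TC _ _ (wcat D u) (map_names (addn (wnext D)) v)
     (wnext D + a)%N (wnext D + b)%N); rewrite /= /wcat ?E1 ?E2 map_names_cat catA //.
- move=> D1 D2 D3 D4 u v u' v' a b E E1 E2 E3 E4.
  rewrite mulrBr !mulrDr !adM.
  apply: (@fourT _ _ _ _ (wcat D u) (map_names (addn (wnext D)) v)
     (wcat D u') (map_names (addn (wnext D)) v')
     (wnext D + a)%N (wnext D + b)%N);
    rewrite /= /wcat ?E1 ?E2 ?E3 ?E4 ?map_names_cat -?catA //.
  by congr (_ ++ _); move/(congr1 (map_names (addn (wnext D)))): E; rewrite !map_names_cat.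
Qed.

Lemma aw_rel_mulr D r : aw_rel r -> aw_rel (r * ad D).
Proof.
case.
- move=> D1 D2 f fI E; rewrite mulrBl !adM.
  pose g x := if (x < wnext D1)%N then f x else (wnext D2 + (x - wnext D1))%N.
  have HN z : z \in names (wcat D1 D) -> (z < wnext D1)%N -> z \in names D1.
    rewrite /wcat /names map_cat mem_cat => /orP[//|].
    by case/mapP=> _ /mapP[x1 _ ->] -> /=; rewrite ltnNge leq_addr.
  have HN2 z : z \in names D1 -> (f z < wnext D2)%N.
    move=> /mapP[x xD ->]; apply: names_lt; rewrite E.
    by apply/mapP; exists (x.1, f x.2) => //; apply/mapP; exists x.
  apply: (@relabel _ _ g) => [x y|] /=; last first.
    rewrite /wcat map_names_cat [in X in X ++ _]E !map_names_comp; congr (_ ++ _).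
      apply/eq_in_map => -[c x] xD /=.
      by rewrite /g names_lt //; apply/mapP; exists (c, x).
    by apply: eq_map => x; rewrite /g /= ltnNge leq_addr /= addKn.
  move=> /HN xN /HN yN; rewrite /g; case: ifP => xD; case: ifP => yD.
  - by apply: fI; [apply: xN | apply: yN].
  - by move=> E1; have := HN2 _ (xN xD); rewrite E1 ltnNge leq_addr.
  - by move=> E1; have := HN2 _ (yN yD); rewrite -E1 ltnNge leq_addr.
  - move/addnI => E1; rewrite -(@subnKC (wnext D1) x) 1?leqNgt ?xD // E1.
    by rewrite subnKC // leqNgt yD.
- move=> D1 D2 u v a b E1 E2; rewrite mulrBl !adM.
  have N : wnext D2 = wnext D1.
    by rewrite E1 E2 next_swap.
  apply: (@TC _ _ u (v ++ map_names (addn (wnext D1)) D) a b);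
    by rewrite /= /wcat ?N ?E1 ?E2 -catA.
- move=> D1 D2 D3 D4 u v u' v' a b E E1 E2 E3 E4.
  rewrite mulrBl !mulrDl !adM.
  have N2 : wnext D2 = wnext D1 by rewrite E1 E2 !(next_ins _ _ (hd b)) E.
  have N3 : wnext D3 = wnext D1 by rewrite E1 E3 next_swap.
  have N4 : wnext D4 = wnext D1 by rewrite -N2 E2 E4 next_swap.
  apply: (@fourT _ _ _ _ u (v ++ map_names (addn (wnext D1)) D)
     u' (v' ++ map_names (addn (wnext D1)) D) a b);
    rewrite /= /wcat ?N2 ?N3 ?N4 ?E1 ?E2 ?E3 ?E4 -?catA //.
  by rewrite -!cat_cons !catA E.
Qed.

Lemma ad_ind (P : {malg rat[arrow_diag]} -> Prop) : P 0 ->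
  (forall a D v, P v -> P (a *: ad D + v)) -> forall v, P v.
Proof.
move=> P0 PD v; rewrite [v]monalgE.
elim: (msupp v : seq _) => [|D s IH]; first by rewrite big_nil.
rewrite big_cons.
have -> : << v@_D *g D >> = v@_D *: ad D.
  by apply/malgP => j; rewrite mcoeffZ !mcoeffU mulr_natr.
exact: PD.
Qed.

Lemma malg_scalerAr (a : rat) (u v : {malg rat[arrow_diag]}) :
  a *: (u * v) = u * (a *: v).
Proof.
rewrite (@malgMEw _ _ (msupp u) (msupp v) u v) //.
rewrite (@malgMEw _ _ (msupp u) (msupp v) u (a *: v)) ?msuppZ_le //.
rewrite scaler_sumr; apply: eq_bigr => D _; rewrite scaler_sumr.
apply: eq_bigr => D' _; apply/malgP => j.
by rewrite !(mcoeffZ, mcoeffU) mulrCA mulrnAr.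
Qed.

Lemma aw_span_mull u v : span aw_rel v -> span aw_rel (u * v).
Proof.
move=> Sv; move: u; apply: ad_ind => [|a D u IH]; first by rewrite mul0r; constructor.
rewrite mulrDl -scalerAl; apply: span_add => //; apply: span_scale.
elim: Sv => [|b r w Rr _ IHw]; first by rewrite mulr0; constructor.
rewrite mulrDr -malg_scalerAr; apply: spanD => //; exact: aw_rel_mull.
Qed.

Lemma aw_span_mulr u v : span aw_rel v -> span aw_rel (v * u).
Proof.
move=> Sv; move: u; apply: ad_ind => [|a D u IH]; first by rewrite mulr0; constructor.
rewrite mulrDr -malg_scalerAr; apply: span_add => //; apply: span_scale.
elim: Sv => [|b r w Rr _ IHw]; first by rewrite mul0r; constructor.
rewrite mulrDl -scalerAl; apply: spanD => //; exact: aw_rel_mulr.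
Qed.

Definition Aw := qmod aw_rel.
HB.instance Definition _ := GRing.Lmodule.on Aw.

Definition cls (D : arrow_diag) : Aw := qpi aw_rel (ad D).

Definition aw_mul (x y : Aw) : Aw := qpi aw_rel (repr x * repr y).
Definition aw_one : Aw := qpi aw_rel 1.

Lemma aw_mulE u v : aw_mul (qpi aw_rel u) (qpi aw_rel v) = qpi aw_rel (u * v).
Proof.
apply/qpi_eq; set u' := repr _; set v' := repr _.
have -> : u' * v' - u * v = u' * (v' - v) + (u' - u) * v.
  by rewrite mulrBr mulrBl addrA addrNK.
by apply: span_add; [apply: aw_span_mull | apply: aw_span_mulr];
  apply: qpi_repr_span.
Qed.

Lemma aw_mulA : associative aw_mul.
Proof.
move=> x y z; have [u ->] := qpi_surj x; have [v ->] := qpi_surj y.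
by have [w ->] := qpi_surj z; rewrite !aw_mulE mulrA.
Qed.
Lemma aw_mul1 : left_id aw_one aw_mul.
Proof. by move=> x; have [u ->] := qpi_surj x; rewrite aw_mulE mul1r. Qed.
Lemma aw_mulr1 : right_id aw_one aw_mul.
Proof. by move=> x; have [u ->] := qpi_surj x; rewrite aw_mulE mulr1. Qed.
Lemma aw_mulDl : left_distributive aw_mul +%R.
Proof.
move=> x y z; have [u ->] := qpi_surj x; have [v ->] := qpi_surj y.
have [w ->] := qpi_surj z.
by rewrite -[qpi _ u + _]linearD !aw_mulE mulrDl linearD.
Qed.
Lemma aw_mulDr : right_distributive aw_mul +%R.
Proof.
move=> x y z; have [u ->] := qpi_surj x; have [v ->] := qpi_surj y.
have [w ->] := qpi_surj z.
by rewrite -[qpi _ v + _]linearD !aw_mulE mulrDr linearD.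
Qed.

Definition ad_counit (D : arrow_diag) : rat^o := (D == ad_one)%:R.

Lemma ad_counit_rel r : aw_rel r -> linext ad_counit r = 0.
Proof.
have E D : (D == ad_one) = (size D == 0%N) by rewrite -val_eqE /=; case: (val D).
have L D : linext ad_counit (ad D) = ad_counit D by exact: linextU.
case.
- move=> D D' f _ ED'; rewrite linearB /= !L /ad_counit !E ED' size_map; exact: subrr.
- move=> D D' u v a b E1 E2; rewrite linearB /= !L /ad_counit !E E1 E2 !size_cat.
  exact: subrr.
- move=> D1 D2 D3 D4 u v u' v' a b _ E1 E2 E3 E4.
  rewrite linearB !linearD /= !L /ad_counit !E E1 E2 E3 E4 !size_cat !addnS.
  exact: subrr.
Qed.

Definition aw_counit (x : Aw) : rat := qlift (linext ad_counit) x.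

Lemma aw_counitE D : aw_counit (cls D) = (D == ad_one)%:R.
Proof.
rewrite /aw_counit /cls qliftE; first exact: (linextU ad_counit).
exact: ad_counit_rel.
Qed.

Lemma aw_nonzero1 : aw_one != 0.
Proof.
have e1 : aw_one = cls ad_one by [].
apply/eqP => E; have := aw_counitE ad_one; rewrite -e1 E eqxx.
rewrite -(subrr (cls ad_one)) /aw_counit.
have L := qlift_linear ad_counit_rel.
by rewrite addrC -scaleN1r L scaleN1r addNr => /esym /eqP; rewrite oner_eq0.
Qed.

HB.instance Definition _ := GRing.Zmodule_isNzRing.Build Aw
  aw_mulA aw_mul1 aw_mulr1 aw_mulDl aw_mulDr aw_nonzero1.

Definition awpi (v : {malg rat[arrow_diag]}) : Aw := qpi aw_rel v.

Lemma awpiZ a v : awpi (a *: v) = a *: awpi v.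
Proof. exact: linearZ. Qed.

Lemma awpi_surj x : exists v, x = awpi v.
Proof. exact: qpi_surj. Qed.

Lemma aw_scalerAl (a : rat) (x y : Aw) : a *: (x * y) = a *: x * y.
Proof.
have [u ->] := awpi_surj x; have [v ->] := awpi_surj y.
have -> : awpi u * awpi v = awpi (u * v) by exact: aw_mulE.
have -> : a *: awpi (u * v) = awpi (a *: (u * v)) by rewrite awpiZ.
have -> : a *: awpi u = awpi (a *: u) by rewrite awpiZ.
by rewrite [RHS]aw_mulE scalerAl.
Qed.

Lemma aw_scalerAr (a : rat) (x y : Aw) : a *: (x * y) = x * (a *: y).
Proof.
have [u ->] := awpi_surj x; have [v ->] := awpi_surj y.
have -> : awpi u * awpi v = awpi (u * v) by exact: aw_mulE.
have -> : a *: awpi (u * v) = awpi (a *: (u * v)) by rewrite awpiZ.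
have -> : a *: awpi v = awpi (a *: v) by rewrite awpiZ.
by rewrite [RHS]aw_mulE malg_scalerAr.
Qed.

HB.instance Definition _ := GRing.Lmodule_isLalgebra.Build rat Aw aw_scalerAl.
HB.instance Definition _ := GRing.Lalgebra_isAlgebra.Build rat Aw aw_scalerAr.

Lemma clsM D D' : cls D * cls D' = cls (ad_mul D D').
Proof. by rewrite [LHS]aw_mulE adM. Qed.

Definition wrestr (p : pred nat) (w : seq (bool * nat)) := [seq x <- w | p x.2].

Lemma gauss_restr p w : gauss w -> gauss (wrestr p w).
Proof.
move=> /andP[Uw /allP Aw]; rewrite /gauss filter_uniq //=.
by apply/allP => x; rewrite !mem_filter => /andP[-> /Aw].
Qed.

Definition restr (p : pred nat) (D : arrow_diag) : arrow_diag :=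
  ArrowDiag (gauss_restr p (gaussP D)).

Definition arrows (D : arrow_diag) : {fset nat} := [fset a in names D].

Definition ad_comul (D : arrow_diag) : tensor Aw Aw :=
  \sum_(S <- fpowerset (arrows D))
    tens (cls (restr (fun a => a \in S) D)) (cls (restr (fun a => a \notin S) D)).

Lemma aw_rel0 r : aw_rel r -> qpi aw_rel r = 0.
Proof.
by move=> Rr; rewrite -(linear0 (qpi aw_rel)); apply/qpi_eq; rewrite subr0; apply: span_gen.
Qed.

Lemma cls_eq D D' : aw_rel (ad D - ad D') -> cls D = cls D'.
Proof. by move=> Rr; apply/qpi_eq/span_gen. Qed.

Lemma restr_eq p (D D' : arrow_diag) : wrestr p D = wrestr p D' -> cls (restr p D) = cls (restr p D').
Proof. by move=> E; congr cls; apply: val_inj. Qed.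

Lemma cls_TC p (D D' : arrow_diag) u v a b :
  word D = u ++ tl a :: tl b :: v -> word D' = u ++ tl b :: tl a :: v ->
  cls (restr p D) = cls (restr p D').
Proof.
move=> E E'; have [pab|] := boolP (p a && p b).
  case/andP: pab => pa pb; apply: cls_eq.
  apply: (@TC _ _ (wrestr p u) (wrestr p v) a b);
  by rewrite /= ?E ?E' /wrestr filter_cat /= pa pb.
move=> npab; apply: restr_eq; rewrite E E' /wrestr !filter_cat /=.
by case: (p a) npab; case: (p b).
Qed.

Lemma cls_4T p (D1 D2 D3 D4 : arrow_diag) u v u' v' a b :
  u ++ tl a :: v = u' ++ hd a :: v' ->
  word D1 = u ++ hd b :: tl a :: v -> word D2 = u' ++ hd b :: hd a :: v' ->
  word D3 = u ++ tl a :: hd b :: v -> word D4 = u' ++ hd a :: hd b :: v' ->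
  [/\ p a && p b -> cls (restr p D1) + cls (restr p D2)
                     = cls (restr p D3) + cls (restr p D4),
      ~~ (p a && p b) -> cls (restr p D1) = cls (restr p D3),
      ~~ (p a && p b) -> cls (restr p D2) = cls (restr p D4) &
      ~~ p b -> cls (restr p D1) = cls (restr p D2)].
Proof.
move=> E E1 E2 E3 E4; split.
- case/andP=> pa pb; apply/eqP; rewrite -subr_eq0; apply/eqP.
  have R : aw_rel (ad (restr p D1) + ad (restr p D2)
     - (ad (restr p D3) + ad (restr p D4))); last first.
    by have := aw_rel0 R; rewrite linearB !linearD.
  apply: (@fourT _ _ _ _ (wrestr p u) (wrestr p v) (wrestr p u') (wrestr p v') a b);
  rewrite /= ?E1 ?E2 ?E3 ?E4 /wrestr ?filter_cat /= ?pa ?pb //.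
  by move/(congr1 (wrestr p)): E; rewrite /wrestr !filter_cat /= pa.
- move=> n; apply: restr_eq; rewrite E1 E3 /wrestr !filter_cat /=.
  by case: (p a) n; case: (p b).
- move=> n; apply: restr_eq; rewrite E2 E4 /wrestr !filter_cat /=.
  by case: (p a) n; case: (p b).
- move=> /negbTE nb; apply: restr_eq; rewrite E1 E2.
  move/(congr1 (wrestr p)): E.
  by rewrite /wrestr !filter_cat /= nb.
Qed.

Lemma arrows_perm (D D' : arrow_diag) : perm_eq D D' -> arrows D = arrows D'.
Proof.
move=> /(perm_map snd) /perm_mem P; apply/fsetP => a.
by rewrite !inE /names P.
Qed.

Lemma perm_swap (u v : seq (bool * nat)) x y :
  perm_eq (u ++ x :: y :: v) (u ++ y :: x :: v).
Proof. by rewrite perm_cat2l; apply/permP => P /=; rewrite addnCA. Qed.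

Lemma perm_ins (u v : seq (bool * nat)) x :
  perm_eq (u ++ x :: v) (x :: u ++ v).
Proof. by apply/permP => P /=; rewrite !count_cat /= addnCA. Qed.

Lemma tensDl (U V : lmodType rat) (u u' : U) (v : V) :
  tens (u + u') v = tens u v + tens u' v.
Proof. by have := tens_linear_l v 1 u u'; rewrite !scale1r. Qed.

Lemma tensDr (U V : lmodType rat) (u : U) (v v' : V) :
  tens u (v + v') = tens u v + tens u v'.
Proof. by have := tens_linear_r u 1 v v'; rewrite !scale1r. Qed.

Lemma big_add4 (V : lmodType rat) (I : Type) (s : seq I) (F1 F2 F3 F4 : I -> V) :
  (forall i, F1 i + F2 i = F3 i + F4 i) ->
  \sum_(i <- s) F1 i + \sum_(i <- s) F2 i
    = \sum_(i <- s) F3 i + \sum_(i <- s) F4 i.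
Proof. by move=> F; rewrite -!big_split; apply: eq_bigr => i _; apply: F. Qed.

Section Tens4.
Variables (U V : lmodType rat) (x1 x2 x3 x4 : U) (y1 y2 y3 y4 : V).

Lemma tens4 : x1 = x3 -> x2 = x4 -> y1 = y3 -> y2 = y4 ->
  tens x1 y1 + tens x2 y2 = tens x3 y3 + tens x4 y4.
Proof. by move=> -> -> -> ->. Qed.

Lemma tens4l : x1 + x2 = x3 + x4 -> y1 = y2 -> y1 = y3 -> y2 = y4 ->
  tens x1 y1 + tens x2 y2 = tens x3 y3 + tens x4 y4.
Proof. by move=> E -> <- <-; rewrite -2!tensDl E. Qed.

Lemma tens4r : y1 + y2 = y3 + y4 -> x1 = x2 -> x1 = x3 -> x2 = x4 ->
  tens x1 y1 + tens x2 y2 = tens x3 y3 + tens x4 y4.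
Proof. by move=> E -> <- <-; rewrite -2!tensDr E. Qed.
End Tens4.

Lemma ad_comul_rel r : aw_rel r -> linext ad_comul r = 0.
Proof.
have L D : linext ad_comul (ad D) = ad_comul D by exact: linextU.
case.
- move=> D D' f fI E; rewrite linearB /= !L; apply/eqP; rewrite subr_eq0; apply/eqP.
  rewrite /ad_comul.
  have -> : arrows D' = f @` arrows D.
    apply/fsetP => a; rewrite !inE; apply/idP/imfsetP => /=.
      rewrite E /names => /mapP[_ /mapP[x xD ->] ->]; exists x.2 => //.
      by rewrite !inE; apply/mapP; exists x.
    case=> b; rewrite !inE => /mapP[x xD ->] ->; rewrite E.
    by apply/mapP; exists (x.1, f x.2) => //; apply/mapP; exists x.
  have fI' : {in arrows D &, injective f} by move=> x y; rewrite !inE; apply: fI.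
  have -> : fpowerset (f @` arrows D) =
      (fun S : {fset nat} => f @` S) @` fpowerset (arrows D).
    apply/fsetP => T; rewrite fpowersetE; apply/idP/imfsetP => /= [TS|[S]]; last first.
      by rewrite fpowersetE => ? ->; apply: subset_imfset; apply/fsubsetP.
    exists [fset a in arrows D | f a \in T].
      by rewrite fpowersetE; apply/fsubsetP => a; rewrite !inE => /andP[].
    apply/fsetP => b; apply/idP/imfsetP => /= [bT|[a]]; last first.
      by rewrite !inE => /andP[_ ?] ->.
    have /imfsetP[a /= aD bE] := fsubsetP TS _ bT.
    by exists a => //; rewrite !inE -bE bT andbT; move: aD; rewrite inE.
  rewrite [RHS]big_imfset; last first.
    move=> S T; rewrite !fpowersetE => SD TD E1; apply/fsetP => a.
    apply/idP/idP => aS.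
      have : f a \in f @` T by rewrite -E1; apply/imfsetP; exists a.
      case/imfsetP => b /= bT /fI' -> //; [exact: (fsubsetP SD) | exact: (fsubsetP TD)].
    have : f a \in f @` S by rewrite E1; apply/imfsetP; exists a.
    case/imfsetP => b /= bT /fI' -> //; [exact: (fsubsetP TD) | exact: (fsubsetP SD)].
  apply: eq_big_seq => S; rewrite fpowersetE => SD.
  have H x : x \in word D -> (f x.2 \in f @` S) = (x.2 \in S).
    move=> xD; apply/imfsetP/idP => /= [[b bS]|xS]; last by exists x.2.
    by move/fI' => -> //; [rewrite inE; apply/mapP; exists x | exact: (fsubsetP SD)].
  have N p : {in names (restr p D) &, injective f}.
    move=> x y /mapP[x' x'D ->] /mapP[y' y'D ->]; apply: fI.
      by apply/mapP; exists x' => //; move: x'D; rewrite mem_filter => /andP[].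
    by apply/mapP; exists y' => //; move: y'D; rewrite mem_filter => /andP[].
  have C p p' : (forall x, x \in word D -> p' (f x.2) = p x.2) ->
      cls (restr p D) = cls (restr p' D').
    move=> pp'; apply: cls_eq; apply: (relabel (N p)).
    rewrite /= E /wrestr /map_names filter_map; congr map.
    by apply: eq_in_filter => x xD /=; rewrite pp'.
  have C1 := C (fun a => a \in S) (fun a => a \in f @` S) H.
  have C2 : cls (restr (fun a => a \notin S) D)
          = cls (restr (fun a => a \notin f @` S) D').
    by apply: C => x /H ->.
  exact: (congr2 (@tens Aw Aw) C1 C2).
- move=> D D' u v a b E E'; rewrite linearB /= !L; apply/eqP; rewrite subr_eq0.
  apply/eqP; rewrite /ad_comul.
  have -> : arrows D' = arrows D by apply: arrows_perm; rewrite E E' perm_swap.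
  apply: eq_bigr => S _.
  by rewrite (cls_TC (fun c => c \in S) E E') (cls_TC (fun c => c \notin S) E E').
- move=> D1 D2 D3 D4 u v u' v' a b E E1 E2 E3 E4.
  have L2 D D' : linext ad_comul (ad D + ad D') = ad_comul D + ad_comul D'.
    by rewrite linearD /= !L.
  rewrite linearB /= !L2; apply/eqP; rewrite subr_eq0; apply/eqP.
  rewrite /ad_comul.
  have -> : arrows D2 = arrows D1.
    apply: arrows_perm; rewrite E2 (permPl (perm_ins _ _ _)) -E perm_sym E1.
    exact: perm_ins.
  have -> : arrows D3 = arrows D1.
    by apply: arrows_perm; rewrite E3 E1 perm_swap.
  have -> : arrows D4 = arrows D1.
    apply: arrows_perm; rewrite E4 (permPl (perm_swap _ _ _ _)).
    by rewrite (permPl (perm_ins _ _ _)) -E perm_sym E1 perm_ins.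
  apply: big_add4 => S.
  have [A1 A2 A3 A4] := cls_4T (fun c => c \in S) E E1 E2 E3 E4.
  have [B1 B2 B3 B4] := cls_4T (fun c => c \notin S) E E1 E2 E3 E4.
  case aS: (a \in S) A1 A2 A3 A4 B1 B2 B3 B4; case bS: (b \in S) => /= A1 A2 A3 A4 B1 B2 B3 B4.
  + exact: (tens4l (A1 isT) (B4 isT) (B2 isT) (B3 isT)).
  + exact: (tens4 (A2 isT) (A3 isT) (B2 isT) (B3 isT)).
  + exact: (tens4 (A2 isT) (A3 isT) (B2 isT) (B3 isT)).
  + exact: (tens4r (B1 isT) (A4 isT) (A2 isT) (A3 isT)).
Qed.

Definition aw_comul (x : Aw) : tensor Aw Aw := qlift (linext ad_comul) x.

Lemma aw_comulE D : aw_comul (cls D) = ad_comul D.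
Proof.
rewrite /aw_comul /cls qliftE; first exact: (linextU ad_comul).
exact: ad_comul_rel.
Qed.

Lemma aw_comul_linear : linear aw_comul.
Proof. exact: (qlift_linear ad_comul_rel). Qed.

(* A diagram with internal vertices: its edges are named by natural numbers;
   [skel] lists the skeleton endpoints, (true, e) where the edge e starts and
   (false, e) where it ends; a vertex (l, r, o) has left incoming edge l, right
   incoming edge r and outgoing edge o.  Every edge starts at exactly one place
   and ends at exactly one place. *)
Definition vertex : Type := (nat * nat * nat)%type.

Definition edge_starts (w : seq (bool * nat)) (vs : seq vertex) : seq nat :=
  [seq x.2 | x <- w & x.1] ++ [seq v.2 | v <- vs].
Definition edge_ends (w : seq (bool * nat)) (vs : seq vertex) : seq nat :=
  [seq x.2 | x <- w & ~~ x.1] ++ [seq v.1.1 | v <- vs] ++ [seq v.1.2 | v <- vs].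

Record tdiag := TDiag {
  skel : seq (bool * nat);
  verts : seq vertex;
  _ : uniq (edge_starts skel verts)
      && perm_eq (edge_starts skel verts) (edge_ends skel verts) }.

(* x is a value of G obtained by eliminating the vertices of G one by one, in
   some order *)
Inductive represents : tdiag -> Aw -> Prop :=
| no_vertex G D : verts G = [::] -> skel G = word D -> represents G (cls D)
| STU1 G G1 G2 x1 x2 u v vs vs' l r o :
    verts G = vs ++ (l, r, o) :: vs' -> skel G = u ++ hd o :: v ->
    verts G1 = vs ++ vs' -> skel G1 = u ++ hd l :: hd r :: v ->
    verts G2 = vs ++ vs' -> skel G2 = u ++ hd r :: hd l :: v ->
    represents G1 x1 -> represents G2 x2 -> represents G (x1 - x2)
| STU2_right G G1 G2 x1 x2 u v vs vs' l r o :
    verts G = vs ++ (l, r, o) :: vs' -> skel G = u ++ tl r :: v ->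
    verts G1 = vs ++ vs' -> skel G1 = u ++ tl o :: hd l :: v ->
    verts G2 = vs ++ vs' -> skel G2 = u ++ hd l :: tl o :: v ->
    represents G1 x1 -> represents G2 x2 -> represents G (x1 - x2)
| STU2_left G G1 G2 x1 x2 u v vs vs' l r o :
    verts G = vs ++ (l, r, o) :: vs' -> skel G = u ++ tl l :: v ->
    verts G1 = vs ++ vs' -> skel G1 = u ++ tl o :: hd r :: v ->
    verts G2 = vs ++ vs' -> skel G2 = u ++ hd r :: tl o :: v ->
    represents G1 x1 -> represents G2 x2 -> represents G (- (x1 - x2)).

(* The cycle edges of the k-wheel are 0, ..., k - 1, the spokes k, ..., 2k - 1. *)
Definition wheel_skel (k : nat) : seq (bool * nat) := [seq tl e | e <- iota k k].
Definition wheel_verts (k : nat) : seq vertex :=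
  [seq ((k + i)%N, i, (i.+1 %% k)%N) | i <- iota 0 k].

Lemma wheel_ok k : uniq (edge_starts (wheel_skel k) (wheel_verts k))
  && perm_eq (edge_starts (wheel_skel k) (wheel_verts k))
             (edge_ends (wheel_skel k) (wheel_verts k)).
Proof.
rewrite /edge_starts /edge_ends.
have -> : [seq x.2 | x <- wheel_skel k & x.1] = iota k k.
  by rewrite filter_map (eq_filter (a2 := predT)) // filter_predT -map_comp map_id.
have -> : [seq x.2 | x <- wheel_skel k & ~~ x.1] = [::].
  by rewrite filter_map (eq_filter (a2 := pred0)) // filter_pred0.
have -> : [seq v.1.1 | v <- wheel_verts k] = iota k k.
  by rewrite -map_comp -[in RHS](addn0 k) iotaDl addn0.
have -> : [seq v.1.2 | v <- wheel_verts k] = iota 0 k.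
  by rewrite -map_comp map_id.
have P : perm_eq [seq v.2 | v <- wheel_verts k] (iota 0 k).
  rewrite -map_comp; case: k => // n.
  suff -> : [seq (i.+1 %% n.+1)%N | i <- iota 0 n.+1] = rot 1 (iota 0 n.+1).
    by rewrite perm_rot.
  have E : iota 0 n.+1 = rcons (iota 0 n) n by rewrite -addn1 iotaD add0n cats1.
  rewrite {1}E map_rcons modnn rot1_cons; congr rcons.
  rewrite -/(iota (1 + 0) n) iotaDl; apply/eq_in_map => i.
  by rewrite mem_iota add0n /= => lin; rewrite add1n modn_small.
set s := map _ (wheel_verts k) in P *.
rewrite cat0s perm_cat2l P andbT.
have /perm_uniq -> : perm_eq (iota k k ++ s) (iota k k ++ iota 0 k).
  by rewrite perm_cat2l.
rewrite cat_uniq !iota_uniq andbT /=; apply/hasPn => i.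
by rewrite !mem_iota add0n => /andP[_ ik]; rewrite /= leqNgt ik.
Qed.

Definition wheel (k : nat) : tdiag := TDiag (wheel_ok k).

Record gbialg (A : algType rat) := GBialg {
  comul : A -> tensor A A;
  counit : A -> rat;
  homog : nat -> A -> Prop }.

Definition gbialg_morphism (A B : algType rat) (SA : gbialg A) (SB : gbialg B)
    (f : {lrmorphism A -> B}) : Prop :=
  [/\ forall x, comul SB (f x) = tmap f f (comul SA x),
      forall x, counit SB (f x) = counit SA x
    & forall n x, homog SA n x -> homog SB n (f x)].

(* A diagram with n arrows is a word of length 2n. *)
Definition aw_homog (n : nat) (x : Aw) : Prop :=
  exists2 v, x = awpi v & forall D : arrow_diag, D \in msupp v -> size D = n.*2.

Definition aw_bialg : gbialg Aw := GBialg aw_comul aw_counit aw_homog.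

Definition D_R : Aw := cls (@ArrowDiag [:: tl 0%N; hd 0%N] isT).
Definition D_L : Aw := cls (@ArrowDiag [:: hd 0%N; tl 0%N] isT).

(* The generators X_i are primitive and the co-product is multiplicative, which
   gives its value on a monomial. *)
Section Poly.
Variables (I : choiceType) (wt : I -> nat).

Definition poly_alg : comAlgType rat := {malg rat[{cmonom I}]}.

Definition pvar (i : I) : poly_alg := << ucm i >>.

Definition mon_comul (m : {cmonom I}) : tensor poly_alg poly_alg :=
  \big[@tmul poly_alg poly_alg/tens 1 1]_(i <- finsupp m)
    iter (m i) (tmul (tens (pvar i) 1 + tens 1 (pvar i))) (tens 1 1).

Definition poly_comul (p : poly_alg) : tensor poly_alg poly_alg :=
  linext mon_comul p.

Definition mon_deg (m : {cmonom I}) : nat := (\sum_(i <- finsupp m) m i * wt i)%N.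

Definition poly_homog (n : nat) (p : poly_alg) : Prop :=
  forall m, m \in msupp p -> mon_deg m = n.

Definition poly_bialg : gbialg poly_alg :=
  GBialg poly_comul (mcoeff (@mone {cmonom I})) poly_homog.
End Poly.

(* [gW j] is the variable for the wheel w_(s + j), where s is the smallest
   index of a wheel variable *)
Inductive gen := gL | gR | gW of nat.

Definition gen_enc (g : gen) : bool + nat :=
  match g with gL => inl true | gR => inl false | gW j => inr j end.
Definition gen_dec (c : bool + nat) : gen :=
  match c with inl true => gL | inl false => gR | inr j => gW j end.
Lemma gen_encK : cancel gen_enc gen_dec.
Proof. by case. Qed.
HB.instance Definition _ := Choice.copy gen (can_type gen_encK).

Definition gen_deg (s : nat) (g : gen) : nat := (if g is gW j then s + j else 1)%N.

Definition gbialg_iso (A B : algType rat) (SA : gbialg A) (SB : gbialg B)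
    (f : {lrmorphism A -> B}) : Prop :=
  [/\ gbialg_morphism SA SB f, bijective f
    & forall n x, homog SB n (f x) -> homog SA n x].

(* Main.v *)
(** An arrow diagram is a word in letters T_a (tails) and H_a (heads), and TC and
    4T are relations in the free algebra.  Eliminating the vertices of the wheel
    with n + 1 spokes gives T_(s_1) ... T_(s_n) [[H_(s_1), ..., [H_(s_n), H_b]], T_b].
    By 4T such a bracket commutes with the tails of all other arrows, and D_R is
    central.  Moving tails through heads, and expanding products of heads into
    iterated brackets (Lazard elimination), every diagram becomes a polynomial in
    D_R and the wheels; it follows that the wheels are central, so that the
    algebra is commutative.

    For independence, consider the Lie algebra spanned by x, y_1, ..., y_n with
    [x, y_i] = a_i y_i, acting on polynomials in t_1, ..., t_n by
    y_i = a_i d/dt_i and x = lam - sum_i a_i t_i d/dt_i, its dual acting by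
    multiplication by 1, t_1, ..., t_n.  Summing over labellings of the edges by
    basis elements gives an invariant of diagrams with vertices, compatible with
    STU, under which D_R, D_L and w_k act as the scalars lam, lam + sum_i a_i and
    sum_i a_i^k.  As (n, a, lam) vary these points form an additive set that is
    Zariski dense, so no polynomial in D_R, D_L, w_2, w_3, ... vanishes; the same
    invariant shows that the value of a wheel does not depend on the order of
    elimination. *)

Require Import Defs.
From HB Require Import structures.
From mathcomp Require Import all_boot all_order all_algebra.
From mathcomp Require Import finmap monalg.
From mathcomp Require Import zify ring.
From mathcomp Require Import boolp.

Set Implicit Arguments.
Unset Strict Implicit.
Unset Printing Implicit Defensive.

Import GRing.Theory Num.Theory.
Local Open Scope fset_scope.
Local Open Scope ring_scope.

(** The obstacle is that 4T is not a relation between elements of an algebra: it changes a diagram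
    at both ends of one arrow, however far apart these are. Two kinds of rewriting are therefore
    kept separate: relations valid in every context, which form the ideal [null], and the exchanges
    [fourT_th] and [fourT_ht], which carry the rest of the diagram along. Commutation of a tail with
    a wheel bracket is of the first kind although its proof uses the second: the correction lands on
    a head outside the bracket. The map [cl] from the free algebra is not multiplicative, because
    names may clash. The content [ct] records which letters occur; it detects words that are no
    diagrams, whose class is set to 0, and the disjointness of names under which [cl] is
    multiplicative. The Lie algebra of the independence proof is chosen for its traces: ad x has the
    eigenvalues a_i on the y_i, so a wheel, being a trace of a power of ad x, yields a power sum.
    Repeating an a_i adds points, so multiplicities, not the a_i themselves, are the coordinates
    along which density is proved. *)

Lemma linear_at0 (V W : lmodType rat) (f : V -> W) : linear f -> f 0 = 0.
Proof. by move=> lf; rewrite -[0](addNr 0) -scaleN1r lf scaleN1r addNr. Qed.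

Lemma linear_bigE (V W : lmodType rat) (f : V -> W) (I : Type) (s : seq I) (G : I -> V) :
  linear f -> f (\sum_(i <- s) G i) = \sum_(i <- s) f (G i).
Proof.
move=> lf; apply: (big_morph f _ (linear_at0 lf)) => x y.
by have := lf 1 x y; rewrite !scale1r.
Qed.

Lemma comp_linear (U V W : lmodType rat) (f : V -> W) (g : U -> V) :
  linear f -> linear g -> linear (fun x => f (g x)).
Proof. by move=> lf lg a x y; rewrite lg lf. Qed.

Lemma linear_scale (V W : lmodType rat) (f : V -> W) a x : linear f ->
  f (a *: x) = a *: f x.
Proof. by move=> lf; rewrite -[a *: x]addr0 lf (linear_at0 lf) addr0. Qed.

Lemma linearB_fun (U W : lmodType rat) (g : U -> W) x y : linear g -> g (x - y) = g x - g y.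
Proof.
by move=> lg; rewrite -scaleN1r addrC lg scaleN1r addrC.
Qed.

Lemma linearN_fun (V W : lmodType rat) (f : V -> W) : linear f -> linear (fun x => - f x).
Proof. by move=> lf a x y; rewrite lf opprD scalerN. Qed.

Lemma const0_linear (V W : lmodType rat) : linear (fun _ : V => 0 : W).
Proof. by move=> a x y; rewrite scaler0 addr0. Qed.

Lemma sum_linear (V W : lmodType rat) (I : Type) (s : seq I) (F : I -> V -> W) :
  (forall i, linear (F i)) -> linear (fun x => \sum_(i <- s) F i x).
Proof.
move=> lF a x y; rewrite scaler_sumr -big_split /=.
by apply: eq_bigr => i _; rewrite lF.
Qed.

(** * The free algebra on arrow endpoints *)

Notation letter := (bool * nat)%type.

Section MalgScale.
Variable K : monomType.

Lemma malg_scaleU (a : rat) (k : K) : << a *g k >> = a *: << k >> :> {malg rat[K]}.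
Proof. by apply/malgP => j; rewrite mcoeffZ !mcoeffU mulr_natr. Qed.

Lemma malg_expand (x : {malg rat[K]}) : x = \sum_(k <- msupp x) x@_k *: << k >>.
Proof. by rewrite {1}[x]monalgE; apply: eq_bigr => k _; rewrite malg_scaleU. Qed.

Lemma malg_scaleAr (a : rat) (x y : {malg rat[K]}) : a *: (x * y) = x * (a *: y).
Proof.
rewrite (@malgMEw _ _ (msupp x) (msupp y) x y) //.
rewrite (@malgMEw _ _ (msupp x) (msupp y) x (a *: y)) ?msuppZ_le //.
rewrite scaler_sumr; apply: eq_bigr => D _; rewrite scaler_sumr.
apply: eq_bigr => D' _; apply/malgP => j.
by rewrite !(mcoeffZ, mcoeffU) mulrCA mulrnAr.
Qed.
End MalgScale.

Definition fa_model := {malg rat[{fmonom letter}]}.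
HB.instance Definition _ := GRing.Lalgebra.on fa_model.
HB.instance Definition _ :=
  GRing.Lalgebra_isAlgebra.Build rat fa_model (@malg_scaleAr {fmonom letter}).

Record free_algebra := FreeAlgebra {
  fa_sort : algType rat;
  fa_mon : seq letter -> fa_sort;
  fa_ext : forall W : lmodType rat, (seq letter -> W) -> fa_sort -> W;
  fa_mon_cat : forall u v, fa_mon (u ++ v) = fa_mon u * fa_mon v;
  fa_mon0 : fa_mon [::] = 1;
  fa_ext_linear : forall (W : lmodType rat) (h : seq letter -> W), linear (fa_ext h);
  fa_extE : forall (W : lmodType rat) (h : seq letter -> W) w, fa_ext h (fa_mon w) = h w;
  fa_mon_ind : forall P : fa_sort -> Prop, P 0 ->
    (forall a w x, P x -> P (a *: fa_mon w + x)) -> forall x, P x }.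

(* Kept opaque: unification must not unfold the ring operations of the model. *)
Lemma free_algebra_exists : free_algebra.
Proof.
apply: (@FreeAlgebra fa_model (fun w => << FMonom w >>)
  (fun W h => linext (fun k : {fmonom letter} => h k))).
- move=> u v; rewrite malgM_def fgmulUU mulr1; congr << _ *g _ >>.
  by apply: val_inj; rewrite /= fmM.
- by congr << _ *g _ >>; apply: val_inj; rewrite /= fm1.
- by move=> W h; apply: linext_linear.
- by move=> W h w; apply: (linextU (fun k : {fmonom letter} => h k)).
move=> P P0 PD x; rewrite [x]malg_expand; elim: (msupp x : seq _) => [|[k] s IH].
  by rewrite big_nil.
by rewrite big_cons; apply: PD.
Qed.

Definition FA : algType rat := fa_sort free_algebra_exists.
Definition mon : seq letter -> FA := @fa_mon _.
Definition br (R : pzRingType) (x y : R) := x * y - y * x.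

Notation T a := (mon [:: (true, a)]).
Notation H a := (mon [:: (false, a)]).

Lemma mon_cat u v : mon (u ++ v) = mon u * mon v.
Proof. exact: fa_mon_cat. Qed.

Lemma mon0 : mon [::] = 1.
Proof. exact: fa_mon0. Qed.

Lemma mon_cons x w : mon (x :: w) = mon [:: x] * mon w.
Proof. by rewrite -mon_cat. Qed.

Lemma fa_ind (P : FA -> Prop) : P 0 ->
  (forall a w x, P x -> P (a *: mon w + x)) -> forall x, P x.
Proof. exact: fa_mon_ind. Qed.

Lemma fa_lin_ext (W : lmodType rat) (f g : FA -> W) : linear f -> linear g ->
  (forall w, f (mon w) = g (mon w)) -> f =1 g.
Proof.
move=> lf lg fg; elim/fa_ind => [|a w x IH]; first by rewrite !linear_at0.
by rewrite lf lg fg IH.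
Qed.

(* The junk value 0 makes the relations TC and 4T hold for all words. *)
Definition clw (w : seq letter) : Aw := if insub w is Some D then cls D else 0.

Lemma clwE (D : arrow_diag) : clw D = cls D.
Proof. by rewrite /clw valK. Qed.

Lemma clw_gauss w (gw : gauss w) : clw w = cls (ArrowDiag gw).
Proof. exact: (clwE (ArrowDiag gw)). Qed.

Lemma clw_ngauss w : ~~ gauss w -> clw w = 0.
Proof. by move=> ngw; rewrite /clw insubN. Qed.

(** Linear but not multiplicative: concatenating two words that share a name is not the product of
    diagrams, which renames the second factor. *)
Definition cl : FA -> Aw := fa_ext clw.
HB.instance Definition _ := GRing.isLinear.Build rat FA Aw *:%R cl
  (@fa_ext_linear _ _ clw).

Lemma clM w : cl (mon w) = clw w.
Proof. exact: fa_extE. Qed.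

Lemma cl_linear : linear cl. Proof. exact: linearP. Qed.
Lemma cl0 : cl 0 = 0. Proof. exact: linear0. Qed.
Lemma clD x y : cl (x + y) = cl x + cl y. Proof. exact: linearD. Qed.
Lemma clN x : cl (- x) = - cl x. Proof. exact: linearN. Qed.
Lemma clB x y : cl (x - y) = cl x - cl y. Proof. exact: linearB. Qed.
Lemma clZ a x : cl (a *: x) = a *: cl x. Proof. exact: linearZ. Qed.

Lemma gauss_perm w w' : perm_eq w w' -> gauss w = gauss w'.
Proof.
move=> p; rewrite /gauss (perm_uniq p) (perm_all _ p); congr (_ && _).
by apply: eq_all => x; rewrite (perm_mem p).
Qed.

(** * Relations in context: TC and 4T *)

Lemma ctx_linear_l x v : linear (fun u : FA => cl (u * x * v)).
Proof. by move=> a y z; rewrite mulrDl mulrDl -!scalerAl linearP. Qed.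

Lemma ctx_linear_r u x : linear (fun v : FA => cl (u * x * v)).
Proof. by move=> a y z; rewrite mulrDr -scalerAr linearP. Qed.

(** The largest two-sided ideal on which [cl] vanishes; a relation in it may be applied at any place
    of a word. *)
Definition null (x : FA) := forall u v, cl (u * x * v) = 0.

Lemma null_mon x : (forall u v, cl (mon u * x * mon v) = 0) -> null x.
Proof.
move=> h u v; pose z0 := fun _ : FA => 0 : Aw.
apply: (@fa_lin_ext _ _ z0 (ctx_linear_l x v) (@const0_linear FA Aw)) => w.
exact: (@fa_lin_ext _ _ z0 (ctx_linear_r (mon w) x) (@const0_linear FA Aw)).
Qed.

Lemma null0 : null 0.
Proof. by move=> u v; rewrite mulr0 mul0r cl0. Qed.
Lemma nullD x y : null x -> null y -> null (x + y).
Proof. by move=> nx ny u v; rewrite mulrDr mulrDl clD nx ny addr0. Qed.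
Lemma nullN x : null x -> null (- x).
Proof. by move=> nx u v; rewrite mulrN mulNr clN nx oppr0. Qed.
Lemma nullB x y : null x -> null y -> null (x - y).
Proof. by move=> nx ny; apply: nullD => //; apply: nullN. Qed.
Lemma nullMl x y : null x -> null (y * x).
Proof. by move=> nx u v; rewrite !mulrA nx. Qed.
Lemma nullMr x y : null x -> null (x * y).
Proof. by move=> nx u v; rewrite -!mulrA mulrA nx. Qed.
Lemma null_eq x y u v : null (x - y) -> cl (u * x * v) = cl (u * y * v).
Proof.
by move=> /(_ u v)/eqP; rewrite mulrBr mulrBl clB subr_eq0 => /eqP.
Qed.

Lemma clw_TC u v a b :
  clw (u ++ (true, a) :: (true, b) :: v) = clw (u ++ (true, b) :: (true, a) :: v).
Proof.
have p := perm_swap u v (true, a) (true, b).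
have [g|n] := boolP (gauss (u ++ (true, a) :: (true, b) :: v)); last first.
  by rewrite !clw_ngauss // -(gauss_perm p).
have g' := g; rewrite (gauss_perm p) in g'.
by rewrite (clw_gauss g) (clw_gauss g'); apply: cls_eq; apply: TC.
Qed.

Lemma TC_null a b : null (br (T a) (T b)).
Proof.
apply: null_mon => u v; rewrite /br mulrBr mulrBl clB -!mon_cat !clM.
by rewrite -!catA /= clw_TC subrr.
Qed.

Lemma clw_fourT u v u' v' a b :
  u ++ (true, a) :: v = u' ++ (false, a) :: v' ->
  clw (u ++ (false, b) :: (true, a) :: v) + clw (u' ++ (false, b) :: (false, a) :: v')
  = clw (u ++ (true, a) :: (false, b) :: v) + clw (u' ++ (false, a) :: (false, b) :: v').
Proof.
move=> E.
(* The four words are permutations of one another, so either all are Gauss words or all four terms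
   are 0. *)
have p2 : perm_eq (u ++ (false, b) :: (true, a) :: v) (u' ++ (false, b) :: (false, a) :: v').
  by rewrite (permPl (perm_ins _ _ _)) E perm_sym perm_ins.
have p3 := perm_swap u v (false, b) (true, a).
have p4 := perm_trans p2 (perm_swap u' v' (false, b) (false, a)).
have [g|n] := boolP (gauss (u ++ (false, b) :: (true, a) :: v)); last first.
  by rewrite !clw_ngauss // -?(gauss_perm p2) -?(gauss_perm p3) -?(gauss_perm p4).
have g2 := g; rewrite (gauss_perm p2) in g2.
have g3 := g; rewrite (gauss_perm p3) in g3.
have g4 := g; rewrite (gauss_perm p4) in g4.
rewrite (clw_gauss g) (clw_gauss g2) (clw_gauss g3) (clw_gauss g4).
apply/eqP; rewrite -subr_eq0; apply/eqP.
have := aw_rel0 (@fourT (ArrowDiag g) (ArrowDiag g2) (ArrowDiag g3) (ArrowDiag g4)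
  u v u' v' a b E erefl erefl erefl erefl).
by rewrite linearB !linearD.
Qed.

(** Lets 4T, known for words, be used with arbitrary elements, in particular brackets, before,
    between and after the ends of the arrow. *)
Lemma tri_linear (F G : FA -> FA -> FA -> Aw) :
  (forall m v, linear (fun u => F u m v)) -> (forall u v, linear (fun m => F u m v)) ->
  (forall u m, linear (F u m)) ->
  (forall m v, linear (fun u => G u m v)) -> (forall u v, linear (fun m => G u m v)) ->
  (forall u m, linear (G u m)) ->
  (forall u m v, F (mon u) (mon m) (mon v) = G (mon u) (mon m) (mon v)) ->
  forall u m v, F u m v = G u m v.
Proof.
move=> F1 F2 F3 G1 G2 G3 FG u m v; move: u.
apply: (fa_lin_ext (F1 m v) (G1 m v)) => u; move: m.
apply: (fa_lin_ext (F2 (mon u) v) (G2 (mon u) v)) => m; move: v.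
exact: (fa_lin_ext (F3 (mon u) (mon m)) (G3 (mon u) (mon m))).
Qed.

Lemma five_linear1 x y m v : linear (fun u => cl (u * x * m * y * v)).
Proof. by move=> a b c; rewrite !mulrDl -!scalerAl linearP. Qed.
Lemma five_linear2 x y u v : linear (fun m => cl (u * x * m * y * v)).
Proof. by move=> a b c; rewrite mulrDr !mulrDl -scalerAr -!scalerAl linearP. Qed.
Lemma five_linear3 x y u m : linear (fun v => cl (u * x * m * y * v)).
Proof. by move=> a b c; rewrite mulrDr -scalerAr linearP. Qed.

(* A head crossing the tail of an arrow is traded for its crossing the head of
   that arrow, whichever comes first along the skeleton. *)
Lemma fourT_th a b u m v :
  cl (u * br (H b) (T a) * m * H a * v) = - cl (u * T a * m * br (H b) (H a) * v).
Proof.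
move: u m v; apply: tri_linear.
- by move=> m v; apply: five_linear1.
- by move=> u v; apply: five_linear2.
- by move=> u m; apply: five_linear3.
- by move=> m v; apply/linearN_fun/five_linear1.
- by move=> u v; apply/linearN_fun/five_linear2.
- by move=> u m; apply/linearN_fun/five_linear3.
move=> u m v.
rewrite /br !(mulrBr, mulrBl) !clB -!mon_cat !clM -!catA /=.
apply/eqP; rewrite -subr_eq0 opprK addrACA -opprD subr_eq0; apply/eqP.
have := @clw_fourT u (m ++ (false, a) :: v) (u ++ (true, a) :: m) v a b.
by rewrite -!catA /=; apply.
Qed.

Lemma fourT_ht a b u m v :
  cl (u * br (H b) (H a) * m * T a * v) = - cl (u * H a * m * br (H b) (T a) * v).
Proof.
move: u m v; apply: tri_linear.
- by move=> m v; apply: five_linear1.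
- by move=> u v; apply: five_linear2.
- by move=> u m; apply: five_linear3.
- by move=> m v; apply/linearN_fun/five_linear1.
- by move=> u v; apply/linearN_fun/five_linear2.
- by move=> u m; apply/linearN_fun/five_linear3.
move=> u m v.
rewrite /br !(mulrBr, mulrBl) !clB -!mon_cat !clM -!catA /=.
apply/eqP; rewrite -subr_eq0 opprK addrACA -opprD subr_eq0; apply/eqP.
rewrite addrC [RHS]addrC.
have := @clw_fourT (u ++ (false, a) :: m) v u (m ++ (true, a) :: v) a b.
by rewrite -!catA /=; apply.
Qed.

(** * Commutators and letter content *)

Section Bracket.
Variable R : pzRingType.
Implicit Types x y z : R.

Lemma br_sym x y : br x y = - br y x.
Proof. by rewrite /br opprB. Qed.

Lemma br_jacobi x y z : br x (br y z) = br (br x y) z - br (br x z) y.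
Proof.
rewrite /br !(mulrBl, mulrBr, mulrA) !opprB.
set a := x * y * z; set b := x * z * y; set c := y * z * x; set d := z * y * x.
set e := y * x * z; set f := z * x * y.
by rewrite [RHS]addrACA !subrKA [LHS]addrACA [RHS]addrACA [- b - c]addrC.
Qed.

Lemma br_mull x y z : br (x * y) z = x * br y z + br x z * y.
Proof. by rewrite /br mulrBr mulrBl !mulrA subrKA. Qed.

Lemma brB x y z : br x (y - z) = br x y - br x z.
Proof.
rewrite /br mulrBr mulrBl !opprB addrACA [RHS]addrACA; congr (_ + _).
exact: addrC.
Qed.
End Bracket.

(** The component of multidegree [c] of the free algebra. Brackets are homogeneous, so content
    decides once for a whole expression whether its words are diagrams and which names they
    contain. *)
Definition ct (c : seq letter) : FA -> Prop :=
  Defs.span (fun y : FA => exists2 w, perm_eq w c & y = mon w).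

Lemma ct_mon w : ct w (mon w).
Proof. by apply: span_gen; exists w. Qed.

Lemma ctD c x y : ct c x -> ct c y -> ct c (x + y).
Proof. exact: span_add. Qed.
Lemma ctZ c a x : ct c x -> ct c (a *: x).
Proof. exact: span_scale. Qed.
Lemma ctB c x y : ct c x -> ct c y -> ct c (x - y).
Proof. by move=> cx cy; rewrite -scaleN1r; apply: ctD => //; apply: ctZ. Qed.
Lemma ct_perm c d x : perm_eq c d -> ct c x -> ct d x.
Proof.
move=> cd; elim=> [|a r v [w wc ->] _ IH]; first exact: span0.
by apply: spanD => //; exists w => //; apply: perm_trans cd.
Qed.

Lemma ctM c d x y : ct c x -> ct d y -> ct (c ++ d) (x * y).
Proof.
move=> cx cy; elim: cx => [|a r v [w wc ->] _ IH]; first by rewrite mul0r; apply: span0.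
rewrite mulrDl -scalerAl; apply: ctD => //; apply: ctZ.
elim: cy => [|b r' v' [w' wd ->] _ IH']; first by rewrite mulr0; apply: span0.
rewrite mulrDr -scalerAr; apply: ctD => //; apply: ctZ.
by rewrite -mon_cat; apply: (@ct_perm (w ++ w')); [apply: perm_cat | apply: ct_mon].
Qed.

Lemma ct_br c d x y : ct c x -> ct d y -> ct (c ++ d) (br x y).
Proof.
move=> cx cy; apply: ctB; first exact: ctM.
by apply: (ct_perm _ (ctM cy cx)); rewrite perm_catC.
Qed.

Lemma ct_lin_eq (W : lmodType rat) (f g : FA -> W) c : linear f -> linear g ->
  (forall w, perm_eq w c -> f (mon w) = g (mon w)) ->
  forall x, ct c x -> f x = g x.
Proof.
move=> lf lg fg x; elim=> [|a r v [w wc ->] _ IH]; first by rewrite !linear_at0.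
by rewrite lf lg fg // IH.
Qed.

(** Every word of such a content is junk; this is what allows later proofs to assume a Gauss
    content. *)
Lemma cl_ct0 c x : ~~ gauss c -> ct c x -> cl x = 0.
Proof.
move=> nc; apply: (@ct_lin_eq _ cl (fun _ => 0 : Aw) c cl_linear (@const0_linear FA Aw)).
by move=> w wc; rewrite clM clw_ngauss // (gauss_perm wc).
Qed.

(** * Renaming, products and isolated arrows *)

Lemma gauss_unmap f w : {in names w &, injective f} -> gauss (map_names f w) -> gauss w.
Proof.
move=> fI /andP[U /allP A]; rewrite /gauss (map_uniq U) /=.
apply/allP => -[b x] xw /=.
have /A : (b, f x) \in map_names f w by apply/mapP; exists (b, x).
case/mapP => -[c y] yw /= [-> E]; rewrite (fI x y) //.
  by apply/mapP; exists (b, x).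
by apply/mapP; exists (c, y).
Qed.

Lemma clw_relabel f w : {in names w &, injective f} -> clw (map_names f w) = clw w.
Proof.
move=> fI; have [g|n] := boolP (gauss w); last first.
  by rewrite !clw_ngauss //; apply: contra n; apply: gauss_unmap.
rewrite (clw_gauss (gauss_map fI g)) (clw_gauss g).
by apply/esym/cls_eq; apply: (@relabel _ _ f).
Qed.

Lemma names_cat u v : names (u ++ v) = names u ++ names v.
Proof. exact: map_cat. Qed.

(** The product of diagrams shifts the names of the second factor; when names are disjoint this
    shift is a renaming of the whole word. *)
Lemma clw_cat u v : ~~ has [in names u] (names v) -> clw (u ++ v) = clw u * clw v.
Proof.
move=> /hasPn dis.
have [/andP[gu gv]|n] := boolP (gauss u && gauss v); last first.
  have -> : clw u * clw v = 0.
    by move: n; rewrite negb_and => /orP[] n; rewrite (clw_ngauss n) ?mul0r ?mulr0.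
  (* Disjointness of names keeps both ends of an arrow in the same factor, so a Gauss concatenation
     has Gauss factors. *)
  apply: clw_ngauss; apply: contra n => /andP[]; rewrite cat_uniq => /and3P[Uu _ Uv].
  rewrite all_cat /gauss Uu Uv /= => /andP[/allP Au /allP Av].
  apply/andP; split; apply/allP => -[b x] xw.
    have := Au _ xw; rewrite mem_cat => /orP[//|/= xv].
    by have /negP[] := dis x (map_f snd xv); apply: (map_f snd xw).
  have := Av _ xw; rewrite mem_cat => /orP[/= xu|//].
  by have /negP[] := dis x (map_f snd xw); apply: (map_f snd xu).
pose g x := if x \in names u then x else (wnext u + x)%N.
have gI : {in names (u ++ v) &, injective g}.
  move=> x y _ _; rewrite /g; case: ifP => xu; case: ifP => yu //.
  - by move=> E; have := names_lt xu; rewrite E ltnNge leq_addr.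
  - by move=> E; have := names_lt yu; rewrite -E ltnNge leq_addr.
  - exact: addnI.
rewrite -(clw_relabel gI) (clw_gauss gu) (clw_gauss gv) clsM -clwE /=.
congr clw; rewrite map_names_cat /wcat; congr (_ ++ _).
  rewrite -[RHS]map_id; apply/eq_in_map => -[b x] xu /=.
  by rewrite /g (map_f snd xu).
apply/eq_in_map => -[b x] xv /=; rewrite /g ifN //.
exact: dis x (map_f snd xv).
Qed.

Lemma gauss_th w a : gauss w -> ((true, a) \in w) = ((false, a) \in w).
Proof. by move=> /andP[_ /allP A]; apply/idP/idP => /A. Qed.

Lemma names_swap f w : (forall x, x \in names w -> f x = x) -> map_names f w = w.
Proof.
move=> fid; rewrite -[RHS]map_id; apply/eq_in_map => -[b x] xw /=.
by rewrite fid //; apply: (map_f snd xw).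
Qed.

Definition swapn (a c x : nat) := if x == a then c else if x == c then a else x.
Lemma swapn_inj a c : injective (swapn a c).
Proof.
move=> x y; rewrite /swapn; do ![case: eqP => // ?]; subst=> // E; subst=> //; congruence.
Qed.

Lemma swapn_l a c : swapn a c a = c. Proof. by rewrite /swapn eqxx. Qed.
Lemma swapn_r a c : swapn a c c = a.
Proof. by rewrite /swapn eqxx; case: eqP. Qed.

Lemma map_swapn a c w : a \notin names w -> c \notin names w ->
  map_names (swapn a c) w = w.
Proof.
move=> na nc; apply: names_swap => x xw; rewrite /swapn.
by case: eqP xw na => [->->//|_ xw _]; case: eqP xw nc => [->->|].
Qed.

Lemma clw_swapn a c w : clw (map_names (swapn a c) w) = clw w.
Proof. by apply: clw_relabel => ? ? _ _ /swapn_inj. Qed.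

Lemma map_names_cons f x w : map_names f (x :: w) = (x.1, f x.2) :: map_names f w.
Proof. by []. Qed.

Lemma notin_names_cat a u v :
  (a \notin names (u ++ v)) = (a \notin names u) && (a \notin names v).
Proof. by rewrite names_cat mem_cat negb_or. Qed.

Lemma notin_names_cons a x v :
  (a \notin names (x :: v)) = (a != x.2) && (a \notin names v).
Proof. by rewrite /names /= in_cons negb_or. Qed.

Ltac perm_by_count :=
  apply/permP => ?; rewrite /= ?(count_cat, count_map) /= ?(count_cat, count_map) /=; lia.

Lemma gauss_permI w w' : gauss w -> perm_eq w w' -> gauss w'.
Proof. by move=> g /gauss_perm <-. Qed.

Lemma gauss_fresh u v w c : gauss (u ++ v ++ w) ->
  (true, c) \in v -> (false, c) \in v -> c \notin names (u ++ w).
Proof.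
move=> /andP[U _] tv hv; have {}U : uniq (v ++ u ++ w) by rewrite uniq_catCA.
apply/negP => /mapP[[b d] dw /= E]; subst d.
move: U; rewrite cat_uniq => /and3P[_ /hasPn/(_ _ dw) n _].
by case: b n {dw}; rewrite /= ?tv ?hv.
Qed.

(* In the 4T relation moving the head of an isolated arrow past a foreign tail,
   the two remaining terms agree by TC and the symmetry exchanging the arrows. *)
Lemma cl_isolated_tail u v a c : a \notin names (u ++ v) -> a != c ->
  cl (mon u * T a * br (H a) (T c) * mon v) = 0.
Proof.
move=> na ac; have [g|n] := boolP (gauss (u ++ [:: (true, a); (false, a); (true, c)] ++ v)).
  have hc : (false, c) \in u ++ v.
    have := gauss_th c g; rewrite !mem_cat !in_cons !eqxx /= !orbT => /esym.
    by rewrite !xpair_eqE /= [c == a]eq_sym (negbTE ac).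
  move: hc na g; rewrite mem_cat => /orP[] /path.splitPr[x y] na g.
    move: na; rewrite -!catA !cat_cons !notin_names_cat notin_names_cons notin_names_cat.
    case/and4P=> ax _ ay av.
    have : c \notin names ((x ++ y) ++ v).
      apply: (gauss_fresh (v := [:: (false, c); (true, a); (false, a); (true, c)])).
        by apply: (gauss_permI g); perm_by_count.
      by rewrite !inE eqxx !orbT.
      by rewrite !inE eqxx.
    rewrite !notin_names_cat -andbA => /and3P[cx cy cv].
    have E : cl (mon x * H c * (mon y * T a) * br (H a) (T c) * mon v)
      = - cl (mon x * br (H a) (H c) * (mon y * T a) * T c * mon v).
      by rewrite fourT_ht opprK.
    rewrite mon_cat (mon_cons _ y) !mulrA; rewrite ?mulrA in E.
    rewrite E /br !(mulrBl, mulrBr) clB opprB -!mon_cat !clM -!catA /=.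
    have := clw_TC (x ++ [:: (false, a), (false, c) & y]) v a c.
    rewrite -!catA /= => ->; rewrite -(clw_swapn a c) !(map_names_cat, map_names_cons) /=.
    by rewrite !swapn_l !swapn_r !map_swapn // subrr.
  move: na; rewrite !notin_names_cat notin_names_cons => /and4P[au ax _ ay].
  have : c \notin names (u ++ (x ++ y)).
    apply: (gauss_fresh (v := [:: (false, c); (true, a); (false, a); (true, c)])).
      by apply: (gauss_permI g); perm_by_count.
    by rewrite !inE eqxx !orbT.
    by rewrite !inE eqxx.
  rewrite !notin_names_cat => /and3P[cu cx cy].
  have E := fourT_th c a (mon u * T a) (mon x) (mon y).
  rewrite mon_cat (mon_cons _ y) !mulrA; rewrite ?mulrA in E.
  rewrite E /br !(mulrBl, mulrBr) clB opprB -!mon_cat !clM -!catA /=.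
  rewrite clw_TC -(clw_swapn a c) !(map_names_cat, map_names_cons) /=.
  by rewrite !swapn_l !swapn_r !map_swapn // subrr.
apply: (cl_ct0 n); rewrite -!mulrA.
apply: ctM; first exact: ct_mon.
rewrite mulrA; apply: ctM (ct_mon v).
have := ctM (ct_mon [:: (true, a)]) (ct_br (ct_mon [:: (false, a)]) (ct_mon [:: (true, c)])).
exact.
Qed.

Lemma clw_isolated_step u v a x : a \notin names (u ++ v) -> a != x.2 ->
  clw (u ++ (true, a) :: (false, a) :: x :: v)
  = clw (u ++ x :: (true, a) :: (false, a) :: v).
Proof.
move=> na; case: x => -[] c /= ac; last first.
  (* When the two ends of [a] are adjacent, the diagram with the head of [c] between them occurs on
     both sides of 4T and cancels; the head jumps over the whole arrow. *)
  have := @clw_fourT u ((false, a) :: v) (u ++ [:: (true, a)]) v a c.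
  by rewrite -!catA /= addrC => /(_ erefl)/addrI ->.
rewrite -[RHS]clw_TC; apply/eqP; rewrite -subr_eq0; apply/eqP.
rewrite -[RHS](cl_isolated_tail na ac) /br !(mulrBl, mulrBr) clB.
by rewrite -!mon_cat !clM -!catA.
Qed.

(** An isolated arrow slides letter by letter to the front of the word, where it is a separate
    factor. *)
Lemma clw_isolated u v a : a \notin names (u ++ v) ->
  clw (u ++ (true, a) :: (false, a) :: v) = D_R * clw (u ++ v).
Proof.
elim/last_ind: u v => [|u x IH] v na.
  rewrite /= -cat1s -(cat1s _ v) catA clw_cat; last first.
    by apply/hasPn => y yv; rewrite !inE orbb; apply: contra na => /eqP /= <-.
  congr (_ * _); rewrite /D_R -clwE /=.
  rewrite -(@clw_relabel (fun b => (b + a)%N) [:: (true, 0%N); (false, 0%N)]) //.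
  by move=> ? ? _ _ /addIn.
move: na; rewrite cat_rcons => na.
have [nu ax nv] : [/\ a \notin names u, a != x.2 & a \notin names v].
  by move: na; rewrite notin_names_cat notin_names_cons => /and3P[].
by rewrite !cat_rcons -clw_isolated_step ?IH // notin_names_cat nu.
Qed.

Lemma cl_isolated c d x y a : a \notin names (c ++ d) -> ct c x -> ct d y ->
  cl (x * (T a * H a) * y) = D_R * cl (x * y).
Proof.
move=> na cx cy.
have lD (f : FA -> Aw) : linear f -> linear (fun z => D_R * f z).
  by move=> lf b z t; rewrite lf mulrDr -scalerAr.
have l1 z : linear (fun x : FA => cl (x * z)).
  by move=> b u v; rewrite mulrDl -scalerAl linearP.
have l2 z : linear (fun x : FA => cl (z * x)).
  by move=> b u v; rewrite mulrDr -scalerAr linearP.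
apply: (ct_lin_eq (ctx_linear_l _ _) (lD _ (l1 y)) _ cx) => w wc.
apply: (ct_lin_eq (ctx_linear_r _ _) (lD _ (l2 _)) _ cy) => z zd.
rewrite -!mon_cat !clM -!catA clw_isolated //.
move: na; rewrite !notin_names_cat /names.
by rewrite !(perm_mem (perm_map snd wc)) !(perm_mem (perm_map snd zd)).
Qed.

Lemma cl_mul c d x y : ~~ has [in names c] (names d) -> ct c x -> ct d y ->
  cl (x * y) = cl x * cl y.
Proof.
move=> dis cx cy.
have l1 z : linear (fun x : FA => cl (x * z)).
  by move=> b u v; rewrite mulrDl -scalerAl linearP.
have l2 z : linear (fun x : FA => cl (z * x)).
  by move=> b u v; rewrite mulrDr -scalerAr linearP.
have l3 z : linear (fun x : FA => cl x * z).
  by move=> b u v; rewrite linearP mulrDl -scalerAl.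
have l4 z : linear (fun x : FA => z * cl x).
  by move=> b u v; rewrite linearP mulrDr -scalerAr.
apply: (ct_lin_eq (l1 _) (l3 _) _ cx) => w wc.
apply: (ct_lin_eq (l2 _) (l4 _) _ cy) => z zd.
rewrite -!mon_cat !clM clw_cat //.
rewrite (eq_has_r (perm_mem (perm_map snd zd))) (eq_has (a2 := [in names c])) //.
by move=> i; rewrite /names /= (perm_mem (perm_map snd wc)).
Qed.

(** 4T trades the crossing of H_c with T_a for a bracket at the head of [a], which lies outside [Y].
    What remains at the tail is T_a itself, and this commutes with [Y]. *)
Lemma null_br_head a c Y d : a != c -> ct d Y -> a \notin names d ->
  null (br (T a) Y) -> null (br (br (T a) (H c)) Y).
Proof.
move=> ac dY ad nY; apply: null_mon => u v.
have E z t : cl (z * br (br (T a) (H c)) Y * t)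
    = cl (z * Y * br (H c) (T a) * t) - cl (z * br (H c) (T a) * Y * t).
  rewrite [br (T a) (H c)]br_sym /br mulrN mulNr opprK.
  by rewrite -clB -mulrBl; congr (cl (_ * _)); rewrite [RHS]addrC mulrDr mulrN !mulrA.
rewrite E; have [g|n] := boolP (gauss (u ++ ([:: (false, c); (true, a)] ++ d) ++ v)).
  have ha : (false, a) \in u ++ v.
    have := gauss_th a g; rewrite !mem_cat !in_cons !eqxx /= !orbT => /esym.
    rewrite !xpair_eqE /= (negbTE ac) /=.
    by case: (boolP (_ \in d)) => [/(map_f snd) /=|_]; rewrite ?(negbTE ad).
  have nn z t : cl (z * Y * T a * t) = cl (z * T a * Y * t).
    apply/esym/eqP; rewrite -subr_eq0 -clB -mulrBl; apply/eqP.
    by rewrite -(nY z t) /br mulrBr !mulrA.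
  move: ha; rewrite mem_cat => /orP[] /path.splitPr[x y].
    rewrite mon_cat (mon_cons _ y) !mulrA.
    have A z t : cl (mon x * H a * z * br (H c) (T a) * t)
      = - cl (mon x * br (H c) (H a) * z * T a * t) by rewrite fourT_ht opprK.
    have := A (mon y * Y) (mon v); have := A (mon y) (Y * mon v).
    by rewrite !mulrA => -> ->; rewrite nn subrr.
  rewrite mon_cat (mon_cons _ y) !mulrA.
  have := fourT_th a c (mon u * Y) (mon x) (mon y).
  have := fourT_th a c (mon u) (Y * mon x) (mon y).
  rewrite !mulrA => -> ->; apply/eqP; rewrite opprK addrC subr_eq0; apply/eqP.
  by rewrite -!mulrA; have := nn (mon u) (mon x * (br (H c) (H a) * mon y)); rewrite !mulrA.
have ctb := ct_br (ct_mon [:: (false, c)]) (ct_mon [:: (true, a)]).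
rewrite (cl_ct0 n) ?(cl_ct0 n) ?subrr //.
  by have := ctM (ct_mon u) (ctM (ctM ctb dY) (ct_mon v)); rewrite !mulrA.
have := ctM (ct_mon u) (ctM (ctM dY ctb) (ct_mon v)); rewrite !mulrA.
by apply: ct_perm; perm_by_count.
Qed.

Lemma null_br_ad a c Y d : a != c -> ct d Y -> a \notin names d ->
  null (br (T a) Y) -> null (br (T a) (br Y (H c))).
Proof.
move=> ac dY ad nY; rewrite br_jacobi; apply: nullB.
  by apply: nullB; [apply: nullMr | apply: nullMl].
exact: null_br_head dY ad nY.
Qed.

(** * Iterated head brackets and wheel brackets *)

Definition adH (S : seq nat) (b : nat) : FA := foldr (fun c X => br (H c) X) (H b) S.
(** A wheel without the tails of the spokes in [S]: the arrow [b] supplies the last spoke, and the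
    commutator with its tail closes the cycle. *)
Definition wh (b : nat) (S : seq nat) : FA := br (adH S b) (T b).

Definition heads (S : seq nat) : seq letter := [seq (false, c) | c <- S].
Definition tails (S : seq nat) : seq letter := [seq (true, c) | c <- S].

Lemma ct_adH S b : ct (heads (rcons S b)) (adH S b).
Proof.
elim: S => [|c S IH]; first exact: ct_mon.
exact: (ct_br (ct_mon [:: (false, c)]) IH).
Qed.

Lemma ct_wh b S : ct (heads (rcons S b) ++ tails [:: b]) (wh b S).
Proof. exact: (ct_br (ct_adH S b) (ct_mon [:: (true, b)])). Qed.

Lemma names_heads S : names (heads S) = S.
Proof. by rewrite /names /heads -map_comp map_id. Qed.
Lemma names_tails S : names (tails S) = S.
Proof. by rewrite /names /tails -map_comp map_id. Qed.

(** Jacobi turns the bracket of [Y] with [H_c, X] into brackets of [Y] with H_c and X in both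
    orders, so [Y] has to vary in the induction. *)
Lemma null_br_adH a S b Y d : a \notin rcons S b -> ct d Y -> a \notin names d ->
  null (br (T a) Y) -> null (br (T a) (br Y (adH S b))).
Proof.
elim: S Y d => [|c S IH] Y d /=.
  by rewrite inE => ab; apply: null_br_ad.
rewrite inE negb_or => /andP[ac aS] dY ad nY; rewrite [X in br _ X]br_jacobi.
rewrite brB; apply: nullB.
  apply: (IH _ (d ++ [:: (false, c)])) => //.
  - exact: ct_br dY (ct_mon _).
  - by rewrite notin_names_cat ad /= inE.
  exact: null_br_ad dY ad nY.
apply: (null_br_ad ac (d := d ++ heads (rcons S b))).
- exact: ct_br dY (ct_adH _ _).
- by rewrite notin_names_cat ad names_heads.
exact: IH dY ad nY.
Qed.

(** The bracket is built up from T_b, with which T_a commutes by TC, by heads of arrows other than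
    [a]. *)
Lemma wh_comm a b S : a \notin rcons S b -> null (br (T a) (wh b S)).
Proof.
move=> aSb; rewrite /wh [br (adH _ _) _]br_sym.
have -> : br (T a) (- br (T b) (adH S b)) = - br (T a) (br (T b) (adH S b)).
  by rewrite /br mulrN mulNr -opprD.
apply: nullN; apply: (null_br_adH aSb (ct_mon [:: (true, b)])).
  by move: aSb; rewrite mem_rcons inE /= negb_or inE => /andP[].
exact: TC_null.
Qed.

Lemma heads_cat u v : heads (u ++ v) = heads u ++ heads v.
Proof. exact: map_cat. Qed.
Lemma tails_cat u v : tails (u ++ v) = tails u ++ tails v.
Proof. exact: map_cat. Qed.
Lemma heads_rcons u c : heads (rcons u c) = heads u ++ [:: (false, c)].
Proof. by rewrite -cats1 heads_cat. Qed.
Lemma tails_rcons u c : tails (rcons u c) = tails u ++ [:: (true, c)].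
Proof. by rewrite -cats1 tails_cat. Qed.
Lemma mon_heads_cat u v : mon (heads (u ++ v)) = mon (heads u) * mon (heads v).
Proof. by rewrite heads_cat mon_cat. Qed.
Lemma mon_heads_cons c u : mon (heads (c :: u)) = H c * mon (heads u).
Proof. by rewrite -mon_cat. Qed.
Lemma mon_tails_cat u v : mon (tails (u ++ v)) = mon (tails u) * mon (tails v).
Proof. by rewrite tails_cat mon_cat. Qed.
Lemma mon_tails_cons c u : mon (tails (c :: u)) = T c * mon (tails u).
Proof. by rewrite -mon_cat. Qed.
Lemma mem_heads x c S : ((x, c) \in heads S) = ~~ x && (c \in S).
Proof.
apply/mapP/andP => [[d dS [-> ->]]|[nx cS]]; first by [].
by exists c => //; case: x nx.
Qed.
Lemma mem_tails x c S : ((x, c) \in tails S) = x && (c \in S).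
Proof.
apply/mapP/andP => [[d dS [-> ->]]|[nx cS]]; first by [].
by exists c => //; case: x nx.
Qed.

(** * Wheels and D_R span *)

Definition subspace (P : Aw -> Prop) := P 0 /\ forall a x y, P x -> P y -> P (a *: x + y).

Section Subspace.
Variable P : Aw -> Prop.
Hypothesis sP : subspace P.
Lemma sub0 : P 0. Proof. by case: sP. Qed.
Lemma subD x y : P x -> P y -> P (x + y).
Proof. by case: sP => _ h Px Py; rewrite -[x]scale1r; apply: h. Qed.
Lemma subZ a x : P x -> P (a *: x).
Proof. by case: sP => P0 h Px; rewrite -[_ *: _]addr0; apply: h. Qed.
Lemma subN x : P x -> P (- x).
Proof. by move=> Px; rewrite -scaleN1r; apply: subZ. Qed.
Lemma subB x y : P x -> P y -> P (x - y).
Proof. by move=> Px Py; apply: subD => //; apply: subN. Qed.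

Lemma subspace_span (R : FA -> Prop) (f : FA -> Aw) x : linear f ->
  (forall y, R y -> P (f y)) -> Defs.span R x -> P (f x).
Proof.
move=> lf h; elim=> [|a r v Rr _ IH]; first by rewrite linear_at0 //; apply: sub0.
by rewrite lf; case: sP => _; apply => //; apply: h.
Qed.

(** Crossing a head leaves a correction which 4T turns into a bracket at the head of [b]: the
    crossed head leaves the left of T_b and joins [g]. Hence the induction on [h] covers the
    corrections as well. *)
Lemma move_tail_left u b y Z h g : b \in g ->
  (forall h' g', perm_eq (h' ++ g') (h ++ g) -> b \in g' ->
     P (cl (u * T b * mon (heads h') * y * mon (heads g') * Z))) ->
  P (cl (u * mon (heads h) * T b * y * mon (heads g) * Z)).
Proof.
elim/last_ind: h g y => [|h c IH] g y bg hyp.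
  by have := hyp [::] g (perm_refl _) bg; rewrite /= mon0 !mulr1.
have -> : u * mon (heads (rcons h c)) * T b * y * mon (heads g) * Z
  = u * mon (heads h) * T b * (H c * y) * mon (heads g) * Z
    + u * mon (heads h) * br (H c) (T b) * y * mon (heads g) * Z.
  have F : H c * T b = T b * H c + br (H c) (T b) by rewrite /br addrC subrK.
  by rewrite heads_rcons mon_cat !mulrA -(mulrA (u * _)) F mulrDr !mulrDl !mulrA.
rewrite clD; apply: subD.
  apply: IH => // h' g' p bg'.
  have := hyp (rcons h' c) g'; rewrite heads_rcons mon_cat !mulrA; apply => //.
  by move: p => /permP p; apply/permP => z; have := p z; rewrite -!cats1 !count_cat /=; lia.
case/path.splitPr: g / bg hyp => p q hyp.
have -> : mon (heads (p ++ b :: q)) = mon (heads p) * H b * mon (heads q).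
  by rewrite mon_heads_cat mon_heads_cons mulrA.
have := fourT_th b c (u * mon (heads h)) (y * mon (heads p)) (mon (heads q) * Z).
rewrite !mulrA => ->; apply: subN.
have E (p' : seq nat) : perm_eq p' [:: c; b] ->
   P (cl (u * mon (heads h) * T b * y * mon (heads (p ++ p' ++ q)) * Z)).
  move=> pp; apply: IH => [|h' g' pg bg'].
    by rewrite !mem_cat (perm_mem pp) !inE eqxx !orbT.
  apply: hyp => //; apply: (perm_trans pg).
  by move: pp => /permP pp; apply/permP => z; have := pp z; rewrite -!cats1 !count_cat /=; lia.
rewrite /br !(mulrBr, mulrBl) clB; apply: subB.
  by have := E [:: c; b] (perm_refl _); rewrite !mon_heads_cat !mon_heads_cons mon0 mulr1 !mulrA.
have := E [:: b; c]; rewrite !mon_heads_cat !mon_heads_cons mon0 mulr1 !mulrA; apply.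
by rewrite -!(cat1s _ [:: _]) perm_catC.
Qed.

(** Here the head of [b] stands on the left. Tails are passed by TC; a crossed head leaves
    corrections in which it has moved next to the head of [b]. Only the number of letters is
    recorded, since degree and termination need no more. *)
Lemma move_tail_right u b Z y2 y1 h : b \in h ->
  (forall h' y', (size h' + size y' = size h + size y1 + size y2)%N ->
     P (cl (u * mon (heads h') * mon y' * T b * Z))) ->
  P (cl (u * mon (heads h) * mon y1 * T b * mon y2 * Z)).
Proof.
elim: y2 y1 h => [|[x c] y2 IH] y1 h bh hyp.
  by rewrite mon0 mulr1; apply: hyp => /=; lia.
have step : P (cl (u * mon (heads h) * mon (rcons y1 (x, c)) * T b * mon y2 * Z)).
  by apply: IH => // h' y' s; apply: hyp; rewrite s size_rcons /=; lia.
rewrite -cats1 mon_cat !mulrA in step; rewrite (mon_cons _ y2) !mulrA.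
set X := u * mon (heads h) * mon y1 in step *; rewrite -(mulrA X (T b)).
case: x hyp step => hyp step.
  rewrite -(mulrA _ (mon y2)) (@null_eq (T b * T c) (T c * T b)); last exact: TC_null.
  by rewrite !mulrA.
have -> : T b * H c = H c * T b - br (H c) (T b) by rewrite /br opprB addrC subrK.
rewrite mulrBr !mulrBl clB; apply: subB; first by rewrite !mulrA.
rewrite {step}/X; case/path.splitPr: h / bh hyp => p q hyp.
have -> : mon (heads (p ++ b :: q)) = mon (heads p) * H b * mon (heads q).
  by rewrite mon_heads_cat mon_heads_cons mulrA.
have := fourT_ht b c (u * mon (heads p)) (mon (heads q) * mon y1) (mon y2 * Z).
rewrite !mulrA => /(congr1 -%R); rewrite opprK => <-; apply: subN.
have E (p' : seq nat) : perm_eq p' [:: c; b] ->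
   P (cl (u * mon (heads (p ++ p' ++ q)) * mon y1 * T b * mon y2 * Z)).
  move=> pp; apply: IH => [|h' y' s].
    by rewrite !mem_cat (perm_mem pp) !inE eqxx !orbT.
  by apply: hyp; rewrite s !size_cat (perm_size pp) /=; lia.
rewrite /br !(mulrBr, mulrBl) clB; apply: subB.
  by have := E [:: c; b] (perm_refl _); rewrite !mon_heads_cat !mon_heads_cons mon0 mulr1 !mulrA.
have := E [:: b; c]; rewrite !mon_heads_cat !mon_heads_cons mon0 mulr1 !mulrA; apply.
by rewrite -!(cat1s _ [:: _]) perm_catC.
Qed.
End Subspace.

Lemma null_trans x y z : null (x - y) -> null (y - z) -> null (x - z).
Proof. by move=> nx ny; rewrite -(subrKA y); apply: nullD. Qed.

Lemma null_refl (x : FA) : null (x - x).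
Proof. by rewrite subrr; apply: null0. Qed.

Lemma tails_front A a B : null (mon (tails (A ++ a :: B)) - mon (tails (a :: A ++ B))).
Proof.
elim: A => [|c A IH]; first exact: null_refl.
apply: (@null_trans _ (mon (tails (c :: a :: A ++ B)))).
  rewrite cat_cons !(mon_tails_cons c) -mulrBr.
  exact: nullMl.
rewrite cat_cons !mon_tails_cons !mulrA -mulrBl.
by apply: nullMr; apply: TC_null.
Qed.

Lemma tails_perm A B : perm_eq A B -> null (mon (tails A) - mon (tails B)).
Proof.
elim: A B => [|a A IH] B p.
  have /nilP -> : nilp B by rewrite /nilp -(perm_size p).
  exact: null_refl.
have aB : a \in B by rewrite -(perm_mem p) mem_head.
case/path.splitPr: B / aB p => B1 B2 p.
have {}p : perm_eq A (B1 ++ B2).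
  by rewrite -(perm_cons a) (perm_trans p) // -(cat1s a B2) perm_catCA.
apply: (@null_trans _ (mon (tails (a :: B1 ++ B2)))).
  by rewrite !mon_tails_cons -mulrBr; apply/nullMl/IH.
by rewrite -opprB; apply/nullN/tails_front.
Qed.

Lemma wh_tails_comm A b S : {in A, forall a, a \notin rcons S b} ->
  null (br (mon (tails A)) (wh b S)).
Proof.
elim: A => [|a A IH] h; first by rewrite mon0 /br mul1r mulr1; apply: null_refl.
rewrite mon_tails_cons br_mull.
apply: nullD; first by apply/nullMl/IH => c cA; apply: h; rewrite inE cA orbT.
by apply/nullMr/wh_comm/h/mem_head.
Qed.

Definition wheels (Ws : seq (nat * seq nat)) : FA := \prod_(p <- Ws) wh p.1 p.2.
Definition cwheel (p : nat * seq nat) := heads (rcons p.2 p.1) ++ tails [:: p.1].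
Definition cwheels (Ws : seq (nat * seq nat)) := flatten (map cwheel Ws).

Lemma ct_wheels Ws : ct (cwheels Ws) (wheels Ws).
Proof.
elim: Ws => [|p Ws IH]; rewrite /wheels ?big_nil ?big_cons; first by rewrite -mon0; apply: ct_mon.
exact: ctM (ct_wh _ _) IH.
Qed.

(** Renaming on the free algebra rather than on words, so that it can be pushed through brackets. *)
Definition rename (f : nat -> nat) : FA -> FA := fa_ext (fun w => mon (map_names f w)).
Lemma rename_linear f : linear (rename f). Proof. exact: fa_ext_linear. Qed.
Lemma renameE f w : rename f (mon w) = mon (map_names f w). Proof. exact: fa_extE. Qed.
Lemma renameB f x y : rename f (x - y) = rename f x - rename f y.
Proof. by rewrite -scaleN1r addrC rename_linear scaleN1r addrC. Qed.
Lemma renameM f x y : rename f (x * y) = rename f x * rename f y.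
Proof.
have l1 z : linear (fun x : FA => rename f (x * z)).
  by move=> b u v; rewrite mulrDl -scalerAl rename_linear.
have l2 z : linear (fun x : FA => rename f (z * x)).
  by move=> b u v; rewrite mulrDr -scalerAr rename_linear.
have l3 z : linear (fun x : FA => rename f x * z).
  by move=> b u v; rewrite rename_linear mulrDl -scalerAl.
have l4 z : linear (fun x : FA => z * rename f x).
  by move=> b u v; rewrite rename_linear mulrDr -scalerAr.
apply: (fa_lin_ext (l1 y) (l3 _)) => u; apply: (fa_lin_ext (l2 _) (l4 _)) => v.
by rewrite -mon_cat !renameE map_names_cat mon_cat.
Qed.

Lemma cl_rename f c x : {in names c &, injective f} -> ct c x -> cl (rename f x) = cl x.
Proof.
move=> fI; have l : linear (fun x : FA => cl (rename f x)).
  by move=> a y z; rewrite rename_linear linearP.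
apply: (ct_lin_eq l cl_linear) => w wc; rewrite renameE !clM clw_relabel // => i j.
by rewrite /names !(perm_mem (perm_map snd wc)); apply: fI.
Qed.

Lemma rename_tails f S : rename f (mon (tails S)) = mon (tails (map f S)).
Proof. by rewrite renameE /map_names /tails -!map_comp. Qed.

Lemma rename_wh f b S : rename f (wh b S) = wh (f b) (map f S).
Proof.
rewrite /wh /br renameB !renameM renameE; congr (_ - _); congr (_ * _);
  by elim: S => [|c S IH] /=; rewrite ?renameE // /br renameB !renameM renameE IH.
Qed.

(* The wheel with n + 1 spokes. *)
Definition omega (n : nat) : Aw := cl (mon (tails (iota 0 n)) * wh n (iota 0 n)).

(** Any choice of distinct names is an injective renaming of the standard one. *)
Lemma cl_wheel b S : uniq (rcons S b) -> cl (mon (tails S) * wh b S) = omega (size S).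
Proof.
move=> U; pose f i := nth 0%N (rcons S b) i.
have fS : map f (iota 0 (size S)) = S.
  rewrite -[RHS](mkseq_nth 0%N); apply/eq_in_map => i; rewrite mem_iota /= => iS.
  by rewrite /f nth_rcons iS.
have fb : f (size S) = b by rewrite /f nth_rcons ltnn eqxx.
have -> : mon (tails S) * wh b S
  = rename f (mon (tails (iota 0 (size S))) * wh (size S) (iota 0 (size S))).
  by rewrite renameM rename_tails rename_wh fS fb.
apply: (cl_rename _ (ctM (ct_mon _) (ct_wh _ _))) => i j.
have K k : k \in names (tails (iota 0 (size S)) ++ heads (rcons (iota 0 (size S)) (size S)) ++ tails [:: size S]) -> (k < size (rcons S b))%N.
  rewrite !names_cat !names_tails names_heads !mem_cat mem_rcons !inE !mem_iota size_rcons /=.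
  by lia.
by move=> /K iS /K jS /eqP; rewrite /f nth_uniq // => /eqP.
Qed.

(** By X H_c = H_c X - [H_c, X], a head standing to the right of an iterated bracket either joins
    the free heads [K] or is nested into the bracket. *)
Lemma lazard b cs : Defs.span (fun y : FA => exists K S, perm_eq (K ++ S) cs /\
    y = mon (heads K) * adH S b) (mon (heads (b :: cs))).
Proof.
elim/last_ind: cs => [|cs c IH].
  by apply: span_gen; exists [::], [::]; rewrite /= mon0 mul1r.
rewrite -rcons_cons heads_rcons mon_cat.
elim: IH => [|a r v [K [S [p ->]]] _ IH]; first by rewrite mul0r; apply: span0.
rewrite mulrDl -scalerAl; apply: span_add => //; apply: span_scale.
have -> : mon (heads K) * adH S b * H c
  = mon (heads (rcons K c)) * adH S b + (-1) *: (mon (heads K) * adH (c :: S) b).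
  rewrite heads_rcons mon_cat scaleN1r /= /br mulrBr !mulrA opprB addrC.
  by rewrite subrK.
apply: span_add; last apply: span_scale; apply: span_gen.
- exists (rcons K c), S; split => //.
  by move/permP: p => p; apply/permP => z; have := p z; rewrite -!cats1 !count_cat /=; lia.
- exists K, (c :: S); split => //.
  by move/permP: p => p; apply/permP => z; have := p z; rewrite -!cats1 !count_cat /=; lia.
Qed.

Lemma ct_heads S x : ct (heads S) x ->
  Defs.span (fun y : FA => exists2 h, perm_eq h S & y = mon (heads h)) x.
Proof.
elim=> [|a r v [w wc ->] _ IH]; first exact: span0.
apply: spanD => //; exists (names w).
  by rewrite -[S in perm_eq _ S]names_heads; apply: perm_map.
congr mon; rewrite /heads /names -map_comp -[LHS]map_id; apply/eq_in_map => -[x' c] /=.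
by rewrite (perm_mem wc) mem_heads; case: x'.
Qed.

Lemma gauss_tail_head w a : gauss w -> (true, a) \in w -> (false, a) \in w.
Proof. by move=> g; rewrite (gauss_th a g). Qed.

Lemma mem_cwheels x c Ws : (x, c) \in cwheels Ws ->
  exists2 p, p \in Ws & if x then c = p.1 else c \in rcons p.2 p.1.
Proof.
case/flatten_mapP => p pW; rewrite mem_cat mem_heads mem_tails => h; exists p => //.
by case: x h => //=; rewrite ?orbF ?inE // => /eqP.
Qed.

Lemma mem_cwheels_head c Ws : (true, c) \in cwheels Ws -> (false, c) \in cwheels Ws.
Proof.
case/flatten_mapP => p pW; rewrite mem_cat mem_heads mem_tails /= inE => /eqP ->.
apply/flatten_mapP; exists p => //.
by rewrite mem_cat mem_heads /= mem_rcons mem_head.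
Qed.

Lemma gauss_count w x : gauss w -> (count_mem x w <= 1)%N.
Proof. by move=> /andP[U _]; rewrite count_uniq_mem //; case: (_ \in _). Qed.

Lemma mem_count (w : seq letter) x : x \in w -> (0 < count_mem x w)%N.
Proof. by rewrite -has_pred1 has_count. Qed.

Lemma gauss_notin2 u v w x : gauss w -> perm_eq w (u ++ v) -> x \in u -> x \notin v.
Proof.
move=> g p /mem_count xu; apply/negP => /mem_count xv.
by have := gauss_count x g; rewrite (permP p) count_cat; lia.
Qed.

Lemma size_heads S : size (heads S) = size S. Proof. exact: size_map. Qed.
Lemma size_tails S : size (tails S) = size S. Proof. exact: size_map. Qed.

Lemma uniq_heads S : uniq (heads S) = uniq S.
Proof. by rewrite map_inj_uniq // => x y []. Qed.
Lemma uniq_tails S : uniq (tails S) = uniq S.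
Proof. by rewrite map_inj_uniq // => x y []. Qed.

Lemma split_last (A : pred nat) h : has A h ->
  exists h1 b cs, [/\ h = h1 ++ b :: cs, A b & ~~ has A cs].
Proof.
elim/last_ind: h => // h c IH; rewrite has_rcons; case Ac: (A c) => /=.
  by exists h, c, [::]; rewrite cats1.
case/IH => h1 [b] [cs] [-> Ab n]; exists h1, b, (rcons cs c).
by rewrite rcons_cat Ab has_rcons Ac.
Qed.

(** The family [V] is abstract because the argument is used twice: with [V] the centre, which gives
    commutativity, and then, evaluation of polynomials having become possible, with [V] the graded
    image of a polynomial algebra. *)
Section Spanning.
Variable V : nat -> Aw -> Prop.
Hypothesis sV : forall n, subspace (V n).
Hypothesis V1 : V 0 1.
Hypothesis VR : forall n x, V n x -> V n.+1 (D_R * x).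
Hypothesis VW : forall k n x, V n x -> V (n + k.+1) (omega k * x).

Lemma ct_word4 A h B Ws : ct (tails A ++ heads h ++ tails B ++ cwheels Ws)
  (mon (tails A) * mon (heads h) * mon (tails B) * wheels Ws).
Proof.
by have := ctM (ct_mon (tails A)) (ctM (ct_mon (heads h)) (ctM (ct_mon (tails B))
  (ct_wheels Ws))); rewrite !mulrA.
Qed.

(** With no free heads left, the tails of the spokes of the first wheel all lie in [A]. The other
    tails commute with its bracket, so the complete wheel splits off as a factor with names of its
    own. *)
Lemma span_wheels Ws A n : size (tails A ++ cwheels Ws) = n.*2 ->
  V n (cl (mon (tails A) * wheels Ws)).
Proof.
have ctA Ws' A' := ctM (ct_mon (tails A')) (ct_wheels Ws').
elim: Ws A n => [|[b S] Ws IH] A n sz.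
  have [g|ng] := boolP (gauss (tails A ++ cwheels [::])); last first.
    by rewrite (cl_ct0 ng) //; apply: sub0.
  have A0 : A = [::].
    case: A sz g => // a A _ g; have := @gauss_tail_head _ a g.
    by rewrite mem_head cats0 mem_tails => /(_ isT).
  rewrite A0 /= in sz *; rewrite /wheels big_nil mulr1 clM.
  have -> : n = 0%N by case: n sz.
  by have -> : clw [::] = 1 by apply: (clwE ad_one).
have [g|ng] := boolP (gauss (tails A ++ cwheels ((b, S) :: Ws))); last first.
  by rewrite (cl_ct0 ng) //; apply: sub0.
have Uall : uniq (tails A ++ cwheels ((b, S) :: Ws)) by case/andP: g.
have UA : uniq A by move: Uall; rewrite cat_uniq uniq_tails => /and3P[].
have USb : uniq (rcons S b).
  by move: Uall; rewrite /cwheels /= !cat_uniq uniq_heads => /and3P[_ _ /andP[/andP[->]]].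
have bS : b \notin S by move: USb; rewrite rcons_uniq => /andP[].
have US : uniq S by move: USb; rewrite rcons_uniq => /andP[].
have hW i : i \in rcons S b -> (false, i) \notin cwheels Ws.
  move=> iS; apply: (gauss_notin2 (u := tails A ++ cwheel (b, S)) g).
    by rewrite /cwheels /= -!catA.
  by rewrite !mem_cat mem_heads iS orbT.
(* The tail of a spoke is not T_b, and it is not inside another wheel, since the tails there come
   with their own heads. *)
have SA i : i \in S -> i \in A.
  move=> iS; have iSb : i \in rcons S b by rewrite mem_rcons inE iS orbT.
  have : (true, i) \in tails A ++ cwheels ((b, S) :: Ws).
    by rewrite (gauss_th i g) !mem_cat mem_heads /= iSb !orbT.
  rewrite /cwheels /= !mem_cat !mem_tails mem_heads /= inE => /or3P[//|/eqP ib|].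
    by rewrite ib (negbTE bS) in iS.
  by move/mem_cwheels_head; rewrite (negbTE (hW _ iSb)).
pose A' := [seq a <- A | a \notin S].
have pA : perm_eq A (S ++ A').
  apply: uniq_perm => //.
    rewrite cat_uniq US filter_uniq // andbT /=; apply/hasPn => i.
    by rewrite mem_filter => /andP[].
  move=> i; rewrite mem_cat mem_filter; case: (boolP (i \in S)) => [/SA|] //=.
have bA : b \notin A.
  have := gauss_notin2 (x := (true, b)) g (u := tails A) (v := cwheels ((b, S) :: Ws)) (perm_refl _).
  rewrite mem_tails /= !mem_cat mem_tails /= mem_head !orbT => h.
  by apply/negP => /h.
have nA' : {in A', forall a, a \notin rcons S b}.
  move=> a; rewrite mem_filter mem_rcons inE negb_or => /andP[-> aA]; rewrite andbT.
  by apply/eqP => E; rewrite -E aA in bA.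
have -> : cl (mon (tails A) * wheels ((b, S) :: Ws))
   = cl (mon (tails S) * wh b S * (mon (tails A') * wheels Ws)).
  rewrite /wheels big_cons /= -[mon (tails A)]mul1r -/(wheels Ws).
  rewrite (null_eq _ _ (tails_perm pA)) mul1r mon_tails_cat.
  have := null_eq (mon (tails S)) (wheels Ws) (wh_tails_comm nA').
  by rewrite !mulrA => ->.
rewrite (cl_mul _ (ctM (ct_mon (tails S)) (ct_wh b S)) (ctA Ws A')); last first.
  apply/hasPn => i /= iA; rewrite !names_cat !names_tails names_heads.
  apply/negP => iS.
  have {}iS : i \in rcons S b.
    by move: iS; rewrite !mem_cat mem_rcons !inE; case: (i \in S); rewrite ?orbT ?orbF //= orbb.
  move: iA; rewrite names_cat names_tails mem_cat => /orP[/nA'|]; first by rewrite iS.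
  case/mapP => -[[] j] jW /= E; subst j; last by rewrite (negbTE (hW _ iS)) in jW.
  by move/mem_cwheels_head: jW; rewrite (negbTE (hW _ iS)).
rewrite (cl_wheel USb).
have -> : n = (n - (size S).+1 + (size S).+1)%N.
  move: sz (perm_size pA); rewrite /cwheels /= !size_cat !size_heads !size_tails size_rcons /=.
  by lia.
apply/VW/IH.
move: sz (perm_size pA); rewrite /cwheels /= !size_cat !size_heads !size_tails size_rcons /=.
by lia.
Qed.

(** The tail belonging to the first free head is among the tails just before it and can be brought
    next to it by TC; the pair is an isolated arrow. *)
Lemma span_R Ws A h n : size (tails A ++ heads h ++ cwheels Ws) = n.*2 ->
  V n (cl (mon (tails A) * mon (heads h) * wheels Ws)).
Proof.
elim: h A n => [|k h IH] A n sz.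
  by rewrite mon0 mulr1; apply: span_wheels.
have [g|ng] := boolP (gauss (tails A ++ heads (k :: h) ++ cwheels Ws)); last first.
  rewrite (cl_ct0 ng) //; first exact: sub0.
  by have := ct_word4 A (k :: h) [::] Ws; rewrite mon0 mulr1.
have kA : k \in A.
  have := gauss_th k g; rewrite !mem_cat !mem_tails !mem_heads mem_head /=.
  move=> /orP[] //.
  move/mem_cwheels_head => kW; have := gauss_notin2 (u := tails A ++ heads (k :: h)) (x := (false, k)) g.
  move=> /(_ (cwheels Ws)); rewrite catA kW => /(_ (perm_refl _)).
  by rewrite mem_cat mem_heads mem_head orbT => /(_ isT).
have pA : perm_eq A (rcons (rem k A) k).
  by rewrite perm_sym perm_rcons perm_sym; apply: perm_to_rem.
have -> : cl (mon (tails A) * mon (heads (k :: h)) * wheels Ws)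
   = D_R * cl (mon (tails (rem k A)) * (mon (heads h) * wheels Ws)).
  rewrite -(@cl_isolated (tails (rem k A)) (heads h ++ cwheels Ws) _ _ k); first last.
  - exact: ctM (ct_mon _) (ct_wheels _).
  - exact: ct_mon.
  - have := gauss_permI g (w' := (tails (rem k A) ++ [:: (true, k); (false, k)] ++ heads h ++ cwheels Ws)).
    move=> {}g; apply: (gauss_fresh (g _)); rewrite ?inE ?eqxx //.
    have := perm_map (fun c => (true, c)) pA; rewrite -/(tails A) -/(tails _) => /permP pT.
    apply/permP => z; have := pT z.
    by rewrite tails_rcons !count_cat /=; lia.
  rewrite -[mon (tails A)]mul1r -!mulrA (mulrA 1) (null_eq _ _ (tails_perm pA)) mul1r.
  by rewrite tails_rcons mon_cat mon_heads_cons !mulrA.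
case: n sz => [|n] sz; first by move: sz; rewrite !size_cat /=; lia.
rewrite !mulrA; apply/VR/IH.
have := perm_size pA; rewrite size_rcons => sA.
by move: sz; rewrite !size_cat !size_tails !size_heads /= sA; move: (size (rem k A)) => r; lia.
Qed.

(** Each tail standing to the right of the heads is either moved to the left of all of them or used
    to close a bracket into a new wheel; the induction is on the number of such tails. *)
Lemma span_heads l (B A h : seq nat) (Ws : seq (nat * seq nat)) n : size B = l ->
  (forall p, p \in Ws -> {in p.2, forall c, c \notin B}) ->
  size (tails A ++ heads h ++ tails B ++ cwheels Ws) = n.*2 ->
  V n (cl (mon (tails A) * mon (heads h) * mon (tails B) * wheels Ws)).
Proof.
elim: l B A h Ws n => [|l IH] B A h Ws n sB hWs sz.
  have B0 : B = [::] by case: B sB {hWs sz}.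
  by rewrite B0 mon0 mulr1; apply: span_R; move: sz; rewrite B0.
have [g|ng] := boolP (gauss (tails A ++ heads h ++ tails B ++ cwheels Ws)); last first.
  by rewrite (cl_ct0 ng (ct_word4 _ _ _ _)); apply: sub0.
(* The head of an arrow of [B] cannot be inside a wheel: the head named [p.1] has its tail in the
   wheel, and the others are kept out of [B] by [hWs]. *)
have hB : has (mem B) h.
  case: B sB hWs g {sz} => // b B _ hWs g; apply/hasP; exists b; last exact: mem_head.
  have := gauss_th b g; rewrite !mem_cat !mem_tails !mem_heads mem_head orbT /=.
  move/esym => /orP[//|] /mem_cwheels [p pW] /=; rewrite mem_rcons inE => /orP[/eqP E|bp].
    have : (true, b) \in cwheels Ws.
      by apply/flatten_mapP; exists p => //; rewrite mem_cat mem_tails E mem_head orbT.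
    apply/contraLR => _; apply: (gauss_notin2 (u := tails A ++ heads h ++ tails (b :: B)) g).
      by rewrite -!catA.
    by rewrite !mem_cat mem_tails mem_head !orbT.
  by have := hWs p pW b bp; rewrite mem_head.
(* The last head with its tail in [B] is chosen, so that no spoke of the bracket built from [cs] has
   its tail in [B]; only then does the new wheel commute with the remaining tails. *)
have [h1 [b [cs [hE bB csB]]]] := split_last hB; rewrite {hB}hE in g sz *.
have {}bB : b \in B := bB.
have {}csB c : c \in cs -> c \notin B by move=> /(hasPn csB).
pose B' := rem b B; have pB : perm_eq B (b :: B') := perm_to_rem bB.
have UB : uniq B.
  case/andP: g => U _; move: U; rewrite cat_uniq => /and3P[_ _].
  by rewrite cat_uniq => /and3P[_ _]; rewrite cat_uniq uniq_tails => /and3P[].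
have bB' : b \notin B' by rewrite mem_rem_uniq // inE eqxx.
have B'B c : c \in B' -> c \in B by apply: mem_rem.
have sB' : size B' = l by rewrite size_rem // sB.
have -> : cl (mon (tails A) * mon (heads (h1 ++ b :: cs)) * mon (tails B) * wheels Ws)
  = cl (mon (tails A) * mon (heads h1) * mon (heads (b :: cs)) * (T b * (mon (tails B') * wheels Ws))).
  by rewrite mon_heads_cat !mulrA (null_eq _ _ (tails_perm pB)) mon_tails_cons !mulrA.
have lf : linear (fun x => cl (mon (tails A) * mon (heads h1) * x * (T b * (mon (tails B') * wheels Ws)))).
  by move=> a x y; rewrite mulrDr mulrDl -scalerAr -scalerAl linearP.
apply: (subspace_span (sV n) lf _ (lazard b cs)) => _ [K [S [p ->]]].
have SB c : c \in S -> c \notin B.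
  by move=> cS; apply: csB; rewrite -(perm_mem p) mem_cat cS orbT.
(* The two outcomes: T_b passes the bracket and can go on to the left, or it closes the bracket into
   a wheel. *)
have -> : mon (tails A) * mon (heads h1) * (mon (heads K) * adH S b)
   * (T b * (mon (tails B') * wheels Ws))
  = mon (tails A) * mon (heads (h1 ++ K)) * T b * adH S b * mon (tails B') * wheels Ws
  + mon (tails A) * mon (heads (h1 ++ K)) * (wh b S * mon (tails B')) * wheels Ws.
  have F : adH S b * T b = T b * adH S b + wh b S by rewrite /wh /br addrC subrK.
  rewrite mon_heads_cat !mulrA -(mulrA _ (adH S b)) F mulrDr !mulrDl !mulrA; congr (_ + _).
rewrite clD; apply: (subD (sV n)).
  have lg : linear (fun x => cl (mon (tails A) * mon (heads (h1 ++ K)) * T b * x * mon (tails B') * wheels Ws)).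
    by move=> a x y; rewrite mulrDr !mulrDl -scalerAr -!scalerAl linearP.
  apply: (subspace_span (sV n) lg _ (ct_heads (ct_adH S b))) => _ [h2 ph2 ->].
  have := @move_tail_left _ (sV n) (mon (tails A)) b 1 (mon (tails B') * wheels Ws) (h1 ++ K) h2.
  rewrite !mulr1 !mulrA; apply.
    by rewrite (perm_mem ph2) mem_rcons mem_head.
  move=> h' g' ph _.
  have -> : mon (tails A) * T b * mon (heads h') * 1 * mon (heads g') * (mon (tails B') * wheels Ws)
     = mon (tails (rcons A b)) * mon (heads (h' ++ g')) * mon (tails B') * wheels Ws.
    by rewrite tails_rcons mon_cat mon_heads_cat mulr1 !mulrA.
  apply: IH => //.
    by move=> q qW c cq; apply: contra (hWs q qW c cq); apply: B'B.
  move: sz (perm_size ph) (perm_size ph2) (perm_size p) (perm_size pB).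
  by rewrite !size_cat !size_tails !size_heads !size_rcons /= !size_cat /=; lia.
have cB' : {in B', forall a, a \notin rcons S b}.
  move=> a aB'; rewrite mem_rcons inE negb_or; apply/andP; split.
    by apply/eqP => E; rewrite -E aB' in bB'.
  by apply/negP => /SB; rewrite B'B.
have nw : null (wh b S * mon (tails B') - mon (tails B') * wh b S).
  by rewrite -opprB; apply/nullN/wh_tails_comm.
rewrite (null_eq _ _ nw) !mulrA -[_ * wheels Ws]mulrA.
have -> : wh b S * wheels Ws = wheels ((b, S) :: Ws) by rewrite /wheels big_cons.
apply: IH => //.
  move=> q; rewrite inE => /orP[/eqP -> | qW] c cq.
    by apply: contra (SB c cq); apply: B'B.
  by apply: contra (hWs q qW c cq); apply: B'B.
move: sz (perm_size p) (perm_size pB).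
by rewrite /cwheels /= !size_cat !size_tails !size_heads !size_rcons /= !size_cat /=; lia.
Qed.

(** [y] is the unread part of the word. A head is appended to [h]; a tail goes right to [B] if its
    head has been read and left to [A] otherwise. Moving a tail lowers [size h + size y]; reading a
    head keeps it and lowers [size y]. *)
Lemma span_state N : forall k (A h : seq nat) (y : seq letter) (B : seq nat) n, (size h + size y = N)%N -> (size y = k)%N ->
  size (tails A ++ heads h ++ y ++ tails B) = n.*2 ->
  V n (cl (mon (tails A) * mon (heads h) * mon y * mon (tails B))).
Proof.
elim/ltn_ind: N => N IHN; elim=> [|k IHk] A h y B n sN sy sz.
  rewrite (size0nil sy) mon0 mulr1.
  have := @span_heads (size B) B A h [::] n erefl; rewrite /wheels big_nil mulr1; apply=> //.
  by move: sz; rewrite (size0nil sy) cats0.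
have [g|ng] := boolP (gauss (tails A ++ heads h ++ y ++ tails B)); last first.
  rewrite (cl_ct0 ng); first exact: sub0.
  have := ctM (ct_mon (tails A)) (ctM (ct_mon (heads h)) (ctM (ct_mon y) (ct_mon (tails B)))).
  by rewrite !mulrA.
case: y sy sN sz g => // -[x b] y [sy] sN sz g.
rewrite mon_cons; case: x sN sz g => sN sz g; last first.
  have := IHk A (rcons h b) y B n; rewrite heads_rcons mon_cat !mulrA; apply=> //.
    by rewrite size_rcons; move: sN => /=; lia.
  by move: sz; rewrite !size_cat /=; lia.
have := gauss_th b g; rewrite !mem_cat !mem_tails !mem_heads !inE eqxx ?orbT ?orTb ?orbF /=.
move=> /esym /orP[bh|by_].

  have := @move_tail_right _ (sV n) (mon (tails A)) b (mon (tails B)) y [::] h bh.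
  rewrite mon0 mulr1 !mulrA; apply => h' y' s.
  have := IHN (size h' + size y')%N _ (size y') A h' y' (b :: B) n erefl erefl.
  rewrite mon_tails_cons !mulrA; apply.
    by rewrite s; move: sN => /=; lia.
  by move: sz s; rewrite !size_cat /= !size_map /=; lia.
case/path.splitPr: y / by_ sy sN sz g => p q sy sN sz g.
have := @move_tail_left _ (sV n) (mon (tails A)) b (mon p) (mon q * mon (tails B)) h [:: b].
have -> : mon (p ++ (false, b) :: q) = mon p * mon (heads [:: b]) * mon q.
  by rewrite mon_cat (mon_cons _ q) mulrA.
rewrite !mulrA; apply; first exact: mem_head.
move=> h' g' ph _.
have := IHN (size h' + size (p ++ heads g' ++ q))%N _ _ (rcons A b) h' (p ++ heads g' ++ q) B n erefl erefl.
rewrite tails_rcons !mon_cat !mulrA; apply.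
  by move: sN (perm_size ph); rewrite /= !(size_cat, size_map) /=; lia.
by move: sz (perm_size ph); rewrite /= !(size_cat, size_map) /= !(size_cat, size_map) /=; lia.
Qed.

Lemma span_word w n : size w = n.*2 -> V n (clw w).
Proof.
move=> sw; have := @span_state (size w) (size w) [::] [::] w [::] n erefl erefl.
by rewrite !mon0 !mul1r mulr1 clM cats0; apply.
Qed.
End Spanning.

(** * Centrality of the wheels and commutativity *)

Section HeadThroughClosed.
Variables (c : nat) (u v : FA).

(** The term produced when H_c crosses the letter [x]; the letter is located by [index], which
    suffices because a Gauss word has no repetitions. *)
Definition cross (w : seq letter) (x : letter) : Aw :=
  let i := index x w in
  cl (u * mon (take i w) * br (H c) (mon [:: x]) * mon (drop i.+1 w) * v).

Lemma cross_cat p q x : x \notin p ->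
  cross (p ++ x :: q) x = cl (u * mon p * br (H c) (mon [:: x]) * mon q * v).
Proof.
move=> xp; rewrite /cross index_cat (negbTE xp) /= eqxx addn0.
by rewrite take_size_cat // -cat_rcons drop_size_cat // size_rcons.
Qed.

(** This is 4T for the arrow of [x]; by symmetry [x] may be taken to be the end that comes first. *)
Lemma cross_flip w x : gauss w -> x \in w ->
  cross w (~~ x.1, x.2) = - cross w x.
Proof.
move=> g xw; have /andP[U /allP /(_ _ xw) yw] := g.
wlog : x xw yw / (index x w < index (~~ x.1, x.2) w)%N.
  move=> wl; case: (ltngtP (index x w) (index (~~ x.1, x.2) w)) => [|lt|E].
  - exact: wl.
  - have := wl (~~ x.1, x.2) yw; rewrite /= negbK -surjective_pairing.
    by move=> /(_ xw lt) ->; rewrite opprK.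
  - have := congr1 (nth x w) E; rewrite !nth_index //.
    by case: (x) => -[].
case/path.splitPr: {w}xw g U yw => p q g U yw lt.
have xp : x \notin p.
  by move: U; rewrite cat_uniq => /and3P[_ /hasPn/(_ x (mem_head _ _))].
have yq : (~~ x.1, x.2) \in q.
  move: yw; rewrite mem_cat inE => /or3P[yp|/eqP E|//].
    move: lt; rewrite index_cat (negbTE xp) /= eqxx addn0 index_cat yp.
    by rewrite ltnNge ltnW // index_mem.
  by case: (x) E => -[].
case/path.splitPr: q / yq U {yw lt g} => q r U.
rewrite cross_cat // -cat_cons catA cross_cat; last first.
  move: U; rewrite -cat_cons catA cat_uniq => /and3P[_ /hasPn/(_ _ (mem_head _ _))].
  by [].
case: x {U} xp => -[] a /= _.
  have := fourT_th a c (u * mon p) (mon q) (mon r * v).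
  by rewrite !mon_cat (mon_cons _ q) (mon_cons _ r) !mulrA => ->; rewrite opprK.
have := fourT_ht a c (u * mon p) (mon q) (mon r * v).
by rewrite !mon_cat (mon_cons _ q) (mon_cons _ r) !mulrA => ->; rewrite opprK.
Qed.

(** Exchanging the two ends of every arrow permutes the letters and negates the terms, so the sum is
    its own negative. *)
Lemma sum_cross_flip w : gauss w -> \sum_(x <- w) cross w x = 0.
Proof.
move=> g; have /andP[U /allP A] := g.
have P : perm_eq (map (fun x : letter => (~~ x.1, x.2)) w) w.
  have I : injective (fun x : letter => (~~ x.1, x.2)).
    by move=> [b i] [d j] [/(congr1 negb)]; rewrite !negbK => -> ->.
  apply: uniq_perm => //; first by rewrite map_inj_uniq.
  move=> y; apply/mapP/idP => [[x xw ->]|yw]; first exact: A.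
  by exists (~~ y.1, y.2); [exact: A | rewrite /= negbK -surjective_pairing].
have E : \sum_(x <- w) cross w x = - \sum_(x <- w) cross w x.
  rewrite -{1}(perm_big _ P) big_map -sumrN /= big_seq [RHS]big_seq.
  by apply: eq_bigr => x xw; rewrite cross_flip.
have : (2%:R : rat) *: \sum_(x <- w) cross w x = 0.
  by rewrite scaler_nat mulr2n {1}E addNr.
by move/eqP; rewrite scaler_eq0 /= => /eqP.
Qed.

(** The commutators of H_c with successive letters telescope. *)
Lemma sum_cross p q : uniq (p ++ q) ->
  \sum_(x <- q) cross (p ++ q) x
  = cl (u * mon p * H c * mon q * v) - cl (u * mon p * mon q * H c * v).
Proof.
elim: q p => [|x q IH] p U; first by rewrite big_nil mon0 !mulr1 subrr.
rewrite big_cons cross_cat; last first.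
  by move: U; rewrite cat_uniq => /and3P[_ /hasPn/(_ x (mem_head _ _))].
have := IH (rcons p x); rewrite cat_rcons => ->//; rewrite -cats1 mon_cat (mon_cons _ q).
rewrite /br !(mulrBr, mulrBl) clB !mulrA.
by rewrite subrKA.
Qed.
End HeadThroughClosed.

Lemma head_through_closed c w : gauss w -> null (br (H c) (mon w)).
Proof.
move=> g u v; have /andP[U _] := g.
have := @sum_cross c u v [::] w U; rewrite (sum_cross_flip _ _ _ g) mon0 mulr1 => E.
by rewrite /br mulrBr mulrBl clB !mulrA -E.
Qed.

Lemma head_through_ct c d x : gauss d -> ct d x -> null (br (H c) x).
Proof.
move=> g dx; have {}dx : Defs.span (fun y => null (br (H c) y)) x.
  elim: dx => [|a r y [w wd ->] _ IH]; first exact: span0.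
  by apply: spanD => //; apply: head_through_closed; rewrite (gauss_perm wd).
elim: dx => [|a r y nr _ IH]; first by rewrite /br mulr0 mul0r; apply: null_refl.
have -> : br (H c) (a *: r + y) = a *: br (H c) r + br (H c) y.
  rewrite /br [H c * (_ + _)]mulrDr [(_ + _) * H c]mulrDl -scalerAr -scalerAl.
  by rewrite opprD addrACA -scalerBr.
move=> s t; rewrite mulrDr mulrDl -scalerAr -scalerAl.
by rewrite clD clZ nr IH scaler0 addr0.
Qed.

Definition wheel_fa (b : nat) (S : seq nat) : FA := mon (tails S) * wh b S.
Definition wheel_ct (b : nat) (S : seq nat) := tails S ++ cwheel (b, S).

Lemma ct_wheel_fa b S : ct (wheel_ct b S) (wheel_fa b S).
Proof. exact: ctM (ct_mon _) (ct_wh _ _). Qed.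

Lemma gauss_wheel b S : uniq (rcons S b) -> gauss (wheel_ct b S).
Proof.
move=> U; apply/andP; split.
  move: (U); rewrite rcons_uniq => /andP[bS US].
  rewrite /wheel_ct cat_uniq uniq_tails US /cwheel andTb; apply/andP; split.
    apply/hasPn => -[x c] h; change ((x, c) \notin tails S); move: h.
    by rewrite mem_cat mem_heads !mem_tails inE; case: x => //= /eqP ->.
  by rewrite cat_uniq uniq_heads U /= orbF mem_heads.
apply/allP => -[x c]; rewrite !mem_cat !mem_heads !mem_tails /= mem_rcons !inE.
by case: x => /=; rewrite ?orbF orbC.
Qed.

(** Heads pass because the wheel together with its spokes is a closed diagram, tails because of TC
    and [wh_comm]. *)
Lemma wheel_central b S w : uniq (rcons S b) ->
  (forall a, a \in names w -> a \notin rcons S b) ->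
  null (br (mon w) (wheel_fa b S)).
Proof.
move=> U; elim: w => [|[x a] w IH] nw; first by rewrite mon0 /br mul1r mulr1; apply: null_refl.
have aS : a \notin rcons S b by apply: nw; rewrite /names /= mem_head.
rewrite mon_cons br_mull; apply: nullD.
  by apply/nullMl/IH => i iw; apply: nw; rewrite /names /= inE iw orbT.
apply: nullMr; case: x {nw}; last exact: head_through_ct (gauss_wheel U) (ct_wheel_fa b S).
rewrite /wheel_fa br_sym; apply: nullN; rewrite br_mull; apply: nullD.
  by apply/nullMl; rewrite br_sym; apply/nullN/wh_comm.
apply: nullMr; elim: (S) => [|d D IHD]; first by rewrite mon0 /br mul1r mulr1; apply: null_refl.
rewrite mon_tails_cons br_mull; apply: nullD; first exact: nullMl.
by apply/nullMr/TC_null.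
Qed.

Lemma clw_span x : Defs.span (fun y => exists w, y = clw w) x.
Proof.
have [v ->] := awpi_surj x; move: v; apply: ad_ind => [|a D v IH].
  by rewrite /awpi linear0; apply: span0.
rewrite /awpi linearP; apply: spanD => //.
by exists (word D); rewrite clwE.
Qed.

Lemma aw_ext (W : lmodType rat) (f g : Aw -> W) : linear f -> linear g ->
  (forall w, f (clw w) = g (clw w)) -> f =1 g.
Proof.
move=> lf lg fg x; elim: (clw_span x) => [|a r y [w ->] _ IH].
  by rewrite -[0](addNr 0) -scaleN1r lf lg !scaleN1r !addNr.
by rewrite lf lg fg IH.
Qed.

Lemma mulr_linear_l (z : Aw) : linear (fun x => z * x).
Proof. by move=> a x y; rewrite mulrDr -scalerAr. Qed.
Lemma mulr_linear_r (z : Aw) : linear (fun x => x * z).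
Proof. by move=> a x y; rewrite mulrDl -scalerAl. Qed.

(** An isolated arrow placed behind a word can be read as a right factor, or slid to the front and
    read as a left factor. *)
Lemma D_R_central x : D_R * x = x * D_R.
Proof.
move: x; apply: (aw_ext (mulr_linear_l _) (mulr_linear_r _)) => w.
pose a := wnext w; have aw : a \notin names w.
  by apply/negP => /names_lt; rewrite ltnn.
have R : cl (T a * H a) = D_R.
  have := @cl_isolated [::] [::] 1 1 a isT.
  by rewrite -mon0 => /(_ (ct_mon _) (ct_mon _)); rewrite mon0 !mulr1 !mul1r -mon0 clM (clwE ad_one) mulr1.
have := @cl_isolated w [::] (mon w) 1 a; rewrite cats0 -mon0 => /(_ aw (ct_mon _) (ct_mon _)).
rewrite mon0 !mulr1 clM => <-.
rewrite (@cl_mul w [:: (true, a); (false, a)]) ?R ?clM //.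
  by apply/hasPn => i; rewrite /names /= !inE orbb => /eqP ->.
- exact: ct_mon.
- by rewrite -mon_cat; apply: ct_mon.
Qed.

Lemma omega_central n x : omega n * x = x * omega n.
Proof.
move: x; apply: (aw_ext (mulr_linear_l _) (mulr_linear_r _)) => w.
pose N := wnext w; pose S := iota N n; pose b := (N + n)%N.
have U : uniq (rcons S b).
  by rewrite rcons_uniq iota_uniq andbT mem_iota /b; lia.
have nw a : a \in names w -> a \notin rcons S b.
  by move=> /names_lt; rewrite mem_rcons inE mem_iota /b -/N; lia.
have D : ~~ has [in names (wheel_ct b S)] (names w).
  apply/hasPn => a /nw; apply: contra; rewrite /= !names_cat !names_tails names_heads.
  by rewrite !mem_cat !mem_rcons !inE; case: (a \in S); rewrite ?orbT ?orbF ?orbb.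
have D' : ~~ has [in names w] (names (wheel_ct b S)).
  by apply: contra D => /hasP[i ? ?]; apply/hasP; exists i.
have := cl_wheel U; rewrite size_iota => <-; rewrite -/(wheel_fa b S) -clM.
rewrite -(cl_mul D (ct_wheel_fa b S) (ct_mon w)) -(cl_mul D' (ct_mon w) (ct_wheel_fa b S)).
have := null_eq 1 1 (wheel_central U nw).
by rewrite !mul1r !mulr1.
Qed.

Lemma gauss_even s : gauss s -> size s = (size s)./2.*2.
Proof.
move=> /andP[Us /allP As]; suff -> : size s = (count (fun z => z.1) s).*2 by rewrite doubleK.
rewrite -(count_predC (fun z => z.1)) -addnn; congr addn.
rewrite -!size_filter -(size_map (fun z : letter => (~~ z.1, z.2))).
apply: perm_size; apply: uniq_perm; rewrite ?filter_uniq //.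
  by rewrite map_inj_uniq ?filter_uniq // => -[[] i] [[] j] [] // ->.
move=> z'; rewrite mem_filter; apply/mapP/andP => [[t]|[zt zs]].
  by rewrite mem_filter => /andP[/= nt ts] ->; split; [rewrite /= (negbTE nt) | apply: As].
exists (~~ z'.1, z'.2); last by rewrite /= negbK -surjective_pairing.
by rewrite mem_filter /= negbK; apply/andP; split; [| apply: As].
Qed.

(** The centre is a subspace that contains 1 and is stable under multiplication by [D_R] and the
    wheels, so the spanning argument applies to it with the degree ignored. *)
Lemma aw_mulC (x y : Aw) : x * y = y * x.
Proof.
pose V (n : nat) x := forall y : Aw, x * y = y * x.
have VM z t : V 0%N z -> V 0%N t -> V 0%N (z * t).
  by move=> cz ct y'; rewrite -mulrA ct mulrA cz mulrA.
move: x; apply: (aw_ext (mulr_linear_r y) (mulr_linear_l y)) => w.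
have [gw|n] := boolP (gauss w); last by rewrite (clw_ngauss n) mul0r mulr0.
have sz := gauss_even gw.
refine (@span_word V _ _ _ _ w (size w)./2 sz y).
- move=> n; split; first by move=> t; rewrite mul0r mulr0.
  move=> b s t cs ct y'; apply: etrans (mulr_linear_r y' b s t) _.
  by apply: etrans _ (esym (mulr_linear_l y' b s t)); rewrite cs ct.
- by move=> t; rewrite mul1r mulr1.
- by move=> n t; apply: VM => ?; apply: D_R_central.
- by move=> k n t; apply: VM => ?; apply: omega_central.
Qed.

(** * The co-product: primitive elements and multiplicativity *)

Definition wsplit (U : {fset nat}) (w : seq letter) : tensor Aw Aw :=
  tens (clw (wrestr (fun a => a \in U) w)) (clw (wrestr (fun a => a \notin U) w)).
(** Fixing the set [U] of arrows makes each summand of the co-product linear on the free algebra,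
    where it can be evaluated on brackets. *)
Definition dU (U : {fset nat}) : FA -> tensor Aw Aw := fa_ext (wsplit U).

Lemma dU_linear U : linear (dU U). Proof. exact: fa_ext_linear. Qed.
Lemma dUM U w : dU U (mon w) = wsplit U w. Proof. exact: fa_extE. Qed.

Lemma wrestr_cat p u v : wrestr p (u ++ v) = wrestr p u ++ wrestr p v.
Proof. exact: filter_cat. Qed.

Lemma wrestr_all (p : pred nat) w : {in names w, forall a, p a} -> wrestr p w = w.
Proof. by move=> h; apply/all_filterP/allP => x xw; apply/h/map_f. Qed.

Lemma wrestr_none (p : pred nat) w : {in names w, forall a, ~~ p a} -> wrestr p w = [::].
Proof.
move=> h; apply/eqP; rewrite -size_eq0 size_filter -leqn0 leqNgt -has_count.
by apply/hasPn => x xw; apply/h/map_f.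
Qed.

Lemma ad_comul_wsplit (D : arrow_diag) :
  ad_comul D = \sum_(U <- fpowerset (arrows D)) wsplit U D.
Proof.
rewrite /ad_comul; apply: eq_bigr => U _; rewrite /wsplit.
by rewrite -!clwE.
Qed.

Definition name_set (w : seq letter) : {fset nat} := [fset a in names w].

Lemma in_name_set a w : (a \in name_set w) = (a \in names w).
Proof. by rewrite !inE. Qed.

Lemma comul_clw w : gauss w -> aw_comul (clw w) = \sum_(U <- fpowerset (name_set w)) wsplit U w.
Proof. by move=> g; rewrite (clw_gauss g) aw_comulE ad_comul_wsplit. Qed.

Lemma comul_cl c x : gauss c -> ct c x ->
  aw_comul (cl x) = \sum_(U <- fpowerset (name_set c)) dU U x.
Proof.
move=> g; have l1 := comp_linear aw_comul_linear cl_linear.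
apply: (ct_lin_eq l1 (sum_linear _ dU_linear)) => w wc.
rewrite clM comul_clw ?(gauss_perm wc) //.
have -> : name_set w = name_set c.
  by apply/fsetP => a; rewrite !in_name_set /names (perm_mem (perm_map snd wc)).
by apply: eq_bigr => U _; rewrite dUM.
Qed.

(** Each co-factor sees letters of only one of [x] and [y], so their order is lost. *)
Lemma dU_exchange U c d x y u v : ct c x -> ct d y ->
  (forall a b, a \in names c -> b \in names d -> (a \in U) != (b \in U)) ->
  dU U (u * (x * y) * v) = dU U (u * (y * x) * v).
Proof.
move=> cx dy dis.
have L (f : FA -> FA) : linear f -> linear (fun z => dU U (f z)) := comp_linear (@dU_linear U).
have l0 z : linear (fun u : FA => u * z) by move=> a s t; rewrite mulrDl -scalerAl.
have l1 z : linear (fun u : FA => z * u) by move=> a s t; rewrite mulrDr -scalerAr.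
have lu z t : linear (fun u => dU U (u * z * t)) := L _ (comp_linear (l0 t) (l0 z)).
have lv z t : linear (fun v => dU U (z * t * v)) := L _ (l1 (z * t)).
have lm z t s : linear (fun m => dU U (z * (m * s) * t)) :=
  L _ (comp_linear (l0 t) (comp_linear (l1 z) (l0 s))).
have lr z t s : linear (fun m => dU U (z * (s * m) * t)) :=
  L _ (comp_linear (l0 t) (comp_linear (l1 z) (l1 s))).
apply: (fa_lin_ext (lu (x * y) v) (lu (y * x) v)) => {}u.
apply: (fa_lin_ext (lv _ (x * y)) (lv _ (y * x))) => {}v.
apply: (ct_lin_eq (lm _ _ y) (lr _ _ y) _ cx) => w wc.
apply: (ct_lin_eq (lr _ _ (mon w)) (lm _ _ (mon w)) _ dy) => z zd.
rewrite -!mon_cat !dUM /wsplit !wrestr_cat.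
suff E p : (forall a b, a \in names c -> b \in names d -> p a != p b) ->
    wrestr p w ++ wrestr p z = wrestr p z ++ wrestr p w.
  rewrite !E // => a b ac bd; have := dis a b ac bd.
  by case: (a \in U); case: (b \in U).
move=> {}dis.
have nw a : a \in names w -> a \in names c by rewrite /names (perm_mem (perm_map snd wc)).
have nz a : a \in names z -> a \in names d by rewrite /names (perm_mem (perm_map snd zd)).
have [/hasP[a aw pa]|/hasPn na] := boolP (has p (names w)).
  rewrite (@wrestr_none _ z) ?cats0 // => b bz; have := dis a b (nw _ aw) (nz _ bz).
  by rewrite pa; case: (p b).
by rewrite (@wrestr_none _ w) ?cats0.
Qed.

Lemma dU_br0 U c d x y u v : ct c x -> ct d y ->
  (forall a b, a \in names c -> b \in names d -> (a \in U) != (b \in U)) ->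
  dU U (u * br x y * v) = 0.
Proof.
move=> cx dy dis; have -> : u * br x y * v = (-1) *: (u * (y * x) * v) + u * (x * y) * v.
  by rewrite scaleN1r /br mulrBr mulrBl addrC.
by rewrite dU_linear scaleN1r (dU_exchange _ _ cx dy dis) addNr.
Qed.

Lemma dU_br_l U x y u v : (forall u v, dU U (u * x * v) = 0) -> dU U (u * br x y * v) = 0.
Proof.
move=> x0; have -> : u * br x y * v = (-1) *: ((u * y) * x * v) + u * x * (y * v).
  by rewrite scaleN1r /br mulrBr mulrBl addrC !mulrA.
by rewrite dU_linear !x0 scaler0 addr0.
Qed.

Lemma dU_br_r U x y u v : (forall u v, dU U (u * y * v) = 0) -> dU U (u * br x y * v) = 0.
Proof.
move=> y0; have -> : u * br x y * v = (-1) *: (u * y * (x * v)) + (u * x) * y * v.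
  by rewrite scaleN1r /br mulrBr mulrBl addrC !mulrA.
by rewrite dU_linear !y0 scaler0 addr0.
Qed.

(** At the innermost spoke on the other side from [b], the bracket is one between arrows separated
    by [U]; its vanishing is inherited by the outer brackets. *)
Lemma dU_adH U S b : (forall a, a \in S -> (a \in U) = (b \in U)) \/
  (forall u v, dU U (u * adH S b * v) = 0).
Proof.
elim: S => [|c S [same|zero]] /=; [by left | | by right=> u v; apply: dU_br_r].
case: (eqVneq (c \in U) (b \in U)) => [cb|cb].
  by left=> a; rewrite inE => /orP[/eqP ->|/same].
right=> u v; apply: (dU_br0 _ _ (ct_mon [:: (false, c)]) (ct_adH S b)) => i j.
rewrite names_heads mem_rcons !inE => /eqP -> /orP[/eqP -> //|/same -> //].
Qed.

Lemma dU_wheel U b S : ~ (forall a, a \in S -> (a \in U) = (b \in U)) ->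
  dU U (wheel_fa b S) = 0.
Proof.
move=> nsame; have [//|z] := dU_adH U S b.
by have := dU_br_l (T b) (mon (tails S)) 1 z; rewrite mulr1.
Qed.

Definition primitive (x : Aw) := aw_comul x = tens x 1 + tens 1 x.

(** The two extreme subsets, all arrows and no arrow, contribute the two primitive terms. *)
Lemma primitive_cl c x : gauss c -> name_set c != fset0 -> ct c x ->
  (forall U, U `<=` name_set c -> U != fset0 -> U != name_set c -> dU U x = 0) ->
  primitive (cl x).
Proof.
move=> g n0 cx z; rewrite /primitive (comul_cl g cx).
have cln : clw [::] = 1 by apply: (clwE ad_one).
rewrite (big_fsetD1 (name_set c)) ?fpowersetE //= (big_fsetD1 fset0) /=; last first.
  by rewrite !inE eq_sym n0 fpowersetE fsub0set.
congr (_ + _).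
  have lt : linear (fun x => tens (cl x) (1 : Aw)).
    by move=> a y t; rewrite linearP tens_linear_l.
  apply: (ct_lin_eq (@dU_linear _) lt _ cx) => w wc.
  have nw a : a \in names w -> a \in name_set c.
    by rewrite in_name_set /names (perm_mem (perm_map snd wc)).
  rewrite dUM /wsplit wrestr_all ?wrestr_none ?cln ?clM // => a /nw -> //.
rewrite big_seq big1 => [|U]; last first.
  by rewrite !inE fpowersetE => /and3P[? ? ?]; apply: z.
apply: etrans (addr0 _) _.
have lt : linear (fun x => tens (1 : Aw) (cl x)).
  by move=> a y t; rewrite linearP tens_linear_r.
apply: (ct_lin_eq (@dU_linear _) lt _ cx) => w wc.
by rewrite dUM /wsplit wrestr_none ?wrestr_all ?cln ?clM // => a _; rewrite in_fset0.
Qed.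

Lemma primitive_omega n : primitive (omega n).
Proof.
have U : uniq (rcons (iota 0 n) n) by rewrite rcons_uniq iota_uniq mem_iota ltnn.
have N a : (a \in name_set (wheel_ct n (iota 0 n))) = (a \in rcons (iota 0 n) n).
  rewrite in_name_set !names_cat !names_tails names_heads !mem_cat !mem_rcons !inE.
  by case: (a \in iota 0 n); rewrite ?orbT ?orbF //= orbb.
apply: (primitive_cl (gauss_wheel U)) (ct_wheel_fa _ _) _.
  by apply/fset0Pn; exists n; rewrite N mem_rcons mem_head.
move=> V VN V0 VN'; apply: dU_wheel => same; case/negP: VN'; rewrite eqEfsubset VN /=.
case/fset0Pn: V0 => a aV; have nV : n \in V.
  by have := fsubsetP VN _ aV; rewrite N mem_rcons inE => /orP[/eqP <-//|/same <-].
apply/fsubsetP => i; rewrite N mem_rcons inE => /orP[/eqP -> //|/same ->//].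
Qed.

Lemma primitive_one (w : seq letter) : gauss w -> names w =i [:: 0%N] -> primitive (clw w).
Proof.
move=> g nw; rewrite -clM; have N : name_set w = [fset 0%N].
  by apply/fsetP => a; rewrite in_name_set nw !inE.
apply: (primitive_cl g _ (ct_mon w)).
  by apply/fset0Pn; exists 0%N; rewrite N inE.
by move=> U; rewrite N fsubset1 => /orP[/eqP ->|/eqP ->]; rewrite ?eqxx.
Qed.

Lemma primitive_D_R : primitive D_R.
Proof. by rewrite /D_R -clwE; apply: primitive_one => // a; rewrite !inE orbb. Qed.
Lemma primitive_D_L : primitive D_L.
Proof. by rewrite /D_L -clwE; apply: primitive_one => // a; rewrite !inE orbb. Qed.

Lemma fpowersetU (V : lmodType rat) (A B : {fset nat}) (F : {fset nat} -> V) :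
  [disjoint A & B]%fset ->
  \sum_(U <- fpowerset (A `|` B)) F U
  = \sum_(X <- fpowerset A) \sum_(Y <- fpowerset B) F (X `|` Y).
Proof.
move=> dis.
transitivity (\sum_(U <- [seq X `|` Y | X <- fpowerset A, Y <- fpowerset B]) F U);
  last by rewrite big_allpairs_dep.
have S X : X `<=` A `|` B -> X = (X `&` A) `|` (X `&` B).
  by move=> XAB; rewrite -fsetIUr; apply/esym/fsetIidPl.
apply: perm_big; apply: uniq_perm; first exact: fset_uniq.
  apply: allpairs_uniq; [exact: fset_uniq | exact: fset_uniq |].
  move=> -[X Y] [X' Y'] /allpairsP[[X1 Y1] /= [X1A Y1B [-> ->]]]
    /allpairsP[[X2 Y2] /= [X2A Y2B [-> ->]]] /= E.
  rewrite !fpowersetE in X1A Y1B X2A Y2B.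
  have I (C D : {fset nat}) : C `<=` A -> D `<=` B -> (C `|` D) `&` A = C /\ (C `|` D) `&` B = D.
    move=> /fsubsetP CA /fsubsetP DB; split; apply/fsetP => i; rewrite !inE.
      case: (boolP (i \in C)) => [/CA -> //|_] /=; case: (boolP (i \in D)) => //= /DB iB.
      by apply/negP => iA; have /fdisjointP/(_ _ iA)/negP := dis.
    case: (boolP (i \in D)) => [/DB -> |_]; rewrite ?orbT ?orbF //.
    case: (boolP (i \in C)) => //= /CA iA.
    by have /fdisjointP/(_ _ iA)/negbTE := dis.
  have [e1 e2] := I _ _ X1A Y1B; have [e3 e4] := I _ _ X2A Y2B.
  by congr (_, _); [rewrite -e1 E e3 | rewrite -e2 E e4].
move=> X; apply/idP/allpairsP => [|[[Y Z] /= [YA ZB ->]]]; rewrite fpowersetE.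
  move=> XAB; exists (X `&` A, X `&` B) => /=; rewrite !fpowersetE !fsubsetIr; split=> //.
  exact: S.
by rewrite !fpowersetE in YA ZB; apply: fsetUSS.
Qed.

Lemma names_wrestr p w a : a \in names (wrestr p w) -> a \in names w.
Proof. by case/mapP => x; rewrite mem_filter => /andP[_ xw] ->; apply: map_f. Qed.

Lemma comul_cat u v : gauss u -> gauss v -> ~~ has [in names u] (names v) ->
  aw_comul (clw (u ++ v)) = tmul (aw_comul (clw u)) (aw_comul (clw v)).
Proof.
move=> gu gv dis.
have dis' a : a \in names u -> a \in names v -> False.
  by move=> au av; case/hasP: dis; exists a.
have g : gauss (u ++ v).
  have /andP[Uu /allP Au] := gu; have /andP[Uv /allP Av] := gv.
  apply/andP; split.
    rewrite cat_uniq Uu Uv andbT /=; apply/hasPn => x xv; apply/negP => xu.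
    by apply: (dis' x.2); apply: map_f.
  by apply/allP => x; rewrite !mem_cat => /orP[/Au ->|/Av ->]; rewrite ?orbT.
have N : name_set (u ++ v) = name_set u `|` name_set v.
  by apply/fsetP => a; rewrite inE !in_name_set names_cat mem_cat.
have nd : [disjoint name_set u & name_set v]%fset.
  by apply/fdisjointP => a; rewrite !in_name_set => au; apply/negP => /(dis' a au).
rewrite !comul_clw // N fpowersetU //.
have tl (t : tensor Aw Aw) := tmul_linear_l t.
have -> : tmul (\sum_(X <- fpowerset (name_set u)) wsplit X u)
     (\sum_(Y <- fpowerset (name_set v)) wsplit Y v)
   = \sum_(X <- fpowerset (name_set u)) \sum_(Y <- fpowerset (name_set v))
        tmul (wsplit X u) (wsplit Y v).
  rewrite (linear_bigE _ _ (tl _)); apply: eq_bigr => X _.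
  exact: (linear_bigE _ _ (tmul_linear_r _)).
rewrite big_seq [RHS]big_seq; apply: eq_bigr => X; rewrite fpowersetE => /fsubsetP Xu.
rewrite big_seq [RHS]big_seq; apply: eq_bigr => Y; rewrite fpowersetE => /fsubsetP Yv.
rewrite /wsplit tmul_tens !wrestr_cat.
have EX p : (forall a, p a = (a \in X `|` Y)) -> wrestr p u = wrestr (fun a => a \in X) u.
  move=> pE; apply: eq_in_filter => x xu; rewrite pE inE.
  case: (boolP (x.2 \in Y)) => [/Yv|]; rewrite ?orbF // in_name_set => xv.
  by case: (dis' x.2) => //; apply: map_f.
have EY p : (forall a, p a = (a \in X `|` Y)) -> wrestr p v = wrestr (fun a => a \in Y) v.
  move=> pE; apply: eq_in_filter => x xv; rewrite pE inE.
  case: (boolP (x.2 \in X)) => [/Xu|] //; rewrite in_name_set => xu.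
  by case: (dis' x.2) => //; apply: map_f.
have EX' : wrestr (fun a => a \notin X `|` Y) u = wrestr (fun a => a \notin X) u.
  apply: eq_in_filter => x xu; rewrite inE negb_or.
  case: (boolP (x.2 \in Y)) => [/Yv|]; rewrite ?andbT // in_name_set => xv.
  by case: (dis' x.2) => //; apply: map_f.
have EY' : wrestr (fun a => a \notin X `|` Y) v = wrestr (fun a => a \notin Y) v.
  apply: eq_in_filter => x xv; rewrite inE negb_or.
  case: (boolP (x.2 \in X)) => [/Xu|] //; rewrite in_name_set => xu.
  by case: (dis' x.2) => //; apply: map_f.
have d p q : ~~ has [in names (wrestr p u)] (names (wrestr q v)).
  by apply/hasPn => a /names_wrestr av; apply/negP => /= /names_wrestr au; apply: (dis' a).
rewrite (EX (fun a => a \in X `|` Y) (fun _ => erefl)).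
rewrite (EY (fun a => a \in X `|` Y) (fun _ => erefl)) EX' EY'.
by rewrite (clw_cat (d _ _)) (clw_cat (d _ _)).
Qed.

Lemma aw_comulM x y : aw_comul (x * y) = tmul (aw_comul x) (aw_comul y).
Proof.
have l1 z := comp_linear aw_comul_linear (mulr_linear_r z).
have l2 z := comp_linear aw_comul_linear (mulr_linear_l z).
have r1 z : linear (fun x => tmul (aw_comul x) z) := comp_linear (tmul_linear_l z) aw_comul_linear.
have r2 z : linear (fun x => tmul z (aw_comul x)) := comp_linear (tmul_linear_r z) aw_comul_linear.
move: x; apply: (aw_ext (l1 y) (r1 _)) => u; move: y; apply: (aw_ext (l2 _) (r2 _)) => v.
have [gu|nu] := boolP (gauss u); last first.
  by rewrite (clw_ngauss nu) (linear_at0 (l1 _)) (linear_at0 (r1 _)).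
have [gv|nv] := boolP (gauss v); last first.
  by rewrite (clw_ngauss nv) (linear_at0 (l2 _)) (linear_at0 (r2 _)).
pose v' := map_names (addn (wnext u)) v.
have I : {in names v &, injective (addn (wnext u))} by move=> i j _ _; apply: addnI.
have dis : ~~ has [in names u] (names v').
  apply/hasPn => _ /mapP[_ /mapP[x xv ->] ->] /=; apply/negP => /names_lt.
  by rewrite ltnNge leq_addr.
by rewrite -(clw_relabel I) -/v' -clw_cat // comul_cat // gauss_map.
Qed.

Lemma aw_comul1 : aw_comul 1 = tens 1 1.
Proof.
have cln : clw [::] = 1 by apply: (clwE ad_one).
rewrite -cln comul_clw //.
have -> : name_set [::] = fset0 by apply/fsetP => a; rewrite in_name_set.
by rewrite fpowerset0 big_seq_fset1.
Qed.

Lemma aw_counit_linear : linear (aw_counit : Aw -> rat^o).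
Proof. exact: (qlift_linear ad_counit_rel). Qed.

Lemma aw_counitM x y : aw_counit (x * y) = aw_counit x * aw_counit y.
Proof.
have l1 z : linear (fun x : Aw => aw_counit (x * z) : rat^o).
  exact: comp_linear aw_counit_linear (mulr_linear_r z).
have l2 z : linear (fun x : Aw => aw_counit (z * x) : rat^o).
  exact: comp_linear aw_counit_linear (mulr_linear_l z).
have lr (c : rat) : linear (fun z : rat^o => z * c : rat^o).
  by move=> a z t; change ((a * z + t) * c = a * (z * c) + t * c :> rat); rewrite mulrDl mulrA.
have ll (c : rat) : linear (fun z : rat^o => c * z : rat^o).
  by move=> a z t; change (c * (a * z + t) = a * (c * z) + c * t :> rat); rewrite mulrDr mulrCA.
move: x; apply: (aw_ext (l1 y) (comp_linear (lr _) aw_counit_linear)) => u.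
move: y; apply: (aw_ext (l2 _) (comp_linear (ll _) aw_counit_linear)) => v.
have c0 : aw_counit 0 = 0 by exact: (linear_at0 aw_counit_linear).
have [gu|nu] := boolP (gauss u); last by rewrite (clw_ngauss nu) !mul0r c0 mul0r.
have [gv|nv] := boolP (gauss v); last by rewrite (clw_ngauss nv) !mulr0 c0 mulr0.
rewrite (clw_gauss gu) (clw_gauss gv) clsM !aw_counitE -natrM mulnb; congr (_%:R).
by rewrite -!val_eqE /=; case: (u) => [|? ?]; case: (v).
Qed.

Lemma aw_counit1 : aw_counit 1 = 1.
Proof. by change (aw_counit (cls ad_one) = 1); rewrite aw_counitE eqxx. Qed.

Lemma malg_ext (K : choiceType) (W : lmodType rat) (f g : {malg rat[K]} -> W) :
  linear f -> linear g -> (forall k, f << k >> = g << k >>) -> f =1 g.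
Proof.
move=> lf lg fg x; rewrite [x]monalgE (linear_bigE _ _ lf) (linear_bigE _ _ lg); apply: eq_bigr => k _.
have -> : << x@_k *g k >> = x@_k *: << k >> :> {malg rat[K]}.
  by apply/malgP => j; rewrite mcoeffZ !mcoeffU mulr_natr.
by rewrite (linear_scale _ _ lf) (linear_scale _ _ lg) fg.
Qed.

Lemma malgUM (K : monomType) (k k' : K) :
  << k >> * << k' >> = << mmul k k' >> :> {malg rat[K]}.
Proof. by rewrite malgM_def fgmulUU mul1r. Qed.

(** * Morphisms from polynomial bialgebras *)

Section Evaluation.
Variables (I : choiceType) (S : comAlgType rat) (el : I -> S).

Definition monev (m : {cmonom I}) : S := \prod_(i <- finsupp m) el i ^+ m i.
Definition evalp (p : poly_alg I) : S := linext monev p.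

Lemma monevEw (d : {fset I}) (m : {cmonom I}) : finsupp m `<=` d ->
  monev m = \prod_(i <- d) el i ^+ m i.
Proof.
move=> le; rewrite /monev; apply: big_fset_incl => // i _.
by rewrite -cmE_eq0 => /eqP ->; rewrite expr0.
Qed.

Lemma monevM (m m' : {cmonom I}) : monev (mmul m m') = monev m * monev m'.
Proof.
rewrite {1}/monev mdomD (monevEw (fsubsetUl _ (finsupp m'))).
rewrite (monevEw (fsubsetUr (finsupp m) _)) -big_split /=.
by apply: eq_bigr => i _; rewrite cmM exprD.
Qed.

Lemma monev1 : monev mone = 1.
Proof. by rewrite /monev mdom1 big_seq_fset0. Qed.

Lemma evalpU m : evalp << m >> = monev m.
Proof. exact: linextU. Qed.

Lemma evalp_linear : linear evalp.
Proof. exact: linext_linear. Qed.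

Lemma evalp1 : evalp 1 = 1.
Proof. by rewrite evalpU monev1. Qed.

Lemma evalpM p q : evalp (p * q) = evalp p * evalp q.
Proof.
have ml (z : poly_alg I) : linear (fun x : poly_alg I => x * z).
  by move=> a x y; rewrite mulrDl -scalerAl.
have mr (z : poly_alg I) : linear (fun x : poly_alg I => z * x).
  by move=> a x y; rewrite mulrDr -scalerAr.
have nl (z : S) : linear (fun x : poly_alg I => evalp x * z).
  by move=> a x y; rewrite evalp_linear mulrDl -scalerAl.
have nr (z : S) : linear (fun x : poly_alg I => z * evalp x).
  by move=> a x y; rewrite evalp_linear mulrDr -scalerAr.
move: p; apply: (malg_ext (comp_linear evalp_linear (ml q)) (nl _)) => m.
move: q; apply: (malg_ext (comp_linear evalp_linear (mr _)) (nr _)) => m'.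
apply: (etrans (congr1 evalp (malgUM m m'))).
apply: (etrans (evalpU _)); apply: (etrans (monevM _ _)).
by rewrite -(evalpU m) -(evalpU m').
Qed.

Lemma evalp_var i : evalp (pvar i) = el i.
Proof. by rewrite evalpU /monev mdomU big_seq_fset1 cmUU expr1. Qed.
End Evaluation.

Lemma tmap_mul (A B : algType rat) (f : A -> B) : linear f ->
  (forall x y, f (x * y) = f x * f y) ->
  forall x y, tmap f f (tmul x y) = tmul (tmap f f x) (tmap f f y).
Proof.
move=> lf fM x y; have lt := tmap_linear lf lf.
have l1 z : linear (fun x => tmap f f (tmul x z)) := comp_linear lt (tmul_linear_l z).
have l2 z : linear (fun x => tmap f f (tmul z x)) := comp_linear lt (tmul_linear_r z).
have r1 z : linear (fun x => tmul (tmap f f x) z) := comp_linear (tmul_linear_l z) lt.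
have r2 z : linear (fun x => tmul z (tmap f f x)) := comp_linear (tmul_linear_r z) lt.
move: x; apply: (tensor_ext (l1 y) (r1 _)) => a b.
move: y; apply: (tensor_ext (l2 _) (r2 _)) => c d.
rewrite tmul_tens (tmapE lf lf) (tmapE lf lf) (tmapE lf lf) tmul_tens.
by rewrite fM fM.
Qed.

Section ComulMonomial.
Variables (A B : algType rat) (f : A -> B) (Delta : B -> tensor B B).
Hypotheses (lf : linear f) (fM : forall x y, f (x * y) = f x * f y) (f1 : f 1 = 1).
Hypotheses (DM : forall x y, Delta (x * y) = tmul (Delta x) (Delta y))
  (D1 : Delta 1 = tens 1 1).
Variables (I : Type) (X : I -> A).
Hypothesis prim : forall i, Delta (f (X i)) = tens (f (X i)) 1 + tens 1 (f (X i)).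

Lemma comul_monomial (s : seq I) (m : I -> nat) :
  Delta (\prod_(i <- s) f (X i) ^+ m i)
  = tmap f f (\big[@tmul A A/tens 1 1]_(i <- s)
      iter (m i) (tmul (tens (X i) 1 + tens 1 (X i))) (tens 1 1)).
Proof.
elim: s => [|i s IH]; first by rewrite !big_nil D1 (tmapE lf lf) f1.
rewrite !big_cons DM IH (tmap_mul lf fM); congr tmul.
elim: (m i) => [|k IHk] /=; first by rewrite expr0 D1 (tmapE lf lf) f1.
rewrite exprS DM IHk (tmap_mul lf fM); congr tmul.
have tD u v : tmap f f (u + v) = tmap f f u + tmap f f v.
  by have := tmap_linear lf lf 1 u v; rewrite !scale1r.
by rewrite prim tD (tmapE lf lf) (tmapE lf lf) f1.
Qed.
End ComulMonomial.

Lemma aw_homog0 n : aw_homog n 0.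
Proof. by exists 0; [rewrite /awpi linear0 | move=> D; rewrite msupp0 in_fset0]. Qed.

Lemma aw_homogP n a x y : aw_homog n x -> aw_homog n y -> aw_homog n (a *: x + y).
Proof.
move=> [u -> hu] [v -> hv]; exists (a *: u + v); first by rewrite /awpi linearP.
move=> D /(fsubsetP (msuppD_le _ _)); rewrite inE => /orP[|/hv //].
by move=> /(fsubsetP (msuppZ_le _ _)) /hu.
Qed.

Lemma aw_homog_subspace n : subspace (aw_homog n).
Proof. by split; [apply: aw_homog0 | apply: aw_homogP]. Qed.

Lemma aw_homogM n k x y : aw_homog n x -> aw_homog k y -> aw_homog (n + k) (x * y).
Proof.
move=> [u -> hu] [v -> hv]; exists (u * v); first exact: aw_mulE.
move=> D /msuppM_le [D1 [D2 [/hu s1 /hv s2 ->]]].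
by rewrite /= /wcat size_cat size_map s1 s2 doubleD.
Qed.

Lemma aw_homog_clw n w : size w = n.*2 -> aw_homog n (clw w).
Proof.
move=> sw; have [g|ng] := boolP (gauss w); last by rewrite (clw_ngauss ng); apply: aw_homog0.
exists (ad (ArrowDiag g)); first by rewrite (clw_gauss g).
by move=> D; rewrite /ad msuppU1 inE => /eqP ->.
Qed.

Lemma aw_homog1 : aw_homog 0 1.
Proof.
by have <- : clw [::] = 1 := clwE ad_one; apply: aw_homog_clw.
Qed.

Lemma aw_homog_cl n c x : size c = n.*2 -> ct c x -> aw_homog n (cl x).
Proof.
move=> sc cx; apply: (subspace_span (aw_homog_subspace n) cl_linear _ cx) => _ [w wc ->].
by rewrite clM; apply: aw_homog_clw; rewrite (perm_size wc).
Qed.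

(** An alias that carries the commutativity just proved, which [evalp] demands of its target. *)
Definition AwC : Type := Aw.
HB.instance Definition _ := GRing.Algebra.on AwC.
HB.instance Definition _ := GRing.PzRing_hasCommutativeMul.Build AwC aw_mulC.

Section AwMorphism.
Variables (I : choiceType) (wt : I -> nat) (el : I -> Aw).

Definition aw_eval : poly_alg I -> Aw := evalp (el : I -> AwC).

Lemma aw_eval_linear : linear aw_eval.
Proof. exact: (@evalp_linear I AwC el). Qed.
Lemma aw_evalM p q : aw_eval (p * q) = aw_eval p * aw_eval q.
Proof. exact: (@evalpM I AwC el). Qed.
Lemma aw_eval1 : aw_eval 1 = 1. Proof. exact: (@evalp1 I AwC el). Qed.
Lemma aw_eval_var i : aw_eval (pvar i) = el i. Proof. exact: (@evalp_var I AwC el). Qed.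
Lemma aw_evalU (m : {cmonom I}) : aw_eval << m >> = \prod_(i <- finsupp m) el i ^+ m i.
Proof. exact: (@evalpU I AwC el). Qed.

HB.instance Definition _ :=
  GRing.isLinear.Build rat (poly_alg I) Aw *:%R aw_eval aw_eval_linear.
HB.instance Definition _ :=
  GRing.isMonoidMorphism.Build (poly_alg I) Aw aw_eval (conj aw_eval1 aw_evalM).

Definition aw_morphism : {lrmorphism poly_alg I -> Aw} := aw_eval.

Hypothesis prim : forall i, primitive (el i).
Hypothesis counit0 : forall i, aw_counit (el i) = 0.
Hypothesis homog_el : forall i, aw_homog (wt i) (el i).

Lemma aw_eval_comul p : aw_comul (aw_eval p) = tmap aw_eval aw_eval (poly_comul p).
Proof.
have lc : linear (@poly_comul I) := linext_linear _.
move: p; apply: (malg_ext (comp_linear aw_comul_linear aw_eval_linear)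
  (comp_linear (tmap_linear aw_eval_linear aw_eval_linear) lc)) => m.
rewrite aw_evalU /poly_comul linextU /mon_comul.
rewrite -(comul_monomial aw_eval_linear aw_evalM aw_eval1 aw_comulM aw_comul1); last first.
  by move=> i; rewrite aw_eval_var; apply: prim.
by congr aw_comul; apply: eq_bigr => i _; rewrite aw_eval_var.
Qed.

Lemma aw_eval_counit p : aw_counit (aw_eval p) = p@_(mone : {cmonom I}).
Proof.
have l2 : linear (fun p : poly_alg I => p@_mone : rat^o).
  by move=> a x y; rewrite mcoeffD mcoeffZ.
move: p; apply: (malg_ext (comp_linear aw_counit_linear aw_eval_linear) l2) => m.
rewrite aw_evalU mcoeffU1 (big_morph aw_counit aw_counitM aw_counit1).
have cX x n : aw_counit (x ^+ n) = aw_counit x ^+ n.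
  by elim: n => [|n IH]; rewrite ?expr0 ?aw_counit1 // !exprS aw_counitM IH.
case: eqP => [->|/eqP m1]; first by rewrite mdom1 big_seq_fset0.
have /fset0Pn[i im] : finsupp m != fset0.
  apply: contra m1 => /eqP m0; apply/cmP => i; rewrite cm1.
  by apply/eqP; rewrite cmE_eq0 m0.
rewrite (big_fsetD1 i) //= cX counit0.
by have := im; rewrite -cmE_neq0; case: (m i) => // k _; rewrite exprS !mul0r.
Qed.

Lemma aw_eval_homog n p : poly_homog wt n p -> aw_homog n (aw_eval p).
Proof.
move=> hp; rewrite [p]monalgE linear_bigE; last exact: aw_eval_linear.
rewrite big_seq; apply: big_ind => [|x y|m mp]; first exact: aw_homog0.
  exact: (subD (aw_homog_subspace n)).
rewrite malg_scaleU (linear_scale _ _ aw_eval_linear).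
apply: (subZ (aw_homog_subspace n)); rewrite -(hp m mp) /mon_deg aw_evalU.
elim: (finsupp m : seq I) => [|i s IH]; rewrite ?big_nil ?big_cons; first exact: aw_homog1.
apply: aw_homogM IH; elim: (m i) => [|k IHk]; first by rewrite expr0; apply: aw_homog1.
by rewrite exprS mulSn; apply: aw_homogM.
Qed.

Lemma aw_morphism_bialg : gbialg_morphism (poly_bialg wt) aw_bialg aw_morphism.
Proof.
by split; [apply: aw_eval_comul | apply: aw_eval_counit | apply: aw_eval_homog].
Qed.
End AwMorphism.

Definition upd (St : Type) (s : nat -> St) (e : nat) (t : St) : nat -> St :=
  fun x => if x == e then t else s x.

(** * State sums *)

Section StateSum.
Variables (St : finType) (V : lmodType rat).
Implicit Types (s : nat -> St) (F G : (nat -> St) -> V) (es : seq nat).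

(** Labellings are total functions on names: the sum overwrites the labels of [es] and takes all
    others from [s]. *)
Fixpoint ssum es F s : V :=
  if es is e :: es' then \sum_t ssum es' F (upd s e t) else F s.

Lemma ssum_eq_off es F G s :
  (forall s', (forall x, x \notin es -> s' x = s x) -> F s' = G s') ->
  ssum es F s = ssum es G s.
Proof.
elim: es s => [|e es IH] s FG /=; first exact: FG.
apply: eq_bigr => t _; apply: IH => s' h; apply: FG => x.
by rewrite inE negb_or => /andP[xe xes]; rewrite h // /upd (negbTE xe).
Qed.

Lemma ssum_eq es F G s : F =1 G -> ssum es F s = ssum es G s.
Proof. by move=> FG; apply: ssum_eq_off. Qed.

Lemma ssum_cat es es' F s : ssum (es ++ es') F s = ssum es (ssum es' F) s.
Proof. by elim: es s => //= e es IH s; apply: eq_bigr. Qed.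

Lemma ssumD es F G s : ssum es (fun s => F s + G s) s = ssum es F s + ssum es G s.
Proof.
by elim: es s => //= e es IH s; rewrite -big_split; apply: eq_bigr.
Qed.

Lemma ssumL es F (L : V -> V) s : linear L -> ssum es (fun s => L (F s)) s = L (ssum es F s).
Proof.
move=> lL; elim: es s => //= e es IH s; rewrite linear_bigE //.
by apply: eq_bigr.
Qed.

Lemma ssumZ es F (c : rat) s : ssum es (fun s => c *: F s) s = c *: ssum es F s.
Proof.
by apply: (@ssumL es F (fun v => c *: v)) => a x y; rewrite scalerDr !scalerA mulrC.
Qed.

Lemma ssumB es F G s : ssum es (fun s => F s - G s) s = ssum es F s - ssum es G s.
Proof.
rewrite -scaleN1r -ssumZ -ssumD; apply: ssum_eq => s'.
by rewrite scaleN1r.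
Qed.

Lemma upd_comm s e e' t t' : e != e' -> upd (upd s e t) e' t' = upd (upd s e' t') e t.
Proof.
move=> ee'; apply: funext => x; rewrite /upd.
by case: (eqVneq x e') => [->|//]; rewrite eq_sym (negbTE ee').
Qed.

Lemma ssum_front es1 e es2 F s : e \notin es1 ->
  ssum (es1 ++ e :: es2) F s = ssum (e :: es1 ++ es2) F s.
Proof.
elim: es1 s => //= d es1 IH s; rewrite inE negb_or => /andP[ed ees].
rewrite [RHS]exchange_big /=; apply: eq_bigr => t _; rewrite IH //=.
by apply: eq_bigr => t' _; rewrite upd_comm // eq_sym.
Qed.

Lemma ssum_perm es es' F s : uniq es -> perm_eq es es' -> ssum es F s = ssum es' F s.
Proof.
elim: es es' s => [|e es IH] es' s.
  by move=> _ p; rewrite (size0nil (s := es')) // -(perm_size p).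
move=> /= /andP[ees Ues] p; have ee' : e \in es' by rewrite -(perm_mem p) mem_head.
have Ues' : uniq es' by rewrite -(perm_uniq p) /= ees.
case/path.splitPr: es' / ee' p Ues' => p q pe Ues'.
rewrite ssum_front /=; last first.
  by move: Ues'; rewrite cat_uniq => /and3P[_ /hasPn/(_ e (mem_head _ _))].
apply: eq_bigr => t _; apply: IH => //.
by rewrite -(perm_cons e) (perm_trans pe) // -(cat1s e q) perm_catCA.
Qed.

Lemma ssum_map (f : nat -> nat) (N : pred nat) es F G s s' :
  {in N &, injective f} -> {subset es <= N} ->
  (forall s s', (forall x, x \in N -> s (f x) = s' x) -> F s = G s') ->
  (forall x, x \in N -> s (f x) = s' x) ->
  ssum (map f es) F s = ssum es G s'.
Proof.
move=> fI; elim: es s s' => [|e es IH] s s' sub FG ss' /=; first exact: FG.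
apply: eq_bigr => t _; apply: IH => // [x xes|x xN].
  by apply: sub; rewrite inE xes orbT.
have eN : e \in N by apply: sub; rewrite mem_head.
by rewrite /upd (inj_in_eq fI) // ss'.
Qed.

Lemma ssum_indep es F s s' :
  (forall s s', (forall x, x \in es -> s x = s' x) -> F s = F s') ->
  ssum es F s = ssum es F s'.
Proof.
(* [es1] collects the edges already relabelled, on which the two labellings agree. *)
move=> hF; suff H es1 es2 : (forall x, x \in es -> (x \in es1) || (x \in es2)) ->
    forall s s', (forall x, x \in es1 -> s x = s' x) -> ssum es2 F s = ssum es2 F s'.
  by apply: (H [::]).
elim: es2 es1 => [|e es2 IH] es1 cov {}s {}s' ss' /=.
  by apply: hF => x /cov; rewrite orbF; apply: ss'.
apply: eq_bigr => t _; apply: (IH (e :: es1)) => [x /cov|x].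
  by rewrite !inE => /or3P[->|->|->]; rewrite ?orbT.
by rewrite inE /upd; case: eqP => //= _ /ss'.
Qed.
End StateSum.

(** * Weight systems on diagrams with vertices *)

Ltac count_edges :=
  rewrite /edge_starts /edge_ends ?filter_cat ?map_cat ?count_cat /=
    ?filter_cat ?map_cat ?count_cat /=.

(* X represents a Lie algebra with basis St and structure constants f, and tau
   gives commuting operators transforming like the dual basis; a head labelled t
   acts by X t, a tail by tau t, and a vertex contributes f. *)
Section Weights.
Variables (St : finType) (V : lmodType rat) (s0 : St).
Variables (tau X : St -> V -> V) (f : St -> St -> St -> rat).
Hypotheses (ltau : forall t, linear (tau t)) (lX : forall t, linear (X t)).
Hypothesis tauC : forall t t' v, tau t (tau t' v) = tau t' (tau t v).
Hypothesis XX : forall l r v, X l (X r v) - X r (X l v) = \sum_o f l r o *: X o v.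
Hypothesis tauX : forall l o v, tau o (X l v) - X l (tau o v) = \sum_r f l r o *: tau r v.
Hypothesis f_anti : forall l r o, f l r o = - f r l o.
Implicit Types (s : nat -> St) (w : seq letter) (vs : seq vertex).

Definition act1 (x : letter) s : V -> V := if x.1 then tau (s x.2) else X (s x.2).
Definition act w s v : V := foldr (fun x u => act1 x s u) v w.
Definition coef vs s : rat := \prod_(p <- vs) f (s p.1.1) (s p.1.2) (s p.2).
Definition vnames vs : seq nat := flatten [seq [:: p.1.1; p.1.2; p.2] | p <- vs].
(** In a well-formed diagram every edge starts exactly once, so [edge_starts] lists the edges and
    the default label [s0] is overwritten on each of them. *)
Definition weight w vs v : V :=
  ssum (edge_starts w vs) (fun s => coef vs s *: act w s v) (fun _ => s0).

Lemma act_cat u w s v : act (u ++ w) s v = act u s (act w s v).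
Proof. exact: foldr_cat. Qed.

Lemma act_cons x w s v : act (x :: w) s v = act1 x s (act w s v).
Proof. by []. Qed.

Lemma act1_linear x s : linear (act1 x s).
Proof. by rewrite /act1; case: x.1. Qed.

Lemma act_linear w s : linear (act w s).
Proof.
elim: w => [|x w IH] a y z //=.
by have := act1_linear x s a (act w s y) (act w s z); rewrite -IH.
Qed.

Lemma act_eq w s s' v : (forall x, x \in names w -> s x = s' x) -> act w s v = act w s' v.
Proof.
elim: w => //= x w IH h; rewrite IH; last by move=> y yw; apply: h; rewrite inE yw orbT.
by rewrite /act1 h // mem_head.
Qed.

Lemma coef_eq vs s s' : (forall x, x \in vnames vs -> s x = s' x) -> coef vs s = coef vs s'.
Proof.
rewrite /coef; elim: vs => [|p vs IH] h; first by rewrite !big_nil.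
rewrite !big_cons IH; last by move=> x xv; apply: h; rewrite /vnames /= !inE xv !orbT.
by rewrite !h // /vnames /= !inE eqxx ?orbT.
Qed.

Lemma act_upd w s e t v : e \notin names w -> act w (upd s e t) v = act w s v.
Proof. by move=> ew; apply: act_eq => x xw; rewrite /upd; case: eqP xw ew => // -> ->. Qed.

Lemma coef_upd vs s e t : e \notin vnames vs -> coef vs (upd s e t) = coef vs s.
Proof. by move=> ew; apply: coef_eq => x xw; rewrite /upd; case: eqP xw ew => // -> ->. Qed.

Lemma coef_cat vs vs' s : coef (vs ++ vs') s = coef vs s * coef vs' s.
Proof. exact: big_cat. Qed.

Lemma sumZ_scale (T : finType) (c : rat) (g : T -> rat) (h : T -> V) :
  \sum_t (c * g t) *: h t = c *: \sum_t g t *: h t.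
Proof. by rewrite scaler_sumr; apply: eq_bigr => t _; rewrite scalerA. Qed.

Lemma act_sum w s (T : finType) (g : T -> rat) (h : T -> V) :
  act w s (\sum_t g t *: h t) = \sum_t g t *: act w s (h t).
Proof.
rewrite (linear_bigE _ _ (act_linear w s)); apply: eq_bigr => t _.
exact: linear_scale _ _ (act_linear w s).
Qed.

(** Common frame of the vertex eliminations: the edge [e] that disappears is summed innermost, where
    one identity between operators decides. *)
Lemma weight_step w vs e w1 vs1 w2 vs2 v :
  uniq (edge_starts w vs) ->
  perm_eq (edge_starts w vs) (e :: edge_starts w1 vs1) ->
  perm_eq (edge_starts w1 vs1) (edge_starts w2 vs2) ->
  (forall s, \sum_t coef vs (upd s e t) *: act w (upd s e t) v
     = coef vs1 s *: act w1 s v - coef vs2 s *: act w2 s v) ->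
  weight w vs v = weight w1 vs1 v - weight w2 vs2 v.
Proof.
move=> U p p2 h.
have U1 : uniq (edge_starts w1 vs1) by move: U; rewrite (perm_uniq p) => /= /andP[].
rewrite /weight -(ssum_perm _ _ U1 p2) -ssumB.
rewrite (@ssum_perm _ _ _ (edge_starts w1 vs1 ++ [:: e])) //; last first.
  by rewrite (perm_trans p) // -cat1s perm_catC.
by rewrite ssum_cat; apply: ssum_eq => s; apply: h.
Qed.

Definition wf (w : seq letter) (vs : seq vertex) :=
  uniq (edge_starts w vs) && perm_eq (edge_starts w vs) (edge_ends w vs).

Lemma wf_count_start w vs e : wf w vs -> (count_mem e (edge_starts w vs) <= 1)%N.
Proof. by case/andP=> U _; rewrite count_uniq_mem //; case: (_ \in _). Qed.

Lemma wf_count_end w vs e : wf w vs -> (count_mem e (edge_ends w vs) <= 1)%N.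
Proof. by case/andP=> U p; rewrite -(permP p) count_uniq_mem //; case: (_ \in _). Qed.

Lemma names_count e w : (e \in names w)
  = (0 < count_mem e [seq x.2 | x <- w & x.1] + count_mem e [seq x.2 | x <- w & ~~ x.1])%N.
Proof.
rewrite -has_pred1 has_count; congr (_ < _)%N.
by elim: w => // -[[] b] w IH; rewrite /names /= in IH *; rewrite IH /=; lia.
Qed.

Lemma vnames_count e vs : (e \in vnames vs)
  = (0 < count_mem e [seq v.2 | v <- vs] + count_mem e [seq v.1.1 | v <- vs]
       + count_mem e [seq v.1.2 | v <- vs])%N.
Proof.
rewrite -has_pred1 has_count; congr (_ < _)%N.
by elim: vs => // p vs IH; rewrite /vnames /= in IH *; rewrite IH /=; lia.
Qed.

Lemma weight_STU1 u v vs vs' l r o z : wf (u ++ (false, o) :: v) (vs ++ (l, r, o) :: vs') ->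
  weight (u ++ (false, o) :: v) (vs ++ (l, r, o) :: vs') z
  = weight (u ++ (false, l) :: (false, r) :: v) (vs ++ vs') z
  - weight (u ++ (false, r) :: (false, l) :: v) (vs ++ vs') z.
Proof.
move=> g; have := wf_count_start o g; have := wf_count_end o g; count_edges.
rewrite eqxx => ce cs; have U : uniq (edge_starts (u ++ (false, o) :: v) (vs ++ (l, r, o) :: vs')).
  by case/andP: g.
(* The edge removed occurs only at the vertex and at one skeleton point; all other factors are
   constant in its label. *)
have [ou ov] : o \notin names u /\ o \notin names v.
  by rewrite !names_count -!eqn0Ngt; split; apply/eqP; move: ce cs => /=; rewrite ?add1n; lia.
have [ovs ovs'] : o \notin vnames vs /\ o \notin vnames vs'.
  by rewrite !vnames_count -!eqn0Ngt; split; apply/eqP; move: ce cs => /=; rewrite ?add1n; lia.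
have [ol or_] : l != o /\ r != o by split; apply/eqP => E; move: ce; rewrite E eqxx /= ?add1n; lia.
apply: (weight_step (e := o) U).
- by apply/permP => P; count_edges; lia.
- by apply/permP => P; count_edges; lia.
move=> s; rewrite -scalerBr !act_cat -(linearB_fun _ _ (act_linear u s)) /= /act1 /= XX.
rewrite act_sum -sumZ_scale; apply: eq_bigr => t _.
rewrite !coef_cat /coef big_cons -!/(coef _ _) /= !coef_upd // {1 2 3}/upd.
rewrite (negbTE ol) (negbTE or_) eqxx !act_cat /= act_upd // act_upd // /act1 /= /upd eqxx.
by rewrite mulrCA mulrC.
Qed.

Lemma weight_STU2_right u v vs vs' l r o z :
  wf (u ++ (true, r) :: v) (vs ++ (l, r, o) :: vs') ->
  weight (u ++ (true, r) :: v) (vs ++ (l, r, o) :: vs') z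
  = weight (u ++ (true, o) :: (false, l) :: v) (vs ++ vs') z
  - weight (u ++ (false, l) :: (true, o) :: v) (vs ++ vs') z.
Proof.
move=> g; have := wf_count_start r g; have := wf_count_end r g; count_edges.
rewrite eqxx => ce cs; have U : uniq (edge_starts (u ++ (true, r) :: v) (vs ++ (l, r, o) :: vs')).
  by case/andP: g.
have [ru rv] : r \notin names u /\ r \notin names v.
  by rewrite !names_count -!eqn0Ngt; split; apply/eqP; move: ce cs => /=; rewrite ?add1n; lia.
have [rvs rvs'] : r \notin vnames vs /\ r \notin vnames vs'.
  by rewrite !vnames_count -!eqn0Ngt; split; apply/eqP; move: ce cs => /=; rewrite ?add1n; lia.
have [rl ro] : l != r /\ o != r.
  by split; apply/eqP => E; move: ce cs; rewrite E eqxx /= ?add1n; lia.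
apply: (weight_step (e := r) U).
- by apply/permP => P; count_edges; lia.
- by apply/permP => P; count_edges; lia.
move=> s; rewrite -scalerBr !act_cat -(linearB_fun _ _ (act_linear u s)) /= /act1 /= tauX.
rewrite act_sum -sumZ_scale; apply: eq_bigr => t _.
rewrite !coef_cat /coef big_cons -!/(coef _ _) /= !coef_upd // {1 2 3}/upd.
rewrite (negbTE rl) (negbTE ro) eqxx !act_cat /= act_upd // act_upd // /act1 /= /upd eqxx.
by rewrite mulrCA mulrC.
Qed.

(** Antisymmetry of [f] carries the rule for the right incoming edge over to the left one and
    accounts for the sign of STU2. *)
Lemma tauXl r o z : X r (tau o z) - tau o (X r z) = \sum_l f l r o *: tau l z.
Proof.
rewrite -opprB tauX -sumrN; apply: eq_bigr => t _.
by rewrite -scaleNr -f_anti.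
Qed.

Lemma weight_STU2_left u v vs vs' l r o z :
  wf (u ++ (true, l) :: v) (vs ++ (l, r, o) :: vs') ->
  weight (u ++ (true, l) :: v) (vs ++ (l, r, o) :: vs') z
  = - (weight (u ++ (true, o) :: (false, r) :: v) (vs ++ vs') z
  - weight (u ++ (false, r) :: (true, o) :: v) (vs ++ vs') z).
Proof.
move=> g; have := wf_count_start l g; have := wf_count_end l g; count_edges.
rewrite eqxx => ce cs; have U : uniq (edge_starts (u ++ (true, l) :: v) (vs ++ (l, r, o) :: vs')).
  by case/andP: g.
have [lu lv] : l \notin names u /\ l \notin names v.
  by rewrite !names_count -!eqn0Ngt; split; apply/eqP; move: ce cs => /=; rewrite ?add1n; lia.
have [lvs lvs'] : l \notin vnames vs /\ l \notin vnames vs'.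
  by rewrite !vnames_count -!eqn0Ngt; split; apply/eqP; move: ce cs => /=; rewrite ?add1n; lia.
have [rl ol] : r != l /\ o != l.
  by split; apply/eqP => E; move: ce cs; rewrite E eqxx /= ?add1n; lia.
rewrite opprB; apply: (weight_step (e := l) U).
- by apply/permP => P; count_edges; lia.
- by apply/permP => P; count_edges; lia.
move=> s; rewrite -scalerBr !act_cat -(linearB_fun _ _ (act_linear u s)) /= /act1 /=.
rewrite tauXl act_sum -sumZ_scale; apply: eq_bigr => t _.
rewrite !coef_cat /coef big_cons -!/(coef _ _) /= !coef_upd // {1 2 3}/upd.
rewrite (negbTE rl) (negbTE ol) eqxx !act_cat /= act_upd // act_upd // /act1 /= /upd eqxx.
by rewrite mulrCA mulrC.
Qed.

Definition weightw w v : V := weight w [::] v.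

Lemma weightwE w v : weightw w v
  = ssum [seq x.2 | x <- w & x.1] (fun s => act w s v) (fun _ => s0).
Proof.
rewrite /weightw /weight /edge_starts cats0; apply: ssum_eq => s.
by rewrite /coef big_nil scale1r.
Qed.

Lemma weightw_linear w : linear (weightw w).
Proof.
move=> a x y; rewrite !weightwE -ssumZ -ssumD; apply: ssum_eq => s.
exact: act_linear.
Qed.

Definition starts w : seq nat := [seq x.2 | x <- w & x.1].

Lemma names_starts w x : gauss w -> (x \in names w) = (x \in starts w).
Proof.
move=> g; apply/mapP/mapP => [[[b y] yw /= ->]|[y]]; last first.
  by rewrite mem_filter => /andP[_ yw] ->; exists y.
have [_ /allP/(_ _ yw) /= yw'] := andP g.
exists (true, y) => //; rewrite mem_filter /=.
by case: b yw yw'.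
Qed.

Lemma uniq_starts w : gauss w -> uniq (starts w).
Proof.
move=> /andP[U _]; rewrite map_inj_in_uniq ?filter_uniq // => -[b x] [c y].
by rewrite !mem_filter /= => /andP[bb _] /andP[cc _] ->; case: b c bb cc => -[].
Qed.

Lemma weightw_perm w es v : gauss w -> perm_eq (starts w) es ->
  weightw w v = ssum es (fun s => act w s v) (fun _ => s0).
Proof. by move=> g p; rewrite weightwE (ssum_perm _ _ (uniq_starts g) p). Qed.

Lemma perm_starts w w' : perm_eq w w' -> perm_eq (starts w) (starts w').
Proof. by move=> p; apply: perm_map; apply: perm_filter. Qed.

Lemma weightw_relabel g w v : {in names w &, injective g} ->
  weightw (map_names g w) v = weightw w v.
Proof.
move=> gI; rewrite !weightwE.
have -> : [seq x.2 | x <- map_names g w & x.1] = map g (starts w).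
  by rewrite /starts /map_names filter_map -!map_comp.
apply: (@ssum_map _ _ g (mem (names w))) => //.
  by move=> x /mapP[y]; rewrite mem_filter => /andP[_ yw] ->; apply: map_f.
move=> s s' ss'; rewrite /act /map_names foldr_map.
elim: w ss' {gI} => //= x w IH ss'.
rewrite IH; last by move=> y yw; apply: ss'; rewrite /names /= inE; apply/orP; right.
congr (_ _); rewrite /act1 /= ss' //.
by rewrite /names /=; apply: mem_head.
Qed.

Lemma weightw_TC u v a b z : gauss (u ++ (true, a) :: (true, b) :: v) ->
  weightw (u ++ (true, a) :: (true, b) :: v) z = weightw (u ++ (true, b) :: (true, a) :: v) z.
Proof.
move=> g; have p := perm_swap u v (true, a) (true, b).
rewrite (weightw_perm z g (perm_starts p)) weightwE; apply: ssum_eq => s.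
by rewrite !act_cat /= /act1 /= tauC.
Qed.

(** Decides, from the two factorizations of one word in 4T, which end of the arrow comes first. *)
Lemma cat_cons_inv (u v u' v' : seq letter) x y : x != y ->
  u ++ x :: v = u' ++ y :: v' ->
  (exists q, u' = u ++ x :: q /\ v = q ++ y :: v') \/
  (exists q, u = u' ++ y :: q /\ v' = q ++ x :: v).
Proof.
move=> xy; elim: u u' => [|t u IH] [|t' u'] /=.
- by move=> [E]; rewrite E eqxx in xy.
- by move=> [-> ->]; left; exists u'.
- by move=> [-> <-]; right; exists u.
move=> [-> /IH [[q [-> ->]]|[q [-> ->]]]]; [left | right]; by exists q.
Qed.

(* The canonical element is invariant: a head acting by the adjoint action on
   both ends of an arrow gives 0. *)
Lemma casimir (b : St) (A B : V -> V) z : linear A -> linear B ->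
  \sum_t (A (X b (tau t (B (X t z))) - tau t (X b (B (X t z))))
    + A (tau t (B (X b (X t z) - X t (X b z))))) = 0.
Proof.
move=> lA lB; rewrite big_split /=.
have -> : \sum_t A (X b (tau t (B (X t z))) - tau t (X b (B (X t z))))
   = - \sum_t \sum_r f b r t *: A (tau r (B (X t z))).
  rewrite -sumrN; apply: eq_bigr => t _; rewrite -opprB tauX.
  rewrite -scaleN1r (linear_scale _ _ lA) scaleN1r (linear_bigE _ _ lA).
  by congr (- _); apply: eq_bigr => r _; rewrite (linear_scale _ _ lA).
have -> : \sum_t A (tau t (B (X b (X t z) - X t (X b z))))
   = \sum_t \sum_r f b t r *: A (tau t (B (X r z))).
  apply: eq_bigr => t _; rewrite XX (linear_bigE _ _ lB) (linear_bigE _ _ (ltau t)).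
  rewrite (linear_bigE _ _ lA); apply: eq_bigr => r _.
  by rewrite (linear_scale _ _ lB) (linear_scale _ _ (ltau t)) (linear_scale _ _ lA).
by rewrite [X in _ + X]exchange_big /= addNr.
Qed.

(** The case of an arrow whose head precedes its tail: the operators on the left act last, so here
    [X t] stands outside. *)
Lemma casimir' (b : St) (A B : V -> V) z : linear A -> linear B ->
  \sum_t (A (X b (X t (B (tau t z))) - X t (X b (B (tau t z))))
    + A (X t (B (X b (tau t z) - tau t (X b z))))) = 0.
Proof.
move=> lA lB; rewrite big_split /=.
have -> : \sum_t A (X b (X t (B (tau t z))) - X t (X b (B (tau t z))))
   = \sum_t \sum_r f b t r *: A (X r (B (tau t z))).
  apply: eq_bigr => t _; rewrite XX (linear_bigE _ _ lA); apply: eq_bigr => r _.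
  by rewrite (linear_scale _ _ lA).
have -> : \sum_t A (X t (B (X b (tau t z) - tau t (X b z))))
   = - \sum_t \sum_r f b r t *: A (X t (B (tau r z))).
  rewrite -sumrN; apply: eq_bigr => t _; rewrite -opprB tauX.
  have lAB : linear (fun y => A (X t (B y))).
    by move=> c p q; rewrite lB (lX t) lA.
  rewrite -scaleN1r (linear_scale _ _ lAB) scaleN1r (linear_bigE _ _ lAB).
  by congr (- _); apply: eq_bigr => r _; rewrite (linear_scale _ _ lAB).
by rewrite exchange_big /= subrr.
Qed.

Lemma weightw_fourT D1 D2 D3 D4 u v u' v' a b z : gauss D1 ->
  u ++ (true, a) :: v = u' ++ (false, a) :: v' ->
  D1 = u ++ (false, b) :: (true, a) :: v -> D2 = u' ++ (false, b) :: (false, a) :: v' ->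
  D3 = u ++ (true, a) :: (false, b) :: v -> D4 = u' ++ (false, a) :: (false, b) :: v' ->
  weightw D1 z + weightw D2 z - (weightw D3 z + weightw D4 z) = 0.
Proof.
move=> g E E1 E2 E3 E4.
have p2 : perm_eq D1 D2.
  by rewrite E1 E2 (permPl (perm_ins _ _ _)) E perm_sym perm_ins.
have p3 : perm_eq D1 D3 by rewrite E1 E3 perm_swap.
have p4 : perm_eq D1 D4.
  by apply: (perm_trans p2); rewrite E2 E4 perm_swap.
have aS : a \in starts D1.
  by rewrite -names_starts // E1 names_cat mem_cat /names /= !inE eqxx !orbT.
have ab : b != a.
  apply/eqP => ba.
  have pD : perm_eq D1 ([:: (false, a)] ++ (u ++ (true, a) :: v)) by rewrite E1 ba perm_ins.
  by have := gauss_notin2 g pD (mem_head _ _); rewrite E mem_cat mem_head orbT.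
(* The label of the arrow [a] is summed innermost; with all other labels fixed, 4T is then the
   invariance of the canonical element. *)
pose es := rem a (starts D1).
have ps : perm_eq (starts D1) (es ++ [:: a]).
  by rewrite cats1 perm_sym perm_rcons perm_sym; apply: perm_to_rem.
have P D : perm_eq D1 D -> weightw D z
    = ssum (es ++ [:: a]) (fun s => act D s z) (fun _ => s0).
  move=> p; apply: weightw_perm; first by rewrite -(gauss_perm p).
  by apply: perm_trans ps; rewrite perm_sym; apply: perm_starts.
rewrite !P // -!ssumD -ssumB ssum_cat.
have z0 s : ssum es (fun _ => 0 : V) s = 0.
  by elim: (es) s => //= e es' IH s; apply: big1.
rewrite -[RHS](z0 (fun _ => s0)); apply: ssum_eq => s /=.
have ne : (true, a) != (false, a) by [].
case: (cat_cons_inv ne E) => [[q [Eu Ev]]|[q [Eu Ev]]].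
- have : a \notin names ([::] ++ ((false, b) :: u ++ q ++ v')).
    apply: (gauss_fresh (v := [:: (true, a); (false, a)])); rewrite ?inE ?eqxx //.
    by apply: (gauss_permI g); rewrite E1 Ev; perm_by_count.
  rewrite cat0s notin_names_cons !notin_names_cat => /and4P[_ au aq av].
  apply: etrans (casimir (s b) (act v' s z) (act_linear u s) (act_linear q s)).
  apply: eq_bigr => t _; rewrite {}E1 {}E2 {}E3 {}E4 Eu Ev opprD addrACA.
  rewrite !(act_cat, act_cons) /act1 /= !act_upd //.
  rewrite /upd eqxx (negbTE ab) (linearB_fun _ _ (act_linear u s)).
  rewrite (linearB_fun _ _ (act_linear q s)) (linearB_fun _ _ (ltau t)).
  by rewrite (linearB_fun _ _ (act_linear u s)).
have : a \notin names ([::] ++ ((false, b) :: u' ++ q ++ v)).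
  apply: (gauss_fresh (v := [:: (true, a); (false, a)])); rewrite ?inE ?eqxx //.
  by apply: (gauss_permI g); rewrite E1 Eu; perm_by_count.
rewrite cat0s notin_names_cons !notin_names_cat => /and4P[_ au aq av].
apply: etrans (casimir' (s b) (act v s z) (act_linear u' s) (act_linear q s)).
apply: eq_bigr => t _; rewrite {}E1 {}E2 {}E3 {}E4 Eu Ev opprD addrACA.
rewrite !(act_cat, act_cons) /act1 /= !act_upd //.
rewrite /upd eqxx (negbTE ab) [RHS]addrC (linearB_fun _ _ (act_linear u' s)).
rewrite (linearB_fun _ _ (act_linear q s)) (linearB_fun _ _ (lX t)).
by rewrite (linearB_fun _ _ (act_linear u' s)).
Qed.

Definition wt (v : V) : Aw -> V := qlift (linext (fun D : arrow_diag => weightw D v)).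

Lemma wt_rel v r : aw_rel r -> linext (fun D : arrow_diag => weightw D v) r = 0.
Proof.
have L D : linext (fun D : arrow_diag => weightw D v) (ad D) = weightw D v by exact: linextU.
case.
- move=> D D' g gI E; rewrite linearB /= !L E weightw_relabel //; exact: subrr.
- move=> D D' u w a b E E'; rewrite linearB /= !L E E' weightw_TC ?subrr //.
  by rewrite -E gaussP.
- move=> D1 D2 D3 D4 u w u' w' a b E E1 E2 E3 E4.
  rewrite linearB !linearD /= !L -?opprD.
  exact: (weightw_fourT v (gaussP D1) E E1 E2 E3 E4).
Qed.

Lemma wt_linear v : linear (wt v).
Proof. exact: (qlift_linear (@wt_rel v)). Qed.

Lemma wt_cls v D : wt v (cls D) = weightw D v.
Proof.
rewrite /wt /cls qliftE; first exact: (linextU (fun D : arrow_diag => weightw D v)).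
exact: wt_rel.
Qed.

Lemma wt_clw v w : gauss w -> wt v (clw w) = weightw w v.
Proof. by move=> g; rewrite (clw_gauss g) wt_cls. Qed.

(** The right-hand side does not depend on the order of eliminations, so the weights of all values
    of a diagram agree without any confluence argument. *)
Lemma wt_represents G x v : represents G x -> wt v x = weight (skel G) (verts G) v.
Proof.
elim=> {G x}.
- by move=> G D E1 E2; rewrite E1 E2 wt_cls.
- move=> G G1 G2 x1 x2 u w vs vs' l r o EG Es EG1 Es1 EG2 Es2 _ IH1 _ IH2.
  rewrite (linearB_fun _ _ (wt_linear v)) IH1 IH2 EG Es EG1 Es1 EG2 Es2 weight_STU1 //.
  by rewrite -Es -EG; case: (G).
- move=> G G1 G2 x1 x2 u w vs vs' l r o EG Es EG1 Es1 EG2 Es2 _ IH1 _ IH2.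
  rewrite (linearB_fun _ _ (wt_linear v)) IH1 IH2 EG Es EG1 Es1 EG2 Es2 weight_STU2_right //.
  by rewrite -Es -EG; case: (G).
- move=> G G1 G2 x1 x2 u w vs vs' l r o EG Es EG1 Es1 EG2 Es2 _ IH1 _ IH2.
  rewrite -scaleN1r (linear_scale _ _ (wt_linear v)) scaleN1r (linearB_fun _ _ (wt_linear v)).
  rewrite IH1 IH2 EG Es EG1 Es1 EG2 Es2 weight_STU2_left //.
  by rewrite -Es -EG; case: (G).
Qed.

Lemma weightw_cat u w v : gauss u -> gauss w -> ~~ has [in names u] (names w) ->
  weightw (u ++ w) v = weightw u (weightw w v).
Proof.
move=> gu gw dis; rewrite !weightwE filter_cat map_cat ssum_cat.
apply: ssum_eq => s.
have -> : ssum [seq x.2 | x <- w & x.1] (fun s => act (u ++ w) s v) s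
   = ssum [seq x.2 | x <- w & x.1] (fun s' => act u s (act w s' v)) s.
  apply: ssum_eq_off => s' ss'; rewrite act_cat; apply: act_eq => x xu.
  apply: ss'; rewrite -[map _ _]/(starts w) -names_starts //.
  by apply: contra dis => xw; apply/hasP; exists x.
rewrite (ssumL _ _ _ (act_linear u s)); congr (act u s _).
apply: ssum_indep => s1 s2 h; apply: act_eq => x xw; apply: h.
by rewrite -[map _ _]/(starts w) -names_starts.
Qed.

(** Concatenation becomes composition of operators, the right factor acting first. This rests on
    renaming the factors apart. *)
Lemma wtM v x y : wt v (x * y) = wt (wt v y) x.
Proof.
have lin_v x0 : linear (fun v => wt v x0).
  elim: (clw_span x0) => [|a r t [w ->] _ IH] b v1 v2.
    by rewrite !(linear_at0 (wt_linear _)) scaler0 addr0.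
  rewrite !wt_linear IH; have [g|ng] := boolP (gauss w); last first.
    by rewrite (clw_ngauss ng) !(linear_at0 (wt_linear _)) !scaler0 !add0r.
  rewrite !(wt_clw _ g) weightw_linear !scalerDr !scalerA addrACA mulrC.
  by congr (_ + _).
move: x; apply: (aw_ext (comp_linear (wt_linear v) (mulr_linear_r y)) (wt_linear _)) => u.
move: y; apply: (aw_ext (comp_linear (wt_linear v) (mulr_linear_l _))
  (comp_linear (lin_v _) (wt_linear v))) => w.
have [gu|nu] := boolP (gauss u); last first.
  by rewrite (clw_ngauss nu) mul0r !(linear_at0 (wt_linear _)).
have [gw|nw] := boolP (gauss w); last first.
  rewrite (clw_ngauss nw) mulr0 !(linear_at0 (wt_linear _)).
  by rewrite (linear_at0 (lin_v _)).
pose w' := map_names (addn (wnext u)) w.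
have I : {in names w &, injective (addn (wnext u))} by move=> i j _ _; apply: addnI.
have dis : ~~ has [in names u] (names w').
  apply/hasPn => _ /mapP[_ /mapP[x xv ->] ->] /=; apply/negP => /names_lt.
  by rewrite ltnNge leq_addr.
have gw' : gauss w' := gauss_map I gw.
rewrite -(clw_relabel I) -/w' -clw_cat // !wt_clw //; last first.
  have /andP[Uu /allP Au] := gu; have /andP[Uw /allP Aw'] := gw'.
  apply/andP; split.
    rewrite cat_uniq Uu Uw andbT /=; apply/hasPn => x xv; apply/negP => xu.
    by case/negP: dis; apply/hasP; exists x.2; apply: map_f.
  by apply/allP => x; rewrite !mem_cat => /orP[/Au ->|/Aw' ->]; rewrite ?orbT.
exact: weightw_cat.
Qed.
End Weights.

(** * Eliminating the vertices of a wheel *)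

Lemma wf_step w vs e w1 vs1 : wf w vs ->
  perm_eq (edge_starts w vs) (e :: edge_starts w1 vs1) ->
  perm_eq (edge_ends w vs) (e :: edge_ends w1 vs1) -> wf w1 vs1.
Proof.
case/andP=> U p ps pe; apply/andP; split.
  by move: U; rewrite (perm_uniq ps) => /= /andP[].
by rewrite -(perm_cons e) -(permPl ps) (permPl p).
Qed.

Lemma wf_STU1 u v vs vs' l r o : wf (u ++ (false, o) :: v) (vs ++ (l, r, o) :: vs') ->
  wf (u ++ (false, l) :: (false, r) :: v) (vs ++ vs')
  /\ wf (u ++ (false, r) :: (false, l) :: v) (vs ++ vs').
Proof. by move=> g; split; apply: (wf_step (e := o) g); (apply/permP => P; count_edges; lia). Qed.

Lemma wf_STU2_left u v vs vs' l r o :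
  wf (u ++ (true, l) :: v) (vs ++ (l, r, o) :: vs') ->
  wf (u ++ (true, o) :: (false, r) :: v) (vs ++ vs')
  /\ wf (u ++ (false, r) :: (true, o) :: v) (vs ++ vs').
Proof. by move=> g; split; apply: (wf_step (e := l) g); (apply/permP => P; count_edges; lia). Qed.

Lemma wf_gauss w : wf w [::] -> gauss w.
Proof.
case/andP; rewrite /edge_starts /edge_ends /= !cats0 => U p.
have U' : uniq [seq x.2 | x <- w & ~~ x.1] by rewrite -(perm_uniq p).
have c b e : count_mem e [seq x.2 | x <- w & x.1 == b] = count_mem (b, e) w.
  rewrite count_map count_filter; apply: eq_count => -[c x] /=.
  by rewrite xpair_eqE andbC.
have ct1 e : count_mem e [seq x.2 | x <- w & x.1] = count_mem (true, e) w.
  by rewrite -c; congr count; congr map; apply: eq_filter => -[[] ?].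
have cf e : count_mem e [seq x.2 | x <- w & ~~ x.1] = count_mem (false, e) w.
  by rewrite -c; congr count; congr map; apply: eq_filter => -[[] ?].
have tf e : count_mem (true, e) w = count_mem (false, e) w.
  by rewrite -ct1 -cf; move/permP: p.
apply/andP; split.
  apply: count_mem_uniq => -[b e]; rewrite -has_pred1 has_count.
  have : (count_mem (b, e) w <= 1)%N.
    by case: b; rewrite -?ct1 -?cf count_uniq_mem // leq_b1.
  by case: count => [|[]].
apply/allP => -[b e]; rewrite -!has_pred1 !has_count /=.
by case: b; rewrite tf.
Qed.

(** The cycle of a wheel cut open: edge 0 enters the first vertex and edge [j] leaves the last. *)
Definition chain k j : seq vertex := [seq ((k + i)%N, i, i.+1) | i <- iota 0 j].

(** The last vertex is the one whose outgoing edge ends on the skeleton. STU1 there peels off the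
    outermost bracket, whence the reversed order of the spokes. *)
Lemma represents_chain k j G A B : verts G = chain k j -> skel G = A ++ (false, j) :: B ->
  represents G (cl (mon A * adH (rev (iota k j)) 0 * mon B)).
Proof.
elim: j G A B => [|j IH] G A B vG sG.
  have g : gauss (skel G) by apply: wf_gauss; rewrite -[[::]]vG; case: (G).
  have -> : cl (mon A * adH (rev (iota k 0)) 0 * mon B) = cls (ArrowDiag g).
    by rewrite -clw_gauss -clM sG mon_cat -cat1s mon_cat mulrA.
  by apply: no_vertex.
have vG' : verts G = chain k j ++ ((k + j)%N, j, j.+1) :: [::].
  by rewrite vG /chain -[X in iota _ X]addn1 iotaD map_cat.
have g : wf (skel G) (verts G) by case: (G).
have [g1 g2] : wf (A ++ (false, (k + j)%N) :: (false, j) :: B) (chain k j ++ [::])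
    /\ wf (A ++ (false, j) :: (false, (k + j)%N) :: B) (chain k j ++ [::]).
  by apply: (wf_STU1 (o := j.+1)); rewrite -sG -vG'.
rewrite cats0 in g1 g2.
have -> : cl (mon A * adH (rev (iota k j.+1)) 0 * mon B)
    = cl (mon (A ++ [:: (false, (k + j)%N)]) * adH (rev (iota k j)) 0 * mon B)
    - cl (mon A * adH (rev (iota k j)) 0 * mon ((false, (k + j)%N) :: B)).
  rewrite -clB; congr cl; rewrite -addn1 iotaD rev_cat /= mon_cat [mon (_ :: B)]mon_cons.
  by rewrite /br mulrBr mulrBl !mulrA.
apply: (@STU1 G (TDiag g1) (TDiag g2) _ _ A B (chain k j) [::] (k + j)%N j j.+1) => //.
- by rewrite cats0.
- by rewrite cats0.
- by apply: IH => //; rewrite -catA.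
- exact: IH.
Qed.

(** No edge of a wheel ends on the skeleton, so elimination has to begin with STU2 at a spoke. At
    the last vertex this cuts the cycle at edge 0, which becomes the arrow closing the bracket; STU1
    does the rest. *)
Lemma represents_wheel k : represents (wheel k.+1) (omega k).
Proof.
pose A := tails (iota k.+1 k).
have sk : wheel_skel k.+1 = A ++ (true, (k.+1 + k)%N) :: [::].
  by rewrite /wheel_skel -[X in iota _ X]addn1 iotaD map_cat.
have vk : wheel_verts k.+1 = chain k.+1 k ++ ((k.+1 + k)%N, k, 0%N) :: [::].
  rewrite /wheel_verts -[X in iota _ X]addn1 iotaD map_cat /= modnn; congr (_ ++ _).
  apply/eq_in_map => i; rewrite mem_iota /= add0n => ik.
  by rewrite modn_small // ltnS.
have g : wf (wheel_skel k.+1) (wheel_verts k.+1) := wheel_ok k.+1.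
have [g1 g2] : wf (A ++ (true, 0%N) :: [:: (false, k)]) (chain k.+1 k ++ [::])
    /\ wf (A ++ (false, k) :: [:: (true, 0%N)]) (chain k.+1 k ++ [::]).
  by apply: (wf_STU2_left (l := (k.+1 + k)%N)); rewrite -sk -vk; exact: g.
rewrite cats0 in g1 g2.
pose S := rev (iota k.+1 k).
have -> : omega k = - (cl (mon (A ++ [:: (true, 0%N)]) * adH S 0 * mon [::])
    - cl (mon A * adH S 0 * mon [:: (true, 0%N)])).
  have sS : size S = k by rewrite size_rev size_iota.
  rewrite -[in LHS]sS -(@cl_wheel 0); last first.
    by rewrite rcons_uniq rev_uniq iota_uniq mem_rev mem_iota.
  have nl : null (mon (tails S) - mon A).
    by apply: tails_perm; rewrite perm_rev.
  have := null_eq 1 (wh 0 S) nl; rewrite !mul1r => ->.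
  rewrite -clB -clN; congr cl.
  by rewrite /wh /br mon0 mulr1 mon_cat opprB mulrBr !mulrA.
apply: (@STU2_left (wheel k.+1) (TDiag g1) (TDiag g2) _ _ A [::] (chain k.+1 k) [::]
  (k.+1 + k)%N k 0%N) => //.
- by rewrite cats0.
- by rewrite cats0.
- by apply: represents_chain; rewrite //= -catA.
- exact: represents_chain.
Qed.

(** * The polynomial representation and its eigenvalues *)

Lemma big_option (W : nmodType) (T : finType) (F : option T -> W) :
  \sum_t F t = F None + \sum_i F (Some i).
Proof.
rewrite (bigD1 None) //=; congr (_ + _).
rewrite (reindex_omap (Some : T -> option T) id) //=; last by case.
by apply: eq_bigl => i; rewrite eqxx.
Qed.

Lemma ssum_sum (St T : finType) (V : lmodType rat) es (F : T -> (nat -> St) -> V) s :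
  ssum es (fun s => \sum_i F i s) s = \sum_i ssum es (F i) s.
Proof.
elim: es s => //= e es IH s; rewrite exchange_big; apply: eq_bigr => t _.
exact: IH.
Qed.

Lemma prod_bool (J : Type) (es : seq J) (b : J -> bool) :
  \prod_(e <- es) (b e)%:R = (all b es)%:R :> rat.
Proof.
elim: es => [|e es IH]; rewrite ?big_nil ?big_cons //= IH.
by case: (b e); rewrite ?mul1r ?mul0r.
Qed.

Lemma ssum_delta (St : finType) (V : lmodType rat) es (g : nat -> St) (u : V) s : uniq es ->
  ssum es (fun s => (\prod_(e <- es) (s e == g e)%:R : rat) *: u) s = u.
Proof.
(* [c] accumulates the factors of the labels already summed over. *)
move=> U; suff H (c : (nat -> St) -> rat) : (forall s e t, e \in es -> c (upd s e t) = c s) ->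
    ssum es (fun s => (c s * \prod_(e <- es) (s e == g e)%:R) *: u) s = c s *: u.
  rewrite -[RHS]scale1r -(H (fun _ => 1)) //.
  by apply: ssum_eq => s'; rewrite mul1r.
elim: es U s c => [|e es IH] /= U s c h; first by rewrite big_nil mulr1.
case/andP: U => ees U; rewrite (bigD1 (g e)) //= big1 ?addr0 => [|t /negbTE tg].
  rewrite -[c s](h s e (g e)) ?mem_head //.
  pose c' s := c s * (s e == g e)%:R.
  transitivity (c' (upd s e (g e)) *: u); last by rewrite /c' /upd !eqxx mulr1.
  rewrite -IH // => [|s' d t ds].
    by apply: ssum_eq => s'; rewrite big_cons mulrA.
  rewrite /c' h ?inE ?ds ?orbT // /upd; case: (eqVneq e d) => // ed.
  by rewrite ed ds in ees.
pose c' s := c s * (s e == g e)%:R.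
transitivity (c' (upd s e t) *: u).
  rewrite -IH // => [|s' d t' ds].
    by apply: ssum_eq => s'; rewrite big_cons mulrA.
  rewrite /c' h ?inE ?ds ?orbT // /upd; case: (eqVneq e d) => // ed.
  by rewrite ed ds in ees.
by rewrite /c' /upd eqxx tg mulr0 scale0r.
Qed.

Record free_module (K : choiceType) := FreeModule {
  fm_sort : lmodType rat;
  fm_basis : K -> fm_sort;
  fm_op : (K -> rat) -> (K -> K) -> fm_sort -> fm_sort;
  fm_op_linear : forall c g, linear (fm_op c g);
  fm_opU : forall c g k, fm_op c g (fm_basis k) = c k *: fm_basis (g k);
  fm_ext : forall (W : lmodType rat) (f g : fm_sort -> W), linear f -> linear g ->
    (forall k, f (fm_basis k) = g (fm_basis k)) -> f =1 g;
  fm_basis_neq0 : forall c k, c *: fm_basis k = 0 -> c = 0 }.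

Lemma free_module_exists (K : choiceType) : free_module K.
Proof.
apply: (@FreeModule K {malg rat[K]} (fun k => << k >>)
  (fun c g => linext (fun k => c k *: << g k >>))).
- by move=> c g; apply: linext_linear.
- by move=> c g k; apply: linextU.
- exact: malg_ext.
- by move=> c k /(congr1 (mcoeff k)); rewrite mcoeffZ mcoeffUU mulr1 mcoeff0.
Qed.

(* The representation of the Lie algebra spanned by x (state None) and
   y_i (state Some i), [x, y_i] = a_i y_i, on polynomials in n variables:
   y_i acts as a_i d/dt_i and x as lam - sum_i a_i t_i d/dt_i; the dual basis
   acts by 1 and by multiplication by t_i. *)
Section Fock.
Variables (n : nat) (a : 'I_n -> rat) (lam : rat).
Let St := option 'I_n.
Let mexp := {ffun 'I_n -> nat}.
Let V : lmodType rat := fm_sort (free_module_exists mexp).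
Let E (k : mexp) : V := fm_basis _ k.

Definition fock_up (i : 'I_n) (k : mexp) : mexp := [ffun j => (k j + (j == i))%N].
(** Truncated subtraction does no harm: y_i carries the factor [k i], which is 0 when there is
    nothing to lower. *)
Definition fock_down (i : 'I_n) (k : mexp) : mexp := [ffun j => (k j - (j == i))%N].
(** The eigenvalue of x on the monomial with exponents [k]. *)
Definition fock_wt (k : mexp) : rat := lam - \sum_j a j * (k j)%:R.

Definition fock_op (c : mexp -> rat) (g : mexp -> mexp) : V -> V :=
  @fm_op _ (free_module_exists mexp) c g.

Definition fock_tau (s : St) : V -> V :=
  if s is Some i then fock_op (fun _ => 1) (fock_up i) else id.
Definition fock_X (s : St) : V -> V :=
  if s is Some i then fock_op (fun k => a i * (k i)%:R) (fock_down i)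
  else fock_op fock_wt id.
Definition fock_f (l r o : St) : rat :=
  match l, r, o with
  | None, Some i, Some j => if i == j then a i else 0
  | Some i, None, Some j => if i == j then - a i else 0
  | _, _, _ => 0
  end.

Lemma fock_op_linear c g : linear (fock_op c g).
Proof. exact: fm_op_linear. Qed.

Lemma fock_opU c g k : fock_op c g (E k) = c k *: E (g k).
Proof. exact: fm_opU. Qed.

Lemma fock_opZ c g b k : fock_op c g (b *: E k) = (b * c k) *: E (g k).
Proof. by rewrite (linear_scale _ _ (fock_op_linear c g)) fock_opU scalerA. Qed.

Lemma fock_tau_linear s : linear (fock_tau s).
Proof. by case: s => [i|] //; apply: fock_op_linear. Qed.

Lemma fock_X_linear s : linear (fock_X s).
Proof. by case: s => [i|]; apply: fock_op_linear. Qed.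

Lemma fock_downK i (k : mexp) : (0 < k i)%N -> fock_up i (fock_down i k) = k.
Proof.
by move=> ki; apply/ffunP => j; rewrite !ffunE; case: eqP => [->|]; rewrite ?subnK ?addn0 ?subn0.
Qed.

Lemma fock_upK i (k : mexp) : fock_down i (fock_up i k) = k.
Proof. by apply/ffunP => j; rewrite !ffunE addnK. Qed.

Lemma fock_wt_up i k : fock_wt (fock_up i k) = fock_wt k - a i.
Proof.
rewrite /fock_wt (eq_bigr (fun j => a j * (k j)%:R + a j * (j == i)%:R)); last first.
  by move=> j _; rewrite ffunE natrD mulrDr.
rewrite big_split /=; set z := \sum_j a j * (k j)%:R.
rewrite (bigD1 i) //= eqxx mulr1 big1 ?addr0 ?opprD ?addrA // => j /negbTE ->.
by rewrite mulr0.
Qed.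

Lemma fock_wt_down i (k : mexp) : (0 < k i)%N -> fock_wt (fock_down i k) = fock_wt k + a i.
Proof. by move=> /fock_downK {2}<-; rewrite fock_wt_up subrK. Qed.

Lemma sum_fock_None i (F : 'I_n -> V) :
  \sum_j (if i == j then a i else 0) *: F j = a i *: F i.
Proof.
rewrite (bigD1 i) //= eqxx big1 ?addr0 // => j.
by rewrite eq_sym => /negbTE ->; rewrite scale0r.
Qed.

Lemma sum_fock_None' i (F : 'I_n -> V) :
  \sum_j (if j == i then a j else 0) *: F j = a i *: F i.
Proof.
rewrite (bigD1 i) //= eqxx big1 ?addr0 // => j.
by move=> /negbTE ->; rewrite scale0r.
Qed.

Lemma linear_sub_fun (U W : lmodType rat) (g h : U -> W) : linear g -> linear h ->
  linear (fun x => g x - h x).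
Proof. by move=> lg lh c x y; rewrite lg lh scalerBr opprD addrACA. Qed.

Lemma fock_tauC t t' v : fock_tau t (fock_tau t' v) = fock_tau t' (fock_tau t v).
Proof.
case: t t' => [i|] [j|] //; move: v; apply: fm_ext.
- exact: comp_linear (fock_op_linear _ _) (fock_op_linear _ _).
- exact: comp_linear (fock_op_linear _ _) (fock_op_linear _ _).
move=> k; rewrite /= !fock_opU !fock_opZ; congr (_ *: E _).
by apply/ffunP => x; rewrite !ffunE addnAC.
Qed.

Lemma fock_xy i v : fock_X None (fock_X (Some i) v) - fock_X (Some i) (fock_X None v)
  = a i *: fock_X (Some i) v.
Proof.
have l := fock_X_linear; move: v; apply: fm_ext.
- exact: linear_sub_fun (comp_linear (l _) (l _)) (comp_linear (l _) (l _)).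
- by move=> c x y; rewrite l scalerDr !scalerA mulrC.
move=> k; rewrite /= !fock_opU !fock_opZ -scalerBl scalerA; congr (_ *: _).
case: (posnP (k i)) => [->|ki]; first by rewrite !mulr0 mul0r subrr.
by rewrite fock_wt_down //; ring.
Qed.

Lemma fock_XX l r v : fock_X l (fock_X r v) - fock_X r (fock_X l v)
  = \sum_o fock_f l r o *: fock_X o v.
Proof.
rewrite big_option; case: l r => [i|] [j|] /=; rewrite scale0r add0r.
- rewrite big1 => [|o _]; last by rewrite scale0r.
  apply/eqP; rewrite subr_eq0; apply/eqP; move: v; apply: fm_ext.
  + exact: comp_linear (fock_op_linear _ _) (fock_op_linear _ _).
  + exact: comp_linear (fock_op_linear _ _) (fock_op_linear _ _).
  move=> k; rewrite /= !fock_opU !fock_opZ; case: (eqVneq i j) => [->//|ij].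
  rewrite !ffunE (negbTE ij) eq_sym (negbTE ij) !subn0.
  congr (_ *: E _); first exact: mulrC.
  by apply/ffunP => x; rewrite !ffunE -!subnDA addnC.
- rewrite -opprB (fock_xy i v) -(sum_fock_None i (fun j => fock_X (Some j) v)) -sumrN.
  by apply: eq_bigr => o _; case: eqP => _; rewrite ?scaleNr // !scale0r oppr0.
- by rewrite (fock_xy j v) -(sum_fock_None j (fun j => fock_X (Some j) v)).
- by rewrite subrr big1 // => o _; rewrite scale0r.
Qed.

Lemma fock_tauX l o v : fock_tau o (fock_X l v) - fock_X l (fock_tau o v)
  = \sum_r fock_f l r o *: fock_tau r v.
Proof.
have l1 := fock_X_linear; have l2 := fock_tau_linear.
rewrite big_option; case: l o => [i|] [j|]; rewrite /fock_f.
- rewrite [\sum_(x < n) _]big1 ?addr0 => [|x _]; last by rewrite scale0r.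
  move: v; apply: fm_ext.
  + exact: linear_sub_fun (comp_linear (l2 _) (l1 _)) (comp_linear (l1 _) (l2 _)).
  + by move=> c x y; rewrite l2 scalerDr !scalerA mulrC.
  move=> k; rewrite /= !fock_opU !fock_opZ.
  have E' : a i * (k i)%:R *: E (fock_up j (fock_down i k))
     = (a i * (k i)%:R) *: E (fock_down i (fock_up j k)) :> V.
    case: (posnP (k i)) => [->|ki]; first by rewrite mulr0 !scale0r.
    congr (_ *: E _); apply/ffunP => x; rewrite !ffunE.
    case: (eqVneq x i) => [->|_]; last by rewrite !subn0.
    by move: (nat_of_bool (i == j)) => b /=; move: (k i) ki => q ki; lia.
  rewrite mulr1 E' -scalerBl mul1r ffunE; case: (eqVneq i j) => [<-|ij].
    by rewrite fock_upK natrD /=; congr (_ *: _); ring.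
  by rewrite addn0 subrr !scale0r.
- by rewrite /= subrr !scale0r add0r big1 // => x _; rewrite scale0r.
- rewrite scale0r add0r (sum_fock_None' j (fun j => fock_tau (Some j) v)).
  move: v; apply: fm_ext.
  + exact: linear_sub_fun (comp_linear (l2 _) (l1 _)) (comp_linear (l1 _) (l2 _)).
  + by move=> c x y; rewrite l2 scalerDr !scalerA mulrC.
  move=> k; rewrite /= !fock_opU !fock_opZ -scalerBl scalerA fock_wt_up.
  by congr (_ *: _); ring.
- by rewrite /= subrr !scale0r add0r big1 // => x _; rewrite scale0r.
Qed.

Lemma fock_anti l r o : fock_f l r o = - fock_f r l o.
Proof. by case: l r o => [i|] [j|] [k|] //=; rewrite ?oppr0 //; case: eqP; rewrite ?opprK ?oppr0. Qed.

Definition fock (v : V) : Aw -> V := wt None fock_tau fock_X fock_f v.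

Definition eigen (x : Aw) (c : rat) := forall v, fock v x = c *: v.

Lemma fock_linear v : linear (fock v).
Proof. exact (wt_linear None fock_tau_linear fock_X_linear fock_tauC fock_XX fock_tauX v). Qed.

Lemma eigenM x y c d : eigen x c -> eigen y d -> eigen (x * y) (c * d).
Proof.
move=> hx hy v.
rewrite [LHS](wtM None fock_tau_linear fock_X_linear fock_tauC fock_XX fock_tauX).
by rewrite -scalerA -hy -hx.
Qed.

Lemma fock_clw v w : gauss w -> fock v (clw w) = weightw None fock_tau fock_X fock_f w v.
Proof. move=> g; exact (wt_clw None fock_tau_linear fock_X_linear fock_tauC fock_XX fock_tauX v g). Qed.

Lemma eigen1 : eigen 1 1.
Proof.
move=> v; have <- : clw [::] = 1 := clwE ad_one.
by rewrite fock_clw // weightwE scale1r.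
Qed.

(** With the dual basis on the left, the terms a_i t_i d/dt_i cancel the Euler part of x. *)
Lemma eigen_D_R : eigen D_R lam.
Proof.
move=> v; rewrite -[D_R]clwE fock_clw //= weightwE /= big_option /=.
rewrite /act1 /upd /=; have l := fock_op_linear.
move: v; apply: fm_ext.
- move=> c x y /=; rewrite l scalerDr addrACA; congr (_ + _).
  rewrite scaler_sumr -big_split; apply: eq_bigr => i _.
  by rewrite !l.
- by move=> c x y; rewrite scalerDr !scalerA mulrC.
move=> k; rewrite /= fock_opU (eq_bigr (fun i => (a i * (k i)%:R) *: E (k))).
  rewrite -scaler_suml -scalerDl; congr (_ *: _).
  by rewrite /fock_wt subrK.
move=> i _; rewrite fock_opU fock_opZ mulr1.
by case: (posnP (k i)) => [->|ki]; rewrite ?mulr0 ?scale0r ?fock_downK.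
Qed.

(** Compared with [D_R], d/dt_i now stands before t_i, and each commutator contributes a_i. *)
Lemma eigen_D_L : eigen D_L (lam + \sum_i a i).
Proof.
move=> v; rewrite -[D_L]clwE fock_clw //= weightwE /= big_option /=.
rewrite /act1 /upd /=; have l := fock_op_linear.
move: v; apply: fm_ext.
- move=> c x y /=; rewrite l scalerDr addrACA; congr (_ + _).
  rewrite scaler_sumr -big_split; apply: eq_bigr => i _.
  by rewrite !l.
- by move=> c x y; rewrite scalerDr !scalerA mulrC.
move=> k; rewrite /= fock_opU (eq_bigr (fun i => (a i * (k i)%:R + a i) *: E (k))).
  rewrite -scaler_suml -scalerDl big_split /=; congr (_ *: _).
  by rewrite /fock_wt addrA subrK.
move=> i _; rewrite fock_opU fock_opZ mul1r fock_upK ffunE eqxx natrD.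
by rewrite mulrDr mulr1.
Qed.

(** A nonzero summand has [None] on all spokes and one and the same [Some i] on all cycle edges, and
    each vertex contributes a_i: this is the trace of a power of ad x. *)
Lemma fock_represents_wheel k x : represents (wheel k.+1) x ->
  eigen x (\sum_i a i ^+ k.+1).
Proof.
move=> rx v; rewrite [LHS](wt_represents None fock_tau_linear fock_X_linear fock_tauC
  fock_XX fock_tauX fock_anti v rx) /weight.
pose es := edge_starts (wheel_skel k.+1) (wheel_verts k.+1).
have Ues : uniq es by case/andP: (wheel_ok k.+1).
have mes e : (e \in es) = (e < k.+1 + k.+1)%N.
  rewrite /es /edge_starts mem_cat /wheel_skel filter_map (eq_filter (a2 := predT)) //.
  rewrite filter_predT -map_comp map_id mem_iota orbC.
  have -> : (e \in [seq p.2 | p <- wheel_verts k.+1]) = (e < k.+1)%N.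
    rewrite -map_comp; apply/mapP/idP => [[i _ ->]|ek]; first exact: ltn_pmod.
    case: e ek => [|e] ek; [exists k | exists e].
    - by rewrite mem_iota add0n leqnn.
    - by rewrite /= modnn.
    - by rewrite mem_iota add0n; apply: ltnW.
    - by rewrite /= modn_small.
  by lia.
pose g i e : St := if (e < k.+1)%N then Some i else None.
rewrite scaler_suml.
transitivity (\sum_i ssum es (fun s => (\prod_(e <- es) (s e == g i e)%:R : rat) *:
   (a i ^+ k.+1 *: v)) (fun _ => None)); last first.
  by apply: eq_bigr => i _; apply: ssum_delta.
rewrite -ssum_sum; apply: ssum_eq => s.
pose P i := all (fun e => s e == g i e) es.
have PE i e : P i -> (e < k.+1 + k.+1)%N -> s e = g i e.
  by move=> /allP p; rewrite -mes => /p /eqP.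
rewrite (eq_bigr (fun i => (P i)%:R *: (a i ^+ k.+1 *: v))); last first.
  by move=> i _; rewrite prod_bool.
have [/existsP[i Pi]|/existsPn nP] := boolP [exists i, P i].
  rewrite (bigD1 i) // big1 => [|j ji]; last first.
    have [Pj|_] := boolP (P j); last by rewrite scale0r.
    by move: (PE _ 0%N Pi); rewrite (PE _ 0%N Pj) // => /(_ isT) [] E1; rewrite E1 eqxx in ji.
  rewrite [RHS]addr0 Pi scale1r -[skel _]/(wheel_skel k.+1) -[verts _]/(wheel_verts k.+1).
  congr (_ *: _).
    rewrite /coef /wheel_verts big_map.
    rewrite (eq_big_seq (fun _ => a i)) => [|j]; last first.
      rewrite mem_iota add0n => /andP[_ jk] /=.
      have jk' : ((j.+1) %% k.+1 < k.+1)%N by apply: ltn_pmod.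
      rewrite !(PE i) // ?ltn_add2l // ?(leq_trans jk) ?(leq_trans jk') ?leq_addr //.
      by rewrite /g jk jk' ltnNge leq_addr /= eqxx.
    by rewrite -[LHS]/(\prod_(0 <= j < k.+1) a i) prodr_const_nat.
  rewrite /wheel_skel; have : all (fun e => s e == None) (iota k.+1 k.+1).
    apply/allP => e; rewrite mem_iota => /andP[h1 h2]; rewrite (PE _ _ Pi) //.
    by rewrite /g ltnNge h1.
  move: (iota k.+1 k.+1) => l0; elim: l0 => //= e l IH /andP[/eqP se /IH ->].
  by rewrite /act1 /= se.
rewrite big1 => [|i _]; last by rewrite (negbTE (nP i)) scale0r.
(* At a contributing vertex the outgoing label is never [None], and every cycle edge leaves a
   vertex. So all cycle labels would be the same [Some i] and all spokes [None], against [nP]. *)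
suff -> : coef fock_f (wheel_verts k.+1) s = 0 by rewrite scale0r.
apply/eqP; apply: contraT; rewrite /coef /wheel_verts big_map prodf_seq_neq0 => /allP h.
have {h} h j : (j < k.+1)%N ->
    exists2 i, s ((j.+1) %% k.+1)%N = Some i & (s j = Some i) /\ s (k.+1 + j)%N = None
      \/ s j = None.
  move=> jk; have := h j; rewrite mem_iota add0n => /(_ jk) /=.
  case: (s _) => [i|]; case: (s j) => [i'|]; case: (s _) => [i''|] //=; rewrite ?eqxx //.
    by exists i''; [|right].
  by case: (eqVneq i' i'') => [->|]; rewrite ?eqxx // => _; exists i''; [|left].
have sS j : (j < k.+1)%N -> s j != None.
  case: j => [_|j jk]; first by have [i] := h k (ltnSn k); rewrite modnn => ->.
  by have [i] := h j (ltnW jk); rewrite modn_small // => ->.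
have [i s0] : exists i, s 0%N = Some i by case: (s 0%N) (sS 0%N isT) => // i _; exists i.
have sj j : (j < k.+1)%N -> s j = Some i.
  elim: j => // j IH jk; have [i' E1 E2] := h j (ltnW jk).
  move: E1 E2; rewrite modn_small // IH 1?ltnW // => ->.
  by case=> [[[->]]|].
case/negP: (nP i); apply/allP => e; rewrite mes => ek; rewrite /g.
case: ltnP => ek'; first by rewrite sj.
have [i' E1] : exists2 i', s ((e - k.+1).+1 %% k.+1)%N = Some i' &
   (s (e - k.+1)%N = Some i' /\ s (k.+1 + (e - k.+1))%N = None) \/ s (e - k.+1)%N = None.
  by apply: h; lia.
by rewrite subnKC // sj; [case=> [[_ ->]|] | lia].
Qed.
End Fock.

(** * Zariski density of the eigenvalues *)

Section Values.
Variable I : choiceType.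
Implicit Types (m : {cmonom I}) (z w : I -> rat) (p : poly_alg I).

Definition mval z m : rat := \prod_(i <- finsupp m) z i ^+ m i.
Definition pval z p : rat := \sum_(m <- msupp p) p@_m * mval z m.

Lemma mvalEw (d : {fset I}) z m : finsupp m `<=` d -> mval z m = \prod_(i <- d) z i ^+ m i.
Proof.
move=> le; rewrite /mval; apply: big_fset_incl => // i _.
by rewrite -cmE_eq0 => /eqP ->; rewrite expr0.
Qed.

Lemma mvalM z w m : mval (fun i => z i * w i) m = mval z m * mval w m.
Proof. by rewrite /mval -big_split; apply: eq_bigr => i _; rewrite exprMn. Qed.

Lemma mval1 m : mval (fun _ => 1) m = 1.
Proof. by rewrite /mval big1 // => i _; rewrite expr1n. Qed.

Lemma mval_separates m m' : m != m' -> exists z, mval z m != mval z m'.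
Proof.
move=> mm'; have [i mi] : exists i, m i != m' i.
  apply/not_existsP => h; case/negP: mm'; apply/cmP => i.
  by apply/eqP; rewrite -[_ == _]negbK; apply/negP; apply: h.
(* The value is then 2 to the exponent of [i], and the exponents differ. *)
exists (fun j => if j == i then 2%:R else 1).
have E k : mval (fun j => if j == i then 2%:R else 1) k = 2%:R ^+ k i.
  have ik : i \in i |` finsupp k by rewrite !inE eqxx.
  rewrite (@mvalEw (i |` finsupp k)) ?fsubsetU1 // (big_fsetD1 i) //= eqxx.
  by rewrite big1_fset ?mulr1 // => j; rewrite !inE => /andP[/negbTE -> _] _; rewrite expr1n.
by rewrite !E -!natrX eqr_nat eqn_exp2l.
Qed.

(* Dedekind: distinct monomials are distinct characters of the multiplicative
   monoid of points, hence linearly independent. *)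
Lemma dedekind (s : seq {cmonom I}) (c : {cmonom I} -> rat) : uniq s ->
  (forall z, \sum_(m <- s) c m * mval z m = 0) -> {in s, forall m, c m = 0}.
Proof.
elim: s c => [|m s IH] c //= /andP[ms Us] h.
have cs : {in s, forall m', c m' = 0}.
  move=> m' m's; have mm' : m' != m by apply: contraNneq ms => <-.
  have [y sep] := mval_separates mm'.
  have := IH (fun k => c k * (mval y k - mval y m)) Us _ _ m's => H.
  have /eqP : c m' * (mval y m' - mval y m) = 0.
    apply: H => z; have := h (fun i => z i * y i); have := h z.
    rewrite !big_cons mvalM => h1 h2.
    transitivity (\sum_(k <- s) c k * mval (fun i => z i * y i) k
      - mval y m * \sum_(k <- s) c k * mval z k).
      rewrite mulr_sumr -sumrB; apply: eq_bigr => k _; rewrite mvalM; ring.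
    move/eqP: h1; move/eqP: h2; rewrite !addr_eq0 => /eqP E1 /eqP E2.
    by rewrite -[X in X - _]opprK -E1 -[X in _ - _ * X]opprK -E2; ring.
  by rewrite mulf_eq0 subr_eq0 (negbTE sep) orbF => /eqP.
move=> m'; rewrite inE => /orP[/eqP ->|/cs //].
have := h (fun _ => 1); rewrite big_cons big_seq big1 ?addr0 => [|k /cs ->]; last by rewrite mul0r.
by rewrite mval1 mulr1.
Qed.

Lemma pval_all0 p : (forall z, pval z p = 0) -> p = 0.
Proof.
move=> h; apply/malgP => m; rewrite mcoeff0.
have [mp|/mcoeff_outdom //] := boolP (m \in msupp p).
exact: (dedekind (fset_uniq _) h mp).
Qed.

Lemma pval_eq z w p : (forall m i, m \in msupp p -> i \in finsupp m -> z i = w i) ->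
  pval z p = pval w p.
Proof.
move=> h; apply: eq_big_seq => m mp; congr (_ * _).
by apply: eq_big_seq => i im; rewrite (h m).
Qed.

Lemma poly_nat_roots (P : {poly rat}) : (forall k : nat, P.[k%:R] = 0) -> P = 0.
Proof.
move=> h; apply/eqP; apply: contraT => P0.
have := @max_poly_roots _ P [seq k%:R | k <- iota 0 (size P)] P0.
rewrite size_map size_iota ltnn; apply.
  by apply/allP => _ /mapP[k _ ->]; apply/rootP.
by rewrite map_inj_uniq ?iota_uniq // => i j /eqP; rewrite eqr_nat => /eqP.
Qed.

(** Along a line the value is a polynomial in the parameter, here with infinitely many roots. *)
Lemma pval_line z w p : (forall k : nat, pval (fun i => z i + k%:R * w i) p = 0) ->
  forall s, pval (fun i => z i + s * w i) p = 0.
Proof.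
move=> h s.
pose P := \sum_(m <- msupp p) p@_m *: \prod_(i <- finsupp m) ((z i)%:P + w i *: 'X) ^+ m i.
have E t : P.[t] = pval (fun i => z i + t * w i) p.
  rewrite /P horner_sum; apply: eq_bigr => m _; rewrite hornerZ horner_prod.
  congr (_ * _); apply: eq_bigr => i _.
  by rewrite horner_exp hornerD hornerC hornerZ hornerX [w i * t]mulrC.
have P0 : P = 0 by apply: poly_nat_roots => k; rewrite E.
by rewrite -E P0 horner0.
Qed.
End Values.

Lemma power_sums_solve N (d : nat -> rat) : exists r : seq (rat * rat),
  forall q, (q < N)%N -> \sum_(u <- r) u.2 * u.1 ^+ q.+1 = d q.
Proof.
pose a : 'rV[rat]_N := \row_i (i.+1)%:R.
pose A := diag_mx a *m (Vandermonde N a)^T.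
have uA : A \in unitmx.
  rewrite unitmxE det_mulmx det_tr det_diag det_Vandermonde unitrM !unitfE.
  apply/andP; split; apply/prodf_neq0 => i _; first by rewrite mxE pnatr_eq0.
  apply/prodf_neq0 => j ij; rewrite !mxE subr_eq0 eqr_nat eqSS.
  by rewrite gtn_eqF.
pose s := (\row_q d q) *m invmx A.
exists [seq ((i.+1)%:R, s 0 i) | i : 'I_N] => q qN.
rewrite big_image /=; have := mulmxKV uA (\row_q d q).
rewrite -/s => E; have := congr1 (fun M : 'rV_N => M 0 (Ordinal qN)) E.
rewrite [RHS]mxE /= => <-; rewrite mxE; apply: eq_bigr => i _; congr (_ * _).
by rewrite /A mul_diag_mx !mxE exprS.
Qed.

(** The eigenvalues of the free generators in the representation with parameters [l] and [lam]; here
    [gW j] stands for the wheel with j + 2 spokes. *)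
Definition point (l : seq rat) (lam : rat) (g : gen) : rat :=
  match g with
  | gL => lam + \sum_(x <- l) x
  | gR => lam
  | gW j => \sum_(x <- l) x ^+ j.+2
  end.

(** Power sums are additive in the list, so repeating an entry k times moves the point k steps in a
    fixed direction. *)
Lemma point_nseq t k l lam g :
  point (nseq k t ++ l) lam g = point l lam g + k%:R * point [:: t] 0 g.
Proof.
case: g => [||j] /=; rewrite ?big_cat ?big_nseq ?big_seq1 ?iter_addr_0 ?add0r ?mulr0 ?addr0 //.
  by rewrite addrA addrAC mulr_natl.
by rewrite addrC mulr_natl.
Qed.

(** Vanishing at all natural steps extends to rational multiples by [pval_line], one direction at a
    time. *)
Lemma pval_span p (r : seq (rat * rat)) : (forall l lam, pval (point l lam) p = 0) ->
  forall l lam,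
  pval (fun g => point l lam g + \sum_(u <- r) u.2 * point [:: u.1] 0 g) p = 0.
Proof.
move=> h; elim: r => [|[t s] r IH] l lam.
  apply: etrans (h l lam); apply: pval_eq => m g _ _.
  by rewrite big_nil addr0.
pose z g := point l lam g + \sum_(u <- r) u.2 * point [:: u.1] 0 g.
rewrite (@pval_eq _ _ (fun g => z g + s * point [:: t] 0 g)); last first.
  by move=> m g _ _; rewrite big_cons /z -addrA [s * _ + _]addrC.
apply: pval_line => k; apply: etrans (IH (nseq k t ++ l) lam).
by apply: pval_eq => m g _ _; rewrite point_nseq addrAC.
Qed.

Lemma wheel_bound (s : seq gen) : exists N, forall j, gW j \in s -> (j < N)%N.
Proof.
elim: s => [|g s [N h]]; first by exists 0%N.
exists (N + (if g is gW j then j.+1 else 0%N))%N => j; rewrite inE => /orP[/eqP <-|/h]; lia.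
Qed.

Lemma points_dense p : (forall l lam, pval (point l lam) p = 0) -> p = 0.
Proof.
move=> h; apply: pval_all0 => z.
pose gens := flatten [seq (finsupp m : seq gen) | m : {cmonom gen} <- msupp p].
(* Only finitely many wheel variables occur in [p], so only finitely many power sums have to be
   prescribed. *)
have [N hN] := wheel_bound gens.
(* Index 0 is the first power sum, the difference between the values of [gL] and [gR]; index j + 1
   is the power sum of exponent j + 2. The value of [gR] is taken care of by [lam]. *)
pose d q := if q is j.+1 then z (gW j) else z gL - z gR.
have [r hr] := power_sums_solve N.+1 d.
apply: etrans (pval_span r h [::] (z gR)); apply: pval_eq => m g mp gm.
have gg : g \in gens by apply/flatten_mapP; exists m.
case: g gm gg => [||j] gm gg /=; rewrite ?big_nil.
- rewrite addr0; have := hr 0%N isT; rewrite /d => E1.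
  rewrite (eq_bigr (fun u => u.2 * u.1 ^+ 1)) => [|u _]; last by rewrite big_seq1 add0r.
  by rewrite E1 addrC subrK.
- by rewrite big1 ?addr0 // => u _; rewrite mulr0.
rewrite add0r (eq_bigr (fun u => u.2 * u.1 ^+ j.+2)) => [|u _]; last by rewrite big_seq1.
by rewrite hr // ltnS hN.
Qed.

(** * Presentation of the algebra *)

Section PolynomialAlgebra.
Variable I : choiceType.
Implicit Types (m : {cmonom I}) (p q : poly_alg I).

Lemma pvarX (i : I) n : exists2 m, pvar i ^+ n = << m >> :> poly_alg I & forall j, m j = ((i == j) * n)%N.
Proof.
elim: n => [|n [m E h]]; first by exists mone => // j; rewrite muln0 cm1.
exists (mmul (ucm i) m); first by rewrite exprS E; exact: malgUM.
by move=> j; rewrite cmM cmU h mulnS.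
Qed.

Lemma malg_monomial m : << m >> = \prod_(i <- finsupp m) pvar i ^+ m i :> poly_alg I.
Proof.
have H (s : seq I) : uniq s -> exists2 m', \prod_(i <- s) pvar i ^+ m i = << m' >> :> poly_alg I
    & forall j, m' j = ((j \in s) * m j)%N.
  elim: s => [|i s IH] /=; first by exists mone; rewrite ?big_nil // => j; rewrite cm1.
  case/andP=> nis /IH [m' E h]; have [m1 E1 h1] := pvarX i (m i).
  exists (mmul m1 m').
    rewrite big_cons.
    exact (etrans (congr2 (fun x y : poly_alg I => x * y) E1 E) (malgUM m1 m')).
  move=> j; rewrite cmM h h1 inE; case: (eqVneq j i) => [->|ji].
    by rewrite (negbTE nis) mul0n addn0.
  by [].
have [m' -> h] := H _ (fset_uniq (finsupp m)).
congr << _ >>; apply/eqP/cmP => j; rewrite h.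
by rewrite -cmE_neq0; case: (eqVneq (m j) 0%N) => [->|_]; rewrite ?mul1n.
Qed.

Lemma poly_alg_ind (P : poly_alg I -> Prop) : P 0 -> P 1 ->
  (forall a p q, P p -> P q -> P (a *: p + q)) ->
  (forall p q, P p -> P q -> P (p * q)) -> (forall i, P (pvar i)) -> forall p, P p.
Proof.
move=> P0 P1 PD PM PX p; rewrite [p]monalgE; elim: (msupp p : seq _) => [|m s IH].
  by rewrite big_nil.
rewrite big_cons malg_scaleU; apply: (PD _ _ _ _ IH); rewrite malg_monomial.
elim: (finsupp m : seq _) => [|i l IHl]; first by rewrite big_nil.
rewrite big_cons; apply: (PM _ _ _ IHl); elim: (m i) => [|n IHn]; first by rewrite expr0.
by rewrite exprS; apply: (PM _ _ (PX i) IHn).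
Qed.

Lemma poly_hom_ext (B : algType rat) (F G : poly_alg I -> B) : linear F -> linear G ->
  F 1 = G 1 -> (forall p q, F (p * q) = F p * F q) -> (forall p q, G (p * q) = G p * G q) ->
  (forall i, F (pvar i) = G (pvar i)) -> F =1 G.
Proof.
move=> lF lG FG1 FM GM FX; apply: poly_alg_ind => [||a p q Ep Eq|p q Ep Eq|//].
- by rewrite (linear_at0 lF) (linear_at0 lG).
- exact: FG1.
- by rewrite lF lG Ep Eq.
- by rewrite FM GM Ep Eq.
Qed.

Variable wt : I -> nat.

Lemma mon_degEw (d : {fset I}) m : finsupp m `<=` d ->
  mon_deg wt m = (\sum_(i <- d) m i * wt i)%N.
Proof.
move=> le; rewrite /mon_deg; apply: big_fset_incl => // i _.
by rewrite -cmE_eq0 => /eqP ->.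
Qed.

Lemma mon_degM m m' : mon_deg wt (mmul m m') = (mon_deg wt m + mon_deg wt m')%N.
Proof.
rewrite {1}/mon_deg mdomD (mon_degEw (fsubsetUl _ (finsupp m'))).
rewrite (mon_degEw (fsubsetUr (finsupp m) _)) -big_split /=.
by apply: eq_bigr => i _; rewrite cmM mulnDl.
Qed.

Lemma poly_homog0 n : poly_homog wt n 0.
Proof. by move=> m; rewrite msupp0 in_fset0. Qed.

Lemma poly_homogP n a p q : poly_homog wt n p -> poly_homog wt n q ->
  poly_homog wt n (a *: p + q).
Proof.
move=> hp hq m /(fsubsetP (msuppD_le _ _)); rewrite inE => /orP[|/hq //].
by move=> /(fsubsetP (msuppZ_le _ _)) /hp.
Qed.

Lemma poly_homogB n p q : poly_homog wt n p -> poly_homog wt n q -> poly_homog wt n (p - q).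
Proof.
move=> hp hq; have -> : p - q = -1 *: q + p by rewrite scaleN1r addrC.
exact: poly_homogP.
Qed.

Lemma poly_homogM n k p q : poly_homog wt n p -> poly_homog wt k q ->
  poly_homog wt (n + k) (p * q).
Proof. by move=> hp hq m /msuppM_le [m1 [m2 [/hp <- /hq <- ->]]]; apply: mon_degM. Qed.

Lemma poly_homog_var i : poly_homog wt (wt i) (pvar i).
Proof.
move=> m; rewrite /pvar msuppU1 => /fset1P ->.
by rewrite /mon_deg mdomU big_seq_fset1 cmUU mul1n.
Qed.

Lemma poly_homog1 : poly_homog wt 0 1.
Proof.
move=> m; have -> : msupp (1 : poly_alg I) = msupp (<< mone >> : poly_alg I) by [].
rewrite msuppU1 => /fset1P ->.
by rewrite /mon_deg mdom1 big_seq_fset0.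
Qed.

Variable el : I -> Aw.
Hypothesis elR : exists2 p, poly_homog wt 1 p & aw_eval el p = D_R.
Hypothesis elW : forall k, exists2 p, poly_homog wt k.+1 p & aw_eval el p = omega k.

Let V n x := exists2 p, poly_homog wt n p & aw_eval el p = x.

Lemma preimage_subspace n : subspace (V n).
Proof.
split; first by exists 0; [apply: poly_homog0 | apply: (linear_at0 (aw_eval_linear el))].
move=> a _ _ [p hp <-] [q hq <-]; exists (a *: p + q); first exact: poly_homogP.
exact: aw_eval_linear.
Qed.

(** The second use of the spanning argument, now keeping track of the degree. *)
Lemma preimage_word w n : size w = n.*2 -> V n (clw w).
Proof.
apply: (span_word preimage_subspace).
- by exists 1; [apply: poly_homog1 | apply: aw_eval1].
- move=> k _ [p hp <-]; have [r hr <-] := elR; exists (r * p); last exact: aw_evalM.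
  exact: (poly_homogM hr hp).
- move=> k j _ [p hp <-]; have [r hr <-] := elW k; exists (r * p); last exact: aw_evalM.
  by rewrite addnC; exact: (poly_homogM hr hp).
Qed.

Lemma homog_preimage n x : aw_homog n x -> V n x.
Proof.
case=> v -> hv; have sV := preimage_subspace n.
rewrite [v]monalgE big_seq /awpi linear_sum.
apply: big_ind => [|x1 x2|D Dv]; [exact: (sub0 sV) | exact: (subD sV) |].
rewrite malg_scaleU linearZ; apply: (subZ sV).
have := preimage_word (hv D Dv); rewrite clwE; exact.
Qed.

Lemma aw_eval_surj x : exists p, aw_eval el p = x.
Proof.
elim: (clw_span x) => [|a r t [w ->] _ [q <-]].
  by exists 0; exact: (linear_at0 (aw_eval_linear el)).
have [p <-] : exists p, aw_eval el p = clw w; last first.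
  by exists (a *: p + q); exact: aw_eval_linear.
have [g|ng] := boolP (gauss w).
  by have [p _ <-] := preimage_word (gauss_even g); exists p.
by rewrite (clw_ngauss ng); exists 0; exact: (linear_at0 (aw_eval_linear el)).
Qed.
End PolynomialAlgebra.

(** * Independence of the free generators *)

Section Eigenvalues.
Variables (n : nat) (a : 'I_n -> rat) (lam : rat).
Notation eigen := (eigen a lam).

Lemma eigen_unique x c d : eigen x c -> eigen x d -> c = d.
Proof.
move=> hc hd; apply/eqP; rewrite -subr_eq0; apply/eqP.
apply: (@fm_basis_neq0 _ (free_module_exists {ffun 'I_n -> nat}) _ [ffun _ => 0%N]).
by rewrite scalerBl -hc -hd; apply: subrr.
Qed.

Lemma eigenX x c k : eigen x c -> eigen (x ^+ k) (c ^+ k).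
Proof.
move=> h; elim: k => [|k IH]; first by rewrite !expr0; exact: eigen1.
by rewrite !exprS; exact: eigenM h IH.
Qed.

Lemma eigen_aw_eval (I : choiceType) (el : I -> Aw) (z : I -> rat) p :
  (forall i, eigen (el i) (z i)) -> eigen (aw_eval el p) (pval z p).
Proof.
move=> h; have hm m : eigen (aw_eval el << m >>) (mval z m).
  rewrite aw_evalU /mval; elim: (finsupp m : seq _) => [|i s IH].
    by rewrite !big_nil; exact: eigen1.
  by rewrite !big_cons; exact: eigenM (eigenX _ (h i)) IH.
move=> v; rewrite {1}[p]monalgE (linear_bigE _ _ (aw_eval_linear el)).
rewrite (linear_bigE _ _ (fock_linear a lam v)) /pval scaler_suml; apply: eq_bigr => m _.
rewrite malg_scaleU (linear_scale _ _ (aw_eval_linear el)).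
by rewrite (linear_scale _ _ (fock_linear a lam v)) hm scalerA.
Qed.
End Eigenvalues.

Section VariableDifference.
Variables (I : choiceType) (S : lmodType rat) (F : poly_alg I -> S) (el : I -> S).
Hypotheses (lF : linear F) (Fv : forall i, F (pvar i) = el i).

Lemma linear_subvar i j : F (pvar i - pvar j) = el i - el j.
Proof.
exact (etrans (linearB_fun (pvar i) (pvar j) lF) (congr2 (fun x y => x - y) (Fv i) (Fv j))).
Qed.

Lemma linear_subvar2 i j k : F (pvar i - (pvar j - pvar k)) = el i - (el j - el k).
Proof.
exact (etrans (linearB_fun (pvar i) (pvar j - pvar k) lF)
  (congr2 (fun x y => x - y) (Fv i) (linear_subvar j k))).
Qed.
End VariableDifference.

(** [omega j] has j + 1 spokes, so here the wheels start at w_2, while those of [wheel_gen] start at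
    w_1. *)
Definition free_gen (g : gen) : Aw :=
  match g with gL => D_L | gR => D_R | gW j => omega j.+1 end.
Definition wheel_gen (g : gen) : Aw :=
  match g with gL => D_L | gR => D_R | gW j => omega j end.

Lemma sum_nth_seq (l : seq rat) k : \sum_(i < size l) l`_i ^+ k = \sum_(x <- l) x ^+ k.
Proof. by rewrite (big_nth 0) big_mkord. Qed.

Lemma eigen_omega n (a : 'I_n -> rat) lam k : eigen a lam (omega k) (\sum_i a i ^+ k.+1).
Proof. exact: fock_represents_wheel (represents_wheel k). Qed.

Lemma eigen_free_gen l lam g :
  eigen (fun i : 'I_(size l) => l`_i) lam (free_gen g) (point l lam g).
Proof.
case: g => [||j] /=.
- have := eigen_D_L (fun i : 'I_(size l) => l`_i) lam.
  suff -> : \sum_(i < size l) l`_i = \sum_(x <- l) x by [].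
  by rewrite (big_nth 0) big_mkord.
- exact: eigen_D_R.
- by have := @eigen_omega (size l) (fun i => l`_i) lam j.+1; rewrite sum_nth_seq.
Qed.

Lemma free_gen_eigenvalue l lam p :
  eigen (fun i : 'I_(size l) => l`_i) lam (aw_eval free_gen p) (pval (point l lam) p).
Proof. by apply: eigen_aw_eval => g; apply: eigen_free_gen. Qed.

Lemma free_gen_inj0 p :
  (forall l lam, eigen (fun i : 'I_(size l) => l`_i) lam (aw_eval free_gen p) 0) -> p = 0.
Proof.
move=> h; apply: points_dense => l lam.
exact (eigen_unique (@free_gen_eigenvalue l lam p) (h l lam)).
Qed.

Lemma eigen_sub n (a : 'I_n -> rat) lam x y c :
  eigen a lam x c -> eigen a lam y c -> eigen a lam (x - y) 0.
Proof.
move=> hx hy v; rewrite (linearB_fun _ _ (fock_linear a lam v)) hx hy scale0r.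
exact: subrr.
Qed.

Lemma free_gen_inj p q : aw_eval free_gen p = aw_eval free_gen q -> p = q.
Proof.
move=> E; apply/eqP; rewrite -subr_eq0; apply/eqP; apply: free_gen_inj0 => l lam.
rewrite (linearB_fun _ _ (aw_eval_linear free_gen)) E.
exact: eigen_sub (@free_gen_eigenvalue l lam q) (@free_gen_eigenvalue l lam q).
Qed.

(** The wheel with one spoke has an empty iterated bracket and is the commutator of H_0 and T_0. *)
Lemma D_L_omega : D_L - D_R = omega 0.
Proof.
rewrite /D_L /D_R -!clwE /omega /= mon0 mul1r /wh /br /= clB -!mon_cat !clM.
by [].
Qed.

Lemma free_gen_R : exists2 p, poly_homog (gen_deg 2) 1 p & aw_eval free_gen p = D_R.
Proof.
by exists (pvar gR); [exact: (@poly_homog_var _ (gen_deg 2) gR) | exact: aw_eval_var].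
Qed.

Lemma free_gen_W k : exists2 p, poly_homog (gen_deg 2) k.+1 p & aw_eval free_gen p = omega k.
Proof.
case: k => [|k]; last first.
  by exists (pvar (gW k)); [exact: (@poly_homog_var _ (gen_deg 2) (gW k)) | exact: aw_eval_var].
exists (pvar gL - pvar gR).
  exact: poly_homogB (@poly_homog_var _ (gen_deg 2) gL) (@poly_homog_var _ (gen_deg 2) gR).
exact: etrans (linear_subvar (aw_eval_linear free_gen) (aw_eval_var free_gen) gL gR) D_L_omega.
Qed.

Lemma wheel_gen_R : exists2 p, poly_homog (gen_deg 1) 1 p & aw_eval wheel_gen p = D_R.
Proof.
by exists (pvar gR); [exact: (@poly_homog_var _ (gen_deg 1) gR) | exact: aw_eval_var].
Qed.

Lemma wheel_gen_W k : exists2 p, poly_homog (gen_deg 1) k.+1 p & aw_eval wheel_gen p = omega k.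
Proof.
by exists (pvar (gW k)); [exact: (@poly_homog_var _ (gen_deg 1) (gW k)) | exact: aw_eval_var].
Qed.

Lemma omega_homog k : aw_homog k.+1 (omega k).
Proof.
apply: (aw_homog_cl _ (ctM (ct_mon (tails (iota 0 k))) (ct_wh k (iota 0 k)))).
by rewrite !size_cat size_heads !size_tails size_rcons size_iota /=; lia.
Qed.

Lemma aw_counit_homog n x : aw_homog n.+1 x -> aw_counit x = 0.
Proof.
have sP : subspace (fun x => aw_counit x = 0).
  split; first exact: (linear_at0 aw_counit_linear).
  by move=> a y z y0 z0; rewrite aw_counit_linear y0 z0 scaler0 addr0.
case=> v -> hv; rewrite [v]monalgE big_seq /awpi linear_sum.
apply: (big_ind (fun x => aw_counit x = 0)) => [|y z|D Dv]; [exact: (sub0 sP) | exact: (subD sP) |].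
rewrite malg_scaleU linearZ; apply: (subZ sP).
apply: etrans (aw_counitE D) _; case: eqP => // E.
by have := hv D Dv; rewrite E.
Qed.

(** All values of a wheel have the same eigenvalues, and these separate elements of the algebra,
    since every element is a polynomial in the free generators. *)
Lemma wheel_unique k x : represents (wheel k.+1) x -> x = omega k.
Proof.
move=> rx; have [p Ep] := aw_eval_surj free_gen_R free_gen_W x.
have [q Eq] := aw_eval_surj free_gen_R free_gen_W (omega k).
rewrite -Ep -Eq; congr aw_eval; apply/eqP; rewrite -subr_eq0; apply/eqP.
apply: free_gen_inj0 => l lam.
rewrite (linearB_fun _ _ (aw_eval_linear free_gen)) Ep Eq.
exact: eigen_sub (fock_represents_wheel _ lam rx) (eigen_omega _ lam k).
Qed.

Lemma wheel_gen_homog g : aw_homog (gen_deg 1 g) (wheel_gen g).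
Proof.
case: g => [||j]; last exact: omega_homog.
- by rewrite /= /D_L -clwE; apply: aw_homog_clw.
- by rewrite /= /D_R -clwE; apply: aw_homog_clw.
Qed.

Lemma free_gen_homog g : aw_homog (gen_deg 2 g) (free_gen g).
Proof.
case: g => [||j]; last exact: omega_homog.
- exact: (wheel_gen_homog gL).
- exact: (wheel_gen_homog gR).
Qed.

Lemma wheel_gen_bialg :
  gbialg_morphism (poly_bialg (gen_deg 1)) aw_bialg (aw_morphism wheel_gen).
Proof.
apply: aw_morphism_bialg => [g|g|]; last exact: wheel_gen_homog.
  by case: g => [||j]; [exact: primitive_D_L | exact: primitive_D_R | exact: primitive_omega].
by have := wheel_gen_homog g; case: g => [||j]; apply: aw_counit_homog.
Qed.

Lemma free_gen_bialg :
  gbialg_morphism (poly_bialg (gen_deg 2)) aw_bialg (aw_morphism free_gen).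
Proof.
apply: aw_morphism_bialg => [g|g|]; last exact: free_gen_homog.
  by case: g => [||j]; [exact: primitive_D_L | exact: primitive_D_R | exact: primitive_omega].
by have := free_gen_homog g; case: g => [||j]; apply: aw_counit_homog.
Qed.

Lemma free_gen_iso : gbialg_iso (poly_bialg (gen_deg 2)) aw_bialg (aw_morphism free_gen).
Proof.
split; first exact: free_gen_bialg.
  have [h hK] := choice (aw_eval_surj free_gen_R free_gen_W).
  by exists h => [p|x]; [apply: free_gen_inj; apply: hK | apply: hK].
move=> n p hp; have [q hq E] := homog_preimage free_gen_R free_gen_W hp.
by rewrite -(free_gen_inj E).
Qed.

(** * The kernel of the presentation with all wheels *)

Definition wheel_elim (g : gen) : poly_alg gen :=
  match g with
  | gW 0 => pvar gL - pvar gR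
  | gW j.+1 => pvar (gW j)
  | g => pvar g
  end.
(** A section of [wheel_elim]; the shift translates between wheel variables counted from w_2 and
    from w_1. *)
Definition wheel_incl (g : gen) : poly_alg gen :=
  match g with gW j => pvar (gW j.+1) | g => pvar g end.

Lemma wheel_elimE p : aw_eval free_gen (evalp wheel_elim p) = aw_eval wheel_gen p.
Proof.
have l1 := @evalp_linear gen (poly_alg gen) wheel_elim; have l2 := aw_eval_linear free_gen.
move: p; apply: (poly_hom_ext (comp_linear l2 l1) (aw_eval_linear wheel_gen)).
- by rewrite (@evalp1 gen (poly_alg gen)) !aw_eval1.
- move=> p q.
  exact (etrans (congr1 (aw_eval free_gen) (@evalpM gen (poly_alg gen) wheel_elim p q))
    (aw_evalM _ _ _)).
- exact: aw_evalM.
move=> g; apply: (etrans _ (esym (aw_eval_var wheel_gen g))).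
apply: (etrans (congr1 (aw_eval free_gen) (@evalp_var gen (poly_alg gen) wheel_elim g))).
case: g => [||[|j]]; [exact: (aw_eval_var free_gen gL) | exact: (aw_eval_var free_gen gR) | |
  exact: (aw_eval_var free_gen (gW j))].
exact: etrans (linear_subvar l2 (aw_eval_var free_gen) gL gR) D_L_omega.
Qed.

Lemma ideal_mul (R : comPzRingType) (p p' s s' q q' e : R) :
  p - s = q * e -> p' - s' = q' * e -> p * p' - s * s' = (q * p' + s * q') * e.
Proof. by move=> h h'; transitivity ((p - s) * p' + s * (p' - s')); [|rewrite h h']; ring. Qed.

Lemma ideal_lin (R : algType rat) (a : rat) (p p' s s' q q' e : R) :
  p - s = q * e -> p' - s' = q' * e ->
  a *: p + p' - (a *: s + s') = (a *: q + q') * e.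
Proof. by move=> h h'; rewrite mulrDl -scalerAl -h -h' scalerBr opprD addrACA. Qed.

Lemma ideal_zero (R : comPzRingType) (p e : R) : p = 0 -> exists q, p = q * e.
Proof. by exists 0; rewrite mul0r. Qed.

Definition wheel_rel : poly_alg gen := pvar (gW 0) - (pvar gL - pvar gR).

(** The elements congruent to their image modulo [e] form a subalgebra, so it is enough to test the
    variables. *)
Lemma id_mod_ideal (I : choiceType) (F : poly_alg I -> poly_alg I) (e : poly_alg I) :
  linear F -> F 1 = 1 -> (forall p q, F (p * q) = F p * F q) ->
  (forall i, exists q, pvar i - F (pvar i) = q * e) -> forall p, exists q, p - F p = q * e.
Proof.
move=> lF F1 FM FX; apply: poly_alg_ind => [||a p q [u Eu] [v Ev]|p q [u Eu] [v Ev]|//].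
- by apply: ideal_zero; rewrite (linear_at0 lF); exact: subrr.
- by apply: ideal_zero; rewrite F1; exact: subrr.
- exists (a *: u + v); rewrite lF.
  exact (@ideal_lin (poly_alg I) a p q (F p) (F q) u v e Eu Ev).
- exists (u * q + F p * v); rewrite FM.
  exact (@ideal_mul (poly_alg I) p q (F p) (F q) u v e Eu Ev).
Qed.

Lemma mod_wheel_rel p :
  exists q, p - evalp wheel_incl (evalp wheel_elim p) = q * wheel_rel.
Proof.
have l1 := @evalp_linear gen (poly_alg gen) wheel_elim.
have l2 := @evalp_linear gen (poly_alg gen) wheel_incl.
have V2 := @evalp_var gen (poly_alg gen) wheel_incl.
have e1 el := @evalp1 gen (poly_alg gen) el.
move: p; apply: (id_mod_ideal (comp_linear l2 l1)).
- exact (etrans (congr1 (evalp wheel_incl) (e1 wheel_elim)) (e1 wheel_incl)).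
- move=> p q; exact (etrans
    (congr1 (evalp wheel_incl) (@evalpM gen (poly_alg gen) wheel_elim p q))
    (@evalpM gen (poly_alg gen) wheel_incl _ _)).
have z (x y : poly_alg gen) : y = x -> x - y = 0 by move=> ->; apply: subrr.
move=> g; have -> := @evalp_var gen (poly_alg gen) wheel_elim g.
case: g => [||[|j]].
- by apply: ideal_zero; apply: z; exact (V2 gL).
- by apply: ideal_zero; apply: z; exact (V2 gR).
- exists 1; apply: (etrans _ (esym (mul1r _))).
  exact (congr1 (fun x => pvar (gW 0) - x) (linear_subvar l2 V2 gL gR)).
- by apply: ideal_zero; apply: z; exact (V2 (gW j)).
Qed.

Lemma wheel_gen_ker p : aw_eval wheel_gen p = 0 <-> exists q, p = q * wheel_rel.
Proof.
split=> [E|[q ->]]; last first.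
  have E : aw_eval wheel_gen wheel_rel = omega 0 - (D_L - D_R).
    exact: (linear_subvar2 (aw_eval_linear wheel_gen) (aw_eval_var wheel_gen)).
  apply: (etrans (aw_evalM _ _ _)); rewrite E D_L_omega.
  have -> : omega 0 - omega 0 = 0 by exact: subrr.
  exact: mulr0.
(* By freeness, elimination of w_1 sends the kernel to 0. So [p] is its own difference from its
   round trip, which is a multiple of the relation. *)
have z : evalp wheel_elim p = 0.
  apply: free_gen_inj; rewrite wheel_elimE E.
  exact: esym (linear_at0 (aw_eval_linear free_gen)).
have [q Eq] := mod_wheel_rel p; exists q; rewrite -Eq z.
rewrite (linear_at0 (@evalp_linear gen (poly_alg gen) wheel_incl)).
exact: esym (subr0 _).
Qed.

Theorem theorem3p15 :
  exists w : nat -> Aw,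
    [/\ (* the wheels, as elements of Aw *)
        forall (k : nat) (x : Aw), (0 < k)%N ->
          (represents (wheel k) x <-> x = w k),
        (* polynomials in D_L, D_R, w_1, w_2, ... modulo w_1 = D_L - D_R *)
        exists f : {lrmorphism poly_alg gen -> Aw},
          [/\ gbialg_morphism (poly_bialg (gen_deg 1)) aw_bialg f,
              [/\ f (pvar gL) = D_L, f (pvar gR) = D_R
                & forall j : nat, f (pvar (gW j)) = w j.+1],
              forall x : Aw, exists p : poly_alg gen, f p = x,
              forall (n : nat) (x : Aw), homog aw_bialg n x ->
                exists2 p, homog (poly_bialg (gen_deg 1)) n p & f p = x
            & forall p : poly_alg gen,
                f p = 0 <->
                exists q, p = q * (pvar (gW 0) - (pvar gL - pvar gR))]
      & (* free on D_L, D_R, w_2, w_3, ... *)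
        exists g : {lrmorphism poly_alg gen -> Aw},
          [/\ gbialg_iso (poly_bialg (gen_deg 2)) aw_bialg g,
              g (pvar gL) = D_L, g (pvar gR) = D_R
            & forall j : nat, g (pvar (gW j)) = w j.+2]].
Proof.
(* The predecessor appears because [omega k] has k + 1 spokes; index 0 gets a default value. *)
exists (fun k => omega k.-1); split.
- by case=> // k x _; split=> [|->]; [apply: wheel_unique | apply: represents_wheel].
- exists (aw_morphism wheel_gen); split.
  + exact: wheel_gen_bialg.
  + split; [exact: (aw_eval_var wheel_gen gL) | exact: (aw_eval_var wheel_gen gR) |].
    by move=> j; exact: (aw_eval_var wheel_gen (gW j)).
  + exact: aw_eval_surj wheel_gen_R wheel_gen_W.
  + by move=> n x; exact: homog_preimage wheel_gen_R wheel_gen_W n x.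
  + exact: wheel_gen_ker.
exists (aw_morphism free_gen); split; first exact: free_gen_iso.
- exact: (aw_eval_var free_gen gL).
- exact: (aw_eval_var free_gen gR).
- by move=> j; exact: (aw_eval_var free_gen (gW j)).
Qed.
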